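(* Let $K$ be a field of characteristic zero and $R=K[x_1,\ldots,x_n]$. Let $h$ be the Hilbert function of a graded Artinian $K$-algebra $R/J$ having the $n$-WLP (resp. $n$-SLP). Let $I$ be the unique almost revlex ideal of $R$ whose quotient ring has the Hilbert function $h$. Then $R/I$ has the maximal graded Betti numbers among graded Artinian $K$-algebras with the Hilbert function $h$ and the $n$-WLP (resp. $n$-SLP); that is, $R/I$ belongs to this class and $\beta_{i,i+j}(R/I')\le\beta_{i,i+j}(R/I)$ for all $i,j$ and every graded ideal $I'\subset R$ such that $R/I'$ has Hilbert function $h$ and the $n$-WLP (resp. $n$-SLP).
   Context: $R=K[x_1,\ldots,x_n]$ has the standard grading. The Hilbert function of a graded algebra $A$ is $t\mapsto\dim_KA_t$; $A$ is Artinian if $\dim_KA<\infty$. SLP/WLP: for a graded Artinian $K$-algebra $A=\bigoplus_iA_i$ and $\ell\in A_1$, $(A,\ell)$ has the SLP (resp. WLP) if the map $\times\ell^s:A_i\to A_{i+s}$ has full rank (is injective or surjective) for every $i\ge0$ and every $s>0$ (resp. for $s=1$). $A$ has the $k$-SLP (resp. $k$-WLP) if there are $g_1,\ldots,g_k\in A_1$ such that $(A,g_1)$ has the SLP (resp. WLP) and $(A/(g_1,\ldots,g_{i-1}),g_i)$ has the SLP (resp. WLP) for all $i=2,\ldots,k$. Graded reverse lexicographic order $>_{\text{revlex}}$ (with $x_1>\cdots>x_n$): $x^a>_{\text{revlex}}x^b$ if $\deg x^a>\deg x^b$, or the degrees are equal and the last nonzero entry of $a-b$ is negative. Almost revlex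 ideal: a monomial ideal $I$ such that for each monomial $u$ in the minimal generating set of $I$, every monomial $v$ with $\deg v=\deg u$ and $v>_{\text{revlex}}u$ belongs to $I$. (Two almost revlex ideals with the same Hilbert function are equal.) Graded Betti numbers: $\beta_{i,i+j}(R/I)=\dim_K[\operatorname{Tor}_i^R(R/I,K)]_{i+j}$. *)

(* Defs.v *)
From mathcomp Require Import all_boot all_order all_algebra.
From mathcomp.multinomials Require Export mpoly.
From Stdlib Require Import ClassicalEpsilon.

Set Implicit Arguments.
Unset Strict Implicit.
Unset Printing Implicit Defensive.

Import GRing.Theory.
Local Open Scope ring_scope.

(* An ideal of R = K[x_1, ..., x_n] is a Prop-valued                          *)
(* predicate on {mpoly K[n]}, and a graded quotient R/I is handled through    *)
(* representatives: an element of (R/I)_t is the class of a form of degree t, *)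
(* and two forms have the same class when their difference is in I.  The unit *)
(* ideal is allowed (R/I = 0 occurs among the iterated quotients); this is    *)
(* why idealr_closed of ring_quotient, which requires 1 \notin I, is not      *)
(* used.  The variable x_(i+1) of the mathematics is 'X_i, i : 'I_n.          *)

Section GradedQuotients.
Context (K : fieldType) (n : nat).
Local Notation R := {mpoly K[n]}.
Implicit Types (I G : R -> Prop) (l : R).

Definition is_ideal I : Prop :=
  [/\ I 0, forall f g, I f -> I g -> I (f + g) & forall r f, I f -> I (r * f)].

Definition graded_ideal I : Prop :=
  is_ideal I /\ forall f d, I f -> I (pihomog mdeg d f).

Definition ideal_gen G : R -> Prop :=
  fun f => forall I, is_ideal I -> (forall g, G g -> I g) -> I f.

(* dim_K (R/I)_t = h t for all t: a basis of (R/I)_t with h t elements.       *)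
Definition is_hilbert_function I (h : nat -> nat) : Prop :=
  forall t, exists b : 'I_(h t) -> R,
    [/\ forall a, b a \is t.-homog,
        forall f, f \is t.-homog ->
          exists c : 'I_(h t) -> K, I (f - \sum_a c a *: b a)
      & forall c : 'I_(h t) -> K,
          I (\sum_a c a *: b a) -> forall a, c a = 0].

(* dim_K (R/I) < oo: a finite spanning family.                                *)
Definition artinian I : Prop :=
  exists (m : nat) (b : 'I_m -> R),
    forall f, exists c : 'I_m -> K, I (f - \sum_a c a *: b a).

Definition mult_injective I l (s i : nat) : Prop :=
  forall f, f \is i.-homog -> I (l ^+ s * f) -> I f.

Definition mult_surjective I l (s i : nat) : Prop :=
  forall g, g \is (i + s).-homog ->
    exists2 f, f \is i.-homog & I (g - l ^+ s * f).

(* l^s : (R/I)_i -> (R/I)_(i+s) has full rank.                                *)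
Definition mult_full_rank I l (s i : nat) : Prop :=
  mult_injective I l s i \/ mult_surjective I l s i.

Definition SLP I l : Prop := forall i s, (0 < s)%N -> mult_full_rank I l s i.
Definition WLP I l : Prop := forall i, mult_full_rank I l 1 i.

(* The ideal of R whose quotient is (R/I)/(g_0, ..., g_(i-1)).                *)
Definition add_gens I (k : nat) (g : 'I_k -> R) (i : nat) : R -> Prop :=
  ideal_gen (fun f => I f \/ exists2 j : 'I_k, (j < i)%N & f = g j).

Definition kSLP (k : nat) I : Prop :=
  exists g : 'I_k -> R, (forall i, g i \is 1.-homog) /\
    forall i : 'I_k, SLP (add_gens I g i) (g i).

Definition kWLP (k : nat) I : Prop :=
  exists g : 'I_k -> R, (forall i, g i \is 1.-homog) /\
    forall i : 'I_k, WLP (add_gens I g i) (g i).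

(* u >_revlex v.  The order carried by 'X_{1..n} in mpoly is the degree       *)
(* lexicographic one, hence this definition.                                  *)
Definition revlex_gt (u v : 'X_{1..n}) : Prop :=
  (mdeg v < mdeg u)%N \/
  mdeg u = mdeg v /\
    exists i : 'I_n, (u i < v i)%N /\ forall j : 'I_n, (i < j)%N -> u j = v j.

Definition generated_by_monomials I (S : 'X_{1..n} -> Prop) : Prop :=
  forall f, I f <-> ideal_gen (fun p => exists2 m, S m & p = 'X_[m]) f.

Definition minimal_monomial_generators I (S : 'X_{1..n} -> Prop) : Prop :=
  generated_by_monomials I S /\
  forall T : 'X_{1..n} -> Prop, (forall m, T m -> S m) ->
    generated_by_monomials I T -> forall m, S m -> T m.

Definition almost_revlex I : Prop :=
  exists2 S : 'X_{1..n} -> Prop, minimal_monomial_generators I S &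
    forall u v, S u -> mdeg v = mdeg u -> revlex_gt v u -> I 'X_[v].

(* A graded free resolution                                                   *)
(*     ... -> F_2 -> F_1 -> F_0 -> R/I -> 0,   F_i = \bigoplus_a R(- d_i(a)), *)
(* with a < gfr_rank i and d_i = gfr_deg i.  Elements of F_i are row vectors, *)
(* the differential F_(i+1) -> F_i is right multiplication by gfr_diff i, and *)
(* gfr_aug b represents the image in R/I of the b-th basis element of F_0.    *)
Record free_complex := FreeComplex {
  gfr_rank : nat -> nat;
  gfr_deg : forall i, 'I_(gfr_rank i) -> nat;
  gfr_diff : forall i, 'M[R]_(gfr_rank i.+1, gfr_rank i);
  gfr_aug : 'cV[R]_(gfr_rank 0)
}.

Definition graded_free_resolution I (F : free_complex) : Prop :=
  [/\ forall i a b, gfr_diff F i a b != 0 ->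
        exists2 e, gfr_deg a = (gfr_deg b + e)%N
                 & gfr_diff F i a b \is e.-homog,
      forall b, gfr_aug F b 0 \is (gfr_deg b).-homog,
      forall f, exists v : 'rV_(gfr_rank F 0), I (f - (v *m gfr_aug F) 0 0),
      forall v : 'rV_(gfr_rank F 0),
        I ((v *m gfr_aug F) 0 0) <-> exists w, v = w *m gfr_diff F 0
    & forall i (v : 'rV_(gfr_rank F i.+1)),
        v *m gfr_diff F i = 0 <-> exists w, v = w *m gfr_diff F i.+1].

(* The differential of F (x)_R K, K = R/(x_1, ..., x_n): constant terms.      *)
Definition tensor_diff (F : free_complex) i :
    'M[K]_(gfr_rank F i.+1, gfr_rank F i) :=
  map_mx (mcoeff 0%MM) (gfr_diff F i).

(* Row space: the part of degree d of F_i (x)_R K.                            *)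
Definition tensor_deg (F : free_complex) i (d : nat) : 'M[K]_(gfr_rank F i) :=
  diag_mx (\row_a (gfr_deg a == d)%:R).

Definition tensor_cycles (F : free_complex) i : 'M[K]_(gfr_rank F i) :=
  match i with
  | 0 => 1%:M
  | j.+1 => kermx (tensor_diff F j)
  end.

(* dim_K [H_i(F (x)_R K)]_d.                                                  *)
Definition tor_dim (F : free_complex) (i d : nat) : nat :=
  (\rank (tensor_cycles F i :&: tensor_deg F i d)%MS
     - \rank (tensor_deg F i.+1 d *m tensor_diff F i))%N.

(* beta_{i,d}(R/I) = dim_K [Tor_i^R(R/I, K)]_d, computed from some graded     *)
(* free resolution by modules of finite rank; one exists as R is Noetherian,  *)
(* and the value does not depend on it.                                       *)
Definition graded_betti I (i d : nat) : nat :=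
  epsilon (inhabits 0%N)
    (fun b => exists2 F, graded_free_resolution I F & b = tor_dim F i d).

Definition lefschetz_class (LP : (R -> Prop) -> Prop) (h : nat -> nat) I :
    Prop :=
  [/\ graded_ideal I, artinian I, is_hilbert_function I h & LP I].

Definition max_betti_in (C : (R -> Prop) -> Prop) I : Prop :=
  C I /\ forall I', C I' ->
    forall i j, (graded_betti I' i (i + j) <= graded_betti I i (i + j))%N.

(* The unique almost revlex ideal with Hilbert function h satisfies P.        *)
Definition the_almost_revlex_ideal (h : nat -> nat) (P : (R -> Prop) -> Prop) :
    Prop :=
  exists I, [/\ almost_revlex I, is_hilbert_function I h,
    forall I', almost_revlex I' -> is_hilbert_function I' h ->
      forall f, I' f <-> I f
  & P I].

End GradedQuotients.

(* Main.v *)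
(* Let g_1, ..., g_n be linear forms witnessing the n-WLP of R/I'; they may   *)
(* be taken linearly independent.  Reducing a free resolution F of R/I'       *)
(* modulo g_1, ..., g_k one form at a time, a cycle of F/(g_1, ..., g_(k+1))  *)
(* has boundary g_(k+1) w with w a cycle of F/(g_1, ..., g_k) in one degree   *)
(* less.  In the lowest homological degree, the class of w is in the kernel   *)
(* of g_(k+1) on R/(I', g_1, ..., g_k), whose dimension in degree e is        *)
(* h_k(e) - h_k(e + 1) (truncated) as g_(k+1) has full rank.  This bounds     *)
(* Tor(R/I', K) in terms of h only.                                           *)
(* The almost revlex ideal I is built from the lists of its standard          *)
(* monomials, and x_n, ..., x_1 witness its n-SLP.  Since I is strongly       *)
(* stable, each standard monomial u in x_1, ..., x_(p+1) with x_(p+1) u in I  *)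
(* and each set of i variables among x_1, ..., x_p yield a Koszul cycle of    *)
(* degree i + 1.  These cycles are independent modulo boundaries, and there   *)
(* are as many as the sum of the upper bounds over all internal degrees.      *)
(* Hence every upper bound is attained by I.                                  *)

Require Import Defs.
From HB Require Import structures.
From mathcomp Require Import all_boot all_order all_algebra.
From mathcomp Require Import zify ring.
From Stdlib Require Import Classical ClassicalEpsilon.

Set Implicit Arguments.
Unset Strict Implicit.
Unset Printing Implicit Defensive.

Import Order.TTheory GRing.Theory.
Local Open Scope ring_scope.

(** * Spanning modulo a subspace *)

(** Upper bound. Write [h_k] for the [k]-fold [dplus] of [h]; full rank makes it the Hilbert
    function of R/(I', g_1, ..., g_k). For independent forms, Tor(R/I', K) is the Koszul homology of
    g_1, ..., g_n on R/I'. Adjoining g_(k+1) to k forms gives a long exact sequence: the new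
    homology in position i + 1 and degree d is bounded by the old one plus the kernel of g_(k+1) on
    the old homology in position i and degree d - 1. For i > 0 this kernel is estimated by the whole
    homology; for i = 0 it is the kernel on R/(I', g_1, ..., g_k), whose dimension [h_k] determines.
    The recurrence [tor_bound] records this, [cyc_bound] proves it on a free resolution, and
    [tor_dim_le] turns it into bounds on Betti numbers ([tor_dimS_le], [tor_dim0_le]). Independent
    forms are supplied by [kWLP_unit].

    Sharpness. The ideal [stairI] keeps as standard monomials the revlex-smallest ones that the
    numbers [h_k] allow. The criterion [std_mulX] for standardness yields closure under division,
    strong stability, the almost revlex property and the n-SLP. If u is standard in x_0, ..., x_p
    and x_p u lies in the ideal, strong stability puts every x_j u with j < p in it too, so u e_S
    e_p is a Koszul cycle for each subset S of {0, ..., p - 1}. These cycles are independent modulo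
    boundaries ([kfam_free]), so they bound Tor from below ([koszul_tor_lower]). Their number is at
    least the sum of all upper bounds ([tor_bound_sum]), which forces equality in each degree
    ([stair_tor]).

    Since n-SLP implies n-WLP and [stairI] has the n-SLP, [stair_max_betti] treats both classes at
    once; [almost_revlex_unique] shows that no other almost revlex ideal has the Hilbert function
    [h]. *)

Lemma subspace_mx (K : fieldType) (N : nat) (W : 'rV[K]_N -> Prop) :
  W 0 -> (forall a u v, W u -> W v -> W (a *: u + v)) ->
  exists r (M : 'M[K]_(r, N)), row_free M /\ forall v, W v <-> (v <= M)%MS.
Proof.
move=> W0 Wlin.
suff [M hM] : exists M : 'M[K]_N, forall v, W v <-> (v <= M)%MS.
  exists _, (row_base M); split; first exact: row_base_free.
  by move=> v; rewrite hM eq_row_base.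
(* Ascent inside [W]: [k] bounds the codimension of a row space contained in [W], and a vector of
   [W] outside it raises the rank. *)
have [k] : exists k, exists2 M : 'M[K]_N,
    (N - \rank M <= k)%N & forall v, (v <= M)%MS -> W v.
  exists N, 0; first by rewrite mxrank0 subn0.
  by move=> v /submx0null ->.
elim: k => [|k IHk] [M rM hM].
  exists M => v; split=> [_|/hM //].
  by apply: submx_full; rewrite /row_full eqn_leq rank_leq_col -subn_eq0 -leqn0.
case: (classic (forall v, W v -> (v <= M)%MS)) => [h|h].
  by exists M => v; split; [exact: h | exact: hM].
have [v hv] := not_all_ex_not _ _ h.
have {h hv}[Wv /negP vM] : W v /\ ~ (v <= M)%MS by apply: imply_to_and.
apply: IHk; exists (v + M)%MS.
  have : (\rank M < \rank (v + M)%MS)%N.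
    rewrite ltn_neqAle mxrankS ?addsmxSr // andbT.
    apply: contra vM => /eqP e; have := (mxrank_leqif_sup (addsmxSr v M)).2.
    by rewrite e eqxx => /esym; rewrite addsmx_sub => /andP[].
  by have := rank_leq_col (v + M)%MS; lia.
move=> u /sub_addsmxP[[a b] /= ->].
rewrite [a]mx11_scalar mul_scalar_mx; apply: Wlin => //.
by apply: hM; apply: submxMl.
Qed.

Section SpannedModulo.
Context (K : fieldType) (n : nat).
Local Notation R := {mpoly K[n]}.

Definition K_subspace (V : lmodType R) (W : V -> Prop) : Prop :=
  W 0 /\ forall (a : K) u v, W u -> W v -> W (a%:MP *: u + v).

(* The image of [Z] modulo [B] has dimension at most [N] over [K]. *)
Definition spanned_mod (N : nat) (V : lmodType R) (Z B : V -> Prop) : Prop :=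
  exists2 M, (M <= N)%N & exists2 b : 'I_M -> V, forall i, Z (b i) &
    forall z, Z z -> exists c : 'I_M -> K, B (z - \sum_i (c i)%:MP *: b i).

Lemma K_subspaceD (V : lmodType R) (W : V -> Prop) u v :
  K_subspace W -> W u -> W v -> W (u + v).
Proof.
by move=> [_ h] Wu Wv; have := h 1 _ _ Wu Wv; rewrite mpolyC1 scale1r.
Qed.

Lemma K_subspaceZ (V : lmodType R) (W : V -> Prop) (a : K) u :
  K_subspace W -> W u -> W (a%:MP *: u).
Proof. by move=> [W0 h] Wu; have := h a _ _ Wu W0; rewrite addr0. Qed.

Lemma K_subspaceN (V : lmodType R) (W : V -> Prop) u :
  K_subspace W -> W u -> W (- u).
Proof.
by move=> hW Wu; have := K_subspaceZ (-1) hW Wu; rewrite mpolyCN mpolyC1 scaleN1r.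
Qed.

Lemma K_subspaceB (V : lmodType R) (W : V -> Prop) u v :
  K_subspace W -> W u -> W v -> W (u - v).
Proof. by move=> hW Wu Wv; apply: K_subspaceD => //; apply: K_subspaceN. Qed.

Lemma K_subspace_sum (V : lmodType R) (W : V -> Prop) (I : finType)
    (c : I -> K) (b : I -> V) :
  K_subspace W -> (forall i, W (b i)) -> W (\sum_i (c i)%:MP *: b i).
Proof.
move=> hW hb; elim/big_ind: _ => [|u v|i _]; first exact: hW.1.
  exact: K_subspaceD.
exact: K_subspaceZ.
Qed.

Lemma spanned_mod0 (V : lmodType R) (Z B : V -> Prop) :
  (forall z, Z z -> B z) -> spanned_mod 0 Z B.
Proof.
move=> h; exists 0%N => //; exists (fun=> 0) => [[]//|z Zz].
by exists (fun=> 0); rewrite big_ord0 subr0; apply: h.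
Qed.

(* [T] plays the role of a linear map [Z / B -> Z' / B'] whose kernel is      *)
(* covered by [Z0].                                                           *)
Lemma spanned_mod_ext (V V' : lmodType R) (Z Z0 B : V -> Prop)
    (Z' B' : V' -> Prop) (T : V -> V' -> Prop) N' N0 :
  K_subspace Z -> K_subspace B -> K_subspace B' ->
  T 0 0 ->
  (forall (a : K) z1 w1 z2 w2, T z1 w1 -> T z2 w2 ->
     T (a%:MP *: z1 + z2) (a%:MP *: w1 + w2)) ->
  (forall z, Z z -> exists2 w, Z' w & T z w) ->
  (forall z w, Z z -> T z w -> B' w -> exists2 z0, Z0 z0 & B (z - z0)) ->
  (forall z, Z0 z -> Z z) ->
  spanned_mod N' Z' B' -> spanned_mod N0 Z0 B -> spanned_mod (N' + N0) Z B.
Proof.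
move=> hZ hB hB' T0 Tlin TZ Tker Z0Z [M' leM' [b' Zb' hb']].
move=> [M0 leM0 [b0 Zb0 hb0]].
pose S' (c : 'rV[K]_M') := \sum_i (c 0 i)%:MP *: b' i.
have S'0 : S' 0 = 0.
  by rewrite /S' big1 // => i _; rewrite mxE mpolyC0 scale0r.
have S'lin a u v : S' (a *: u + v) = a%:MP *: S' u + S' v.
  rewrite /S' scaler_sumr -big_split /=; apply: eq_bigr => i _.
  by rewrite !mxE mpolyCD mpolyCM scalerDl scalerA.
(* Coefficient vectors of the classes in Z'/B' that [T] reaches from [Z]. A basis of this space has
   r <= M' elements; their lifts [zz i] to [Z] come first in the spanning family and [b0] covers the
   remainder. *)
pose W c := exists2 z, Z z & exists2 w, T z w & B' (w - S' c).
have W0 : W 0.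
  exists 0; first exact: hZ.1.
  by exists 0 => //; rewrite S'0 subrr; apply: hB'.1.
have Wlin a u v : W u -> W v -> W (a *: u + v).
  move=> [z1 Zz1 [w1 Tw1 B1]] [z2 Zz2 [w2 Tw2 B2]].
  exists (a%:MP *: z1 + z2); first exact: hZ.2.
  exists (a%:MP *: w1 + w2); first exact: Tlin.
  rewrite S'lin opprD addrACA -scalerBr; exact: hB'.2.
have [r [M [Mfree hM]]] := subspace_mx W0 Wlin.
have Wrow i : W (row i M) by apply/hM/row_sub.
have pick_z i : {z | Z z /\ exists2 w, T z w & B' (w - S' (row i M))}.
  apply: constructive_indefinite_description.
  by have [z Zz h] := Wrow i; exists z.
pose zz i := sval (pick_z i).
exists (r + M0)%N.
  apply: leq_add leM0; apply: leq_trans leM'.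
  by rewrite -(eqP Mfree) rank_leq_col.
exists (fun i => match split i with inl i => zz i | inr i => b0 i end).
  move=> i; case: (split i) => j; last exact/Z0Z/Zb0.
  by rewrite /zz; case: (pick_z j) => z [].
move=> z Zz.
have [w Zw Tw] := TZ _ Zz.
have [c hc] := hb' _ Zw.
have Wc : W (\row_i c i).
  exists z => //; exists w => //.
  by rewrite /S'; under eq_bigr do rewrite mxE.
have /submxP[l hl] := (hM _).1 Wc.
have [wz hwz] : exists wz : 'I_r -> V', forall i,
    T (zz i) (wz i) /\ B' (wz i - S' (row i M)).
  have pick_w i : {w | T (zz i) w /\ B' (w - S' (row i M))}.
    apply: constructive_indefinite_description.
    by rewrite /zz; case: (pick_z i) => y /= [_ [v]]; exists v.
  by exists (fun i => sval (pick_w i)) => i; case: (pick_w i).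
have Tsum (s : seq 'I_r) (d : 'I_r -> K) : T (\sum_(i <- s) (d i)%:MP *: zz i)
    (\sum_(i <- s) (d i)%:MP *: wz i).
  elim: s => [|i s IHs]; rewrite ?big_nil // !big_cons.
  by apply: Tlin => //; case: (hwz i).
pose z1 := \sum_i (l 0 i)%:MP *: zz i.
pose w1 := \sum_i (l 0 i)%:MP *: wz i.
have Tz1 : T (z - z1) (w - w1).
  have := Tlin (-1) _ _ _ _ (Tsum (index_enum _) (fun i => l 0 i)) Tw.
  by rewrite mpolyCN mpolyC1 !scaleN1r addrC [- _ + w]addrC.
have S'sum : S' (\row_i c i) = \sum_i (l 0 i)%:MP *: S' (row i M).
  rewrite hl mulmx_sum_row.
  elim: (index_enum _) => [|i s IHs]; first by rewrite !big_nil S'0.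
  by rewrite !big_cons S'lin IHs.
have Bw1 : B' (w - w1).
  have -> : w - w1 = (w - S' (\row_i c i)) -
      \sum_i (l 0 i)%:MP *: (wz i - S' (row i M)).
    under [in RHS]eq_bigr do rewrite scalerBr.
    by rewrite S'sum sumrB opprB addrA subrK.
  apply: K_subspaceB => //.
    by rewrite /S'; under eq_bigr do rewrite mxE.
  by apply: K_subspace_sum => // i; case: (hwz i).
have Zzz i : Z (zz i) by rewrite /zz; case: (pick_z i) => ? [].
have Zz1 : Z (z - z1).
  by apply: K_subspaceB => //; apply: K_subspace_sum.
have [z0 Zz0 Bz0] := Tker _ _ Zz1 Tz1 Bw1.
have [d hd] := hb0 _ Zz0.
exists (fun i => match split i with inl i => l 0 i | inr i => d i end).
rewrite big_split_ord /=.
under eq_bigr => i _ do rewrite (unsplitK (inl i)).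
have -> : \sum_(i < M0) match split (rshift r i) with
    | inl j => l 0 j | inr j => d j end%:MP_[n] *:
    match split (rshift r i) with inl j => zz j | inr j => b0 j end =
    \sum_i (d i)%:MP *: b0 i.
  by apply: eq_bigr => i _; rewrite (unsplitK (inr i)).
rewrite -/z1 opprD addrA -[z - z1](subrK z0) -addrA.
exact: K_subspaceD.
Qed.

End SpannedModulo.

(** * Koszul complexes *)

Section Koszul.
Context (R : comNzRingType) (x : nat -> R).
Implicit Types V W : lmodType R.

(* Degree [q] of the Koszul complex of [x 0, ..., x (p - 1)] with             *)
(* coefficients in [V]: a pair [(z', z'')] stands for [z' + e_p /\ z''].      *)
Fixpoint kos V (p q : nat) {struct p} : lmodType R :=
  match p, q with
  | 0, 0 => V
  | 0, _.+1 => 'rV[R]_0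
  | p'.+1, 0 => kos V p' 0
  | p'.+1, q'.+1 => (kos V p' q'.+1 * kos V p' q')%type
  end.

(** The sign convention is d(e_p /\ z'') = x_p z'' - e_p /\ d z''. *)
Fixpoint kd V (p q : nat) {struct p} : kos V p q.+1 -> kos V p q :=
  match p return kos V p q.+1 -> kos V p q with
  | 0 => fun=> 0
  | p'.+1 => match q return kos V p'.+1 q.+1 -> kos V p'.+1 q with
    | 0 => fun z => kd z.1 + x p' *: z.2
    | q'.+1 => fun z => (kd z.1 + x p' *: z.2, - kd z.2)
    end
  end.

Fixpoint kmap V W (f : V -> W) (p q : nat) {struct p} : kos V p q -> kos W p q :=
  match p return kos V p q -> kos W p q with
  | 0 => match q return kos V 0 q -> kos W 0 q with
    | 0 => f
    | _.+1 => fun=> 0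
    end
  | p'.+1 => match q return kos V p'.+1 q -> kos W p'.+1 q with
    | 0 => @kmap V W f p' 0
    | q'.+1 => fun z => (kmap f z.1, kmap f z.2)
    end
  end.

(** Applied to membership in an ideal, this expresses the vanishing of a chain with coefficients in
    the quotient while computing with representatives. *)
Fixpoint kall V (P : V -> Prop) (p q : nat) {struct p} : kos V p q -> Prop :=
  match p return kos V p q -> Prop with
  | 0 => match q return kos V 0 q -> Prop with
    | 0 => P
    | _.+1 => fun=> True
    end
  | p'.+1 => match q return kos V p'.+1 q -> Prop with
    | 0 => @kall V P p' 0
    | q'.+1 => fun z => kall P z.1 /\ kall P z.2
    end
  end.

(** Degree 0 of the complex is [V], but only after unfolding the recursion on [p]; [kbase] and
    [kinj] are the identity read through it. *)
Fixpoint kbase V (p : nat) : kos V p 0 -> V :=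
  match p return kos V p 0 -> V with
  | 0 => id
  | p'.+1 => @kbase V p'
  end.

Fixpoint kinj V (p : nat) : V -> kos V p 0 :=
  match p return V -> kos V p 0 with
  | 0 => id
  | p'.+1 => @kinj V p'
  end.

Lemma kbaseK V p : cancel (@kbase V p) (@kinj V p).
Proof. by elim: p. Qed.

Lemma kinjK V p : cancel (@kinj V p) (@kbase V p).
Proof. by elim: p. Qed.

Lemma kbaseP V p a (u v : kos V p 0) :
  kbase (a *: u + v) = a *: kbase u + kbase v.
Proof. by elim: p u v. Qed.

HB.instance Definition _ V p :=
  GRing.isLinear.Build R (kos V p 0) V _ (@kbase V p) (fun a u v => kbaseP a u v).

Lemma kinjP V p a (u v : V) : kinj p (a *: u + v) = a *: kinj p u + kinj p v.
Proof. by elim: p. Qed.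

HB.instance Definition _ V p :=
  GRing.isLinear.Build R V (kos V p 0) _ (@kinj V p) (fun a u v => kinjP p a u v).

Lemma kos00 V q (z : kos V 0 q.+1) : z = 0.
Proof. by apply/rowP => -[]. Qed.

Lemma kdP V p q a (u v : kos V p q.+1) : kd (a *: u + v) = a *: kd u + kd v.
Proof.
elim: p q u v => [|p IHp] q u v; first by rewrite /= scaler0 addr0.
case: q u v => [|q] [u1 u2] [v1 v2] /=.
  rewrite IHp scalerDr [x p *: (a *: u2)]scalerA mulrC -scalerA.
  by rewrite addrACA -scalerDr.
congr (_, _).
  rewrite IHp scalerDr [x p *: (a *: u2)]scalerA mulrC -scalerA.
  by rewrite addrACA -scalerDr.
by rewrite IHp opprD -scalerN.
Qed.

HB.instance Definition _ V p q :=
  GRing.isLinear.Build R (kos V p q.+1) (kos V p q) _ (@kd V p q)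
    (fun a u v => kdP a u v).

Lemma kdK V p q (z : kos V p q.+2) : kd (kd z) = 0.
Proof.
elim: p q z => [|p IHp] q z //.
case: q z => [|q] [z1 z2] /=.
  by rewrite linearD linearZ /= IHp add0r scalerN subrr.
congr (_, _); last by rewrite linearN /= IHp !oppr0.
by rewrite linearD linearZ /= IHp add0r scalerN subrr.
Qed.

Lemma kmapD V W (f : V -> W) p q : {morph f : u v / u + v} ->
  {morph @kmap V W f p q : u v / u + v}.
Proof.
move=> fD; elim: p q => [|p IHp] [|q] u v //=; first by rewrite addr0.
  exact: IHp.
by rewrite !IHp.
Qed.

Lemma kmap_scale V a p q (z : kos V p q) : kmap (fun v => a *: v) z = a *: z.
Proof.
elim: p q z => [|p IHp] [|q] z //=; first by apply/rowP => -[].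
by rewrite !IHp.
Qed.

Lemma kmap_subid V (f : V -> V) p q (z : kos V p q) :
  kmap (fun v => v - f v) z = z - kmap f z.
Proof.
elim: p q z => [|p IHp] [|q] z //=; first by apply/rowP => -[].
by rewrite !IHp.
Qed.

(** Compatibility with the variables below [p] suffices; the substitution x_p = 0, which is not
    R-linear, satisfies it. *)
Lemma kmap_kd V W (f : V -> W) p q (z : kos V p q.+1) :
  f 0 = 0 -> {morph f : u v / u + v} ->
  (forall j v, (j < p)%N -> f (x j *: v) = x j *: f v) ->
  kmap f (kd z) = kd (kmap f z).
Proof.
move=> f0 fD fx.
have kD r s := kmapD (p := r) (q := s) fD.
have k0 r s : @kmap V W f r s 0 = 0.
  by elim: r s => [|r IHr] [|s] //=; rewrite !IHr.
have kN r s : {morph @kmap V W f r s : u / - u}.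
  by move=> u; apply: (addrI (kmap f u)); rewrite -kD !subrr k0.
have kx r s j (u : kos V r s) : (j < p)%N -> kmap f (x j *: u) = x j *: kmap f u.
  move=> jp; elim: r s u => [|r IHr] [|s] u //=; first exact: fx.
    by rewrite scaler0.
  by rewrite !IHr.
suff h r : forall s (y : kos V r s.+1), (r <= p)%N ->
    kmap f (kd y) = kd (kmap f y) by exact: h.
elim: r => [|r IHr] {z} q z lt_rp.
  by case: q z => [|q] z.
have le_rp := ltnW lt_rp.
by case: q z => [|q] [z1 z2] /=; rewrite ?kD ?kN ?kx ?IHr.
Qed.

Lemma kmap_comp V W (U : lmodType R) (f : V -> W) (g : W -> U) p q (z : kos V p q) :
  kmap g (kmap f z) = kmap (g \o f) z.
Proof.
by elim: p q z => [|p IHp] [|q] z //=; rewrite !IHp.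
Qed.

Lemma kmapP V W (f : {linear V -> W}) p q a (u v : kos V p q) :
  kmap f (a *: u + v) = a *: kmap f u + kmap f v.
Proof.
elim: p q u v => [|p IHp] [|q] u v //=; first by rewrite linearP.
  by rewrite scaler0 addr0.
by rewrite !IHp.
Qed.

HB.instance Definition _ V W (f : {linear V -> W}) p q :=
  GRing.isLinear.Build R (kos V p q) (kos W p q) _ (@kmap V W f p q)
    (fun a u v => kmapP f a u v).

Lemma kmap_linear_kd V W (f : {linear V -> W}) p q (z : kos V p q.+1) :
  kmap f (kd z) = kd (kmap f z).
Proof.
apply: kmap_kd => [|u v|j v _]; [exact: linear0 | exact: linearD | exact: linearZ].
Qed.

Lemma kall_impl V (P Q : V -> Prop) p q (z : kos V p q) :
  (forall v, P v -> Q v) -> kall P z -> kall Q z.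
Proof.
move=> PQ; elim: p q z => [|p IHp] [|q] z //=; first exact: PQ.
  exact: IHp.
by case=> /IHp ? /IHp.
Qed.

Lemma kall_and V (P Q : V -> Prop) p q (z : kos V p q) :
  kall P z -> kall Q z -> kall (fun v => P v /\ Q v) z.
Proof.
elim: p q z => [|p IHp] [|q] z //=; first exact: IHp.
by move=> [? ?] [? ?]; split; apply: IHp.
Qed.

Lemma kallT V (P : V -> Prop) p q (z : kos V p q) : (forall v, P v) -> kall P z.
Proof. by move=> hP; elim: p q z => [|p IHp] [|q] z //=. Qed.

Lemma kall_kmapE V W (f : V -> W) (P : W -> Prop) p q (z : kos V p q) :
  kall P (kmap f z) <-> kall (fun v => P (f v)) z.
Proof.
by elim: p q z => [|p IHp] [|q] z //=; split=> -[? ?]; split; apply/IHp.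
Qed.

Lemma kall_eq0 V p q (z : kos V p q) : kall (fun v => v = 0) z <-> z = 0.
Proof.
elim: p q z => [|p IHp] [|q] z //=.
  by split=> // _; apply: kos00.
case: z => z1 z2 /=; rewrite !IHp; split=> [[-> ->]//|].
by case=> -> ->.
Qed.

Lemma kall_eq V W (f g : V -> W) p q (z : kos V p q) :
  kall (fun v => f v = g v) z -> kmap f z = kmap g z.
Proof.
elim: p q z => [|p IHp] [|q] z //=; first exact: IHp.
by case=> /IHp -> /IHp ->.
Qed.

Lemma kmap_id V p q (z : kos V p q) : kmap id z = z.
Proof.
elim: p q z => [|p IHp] [|q] z //=; first by rewrite [RHS]kos00.
by rewrite !IHp; case: z.
Qed.

Lemma kmap_lift V W (f : V -> W) p q (z : kos W p q) :
  kall (fun w => exists v, f v = w) z -> exists y, kmap f y = z.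
Proof.
elim: p q z => [|p IHp] [|q] z //=.
- by move=> _; exists 0; rewrite [RHS]kos00.
- exact: IHp.
by case: z => z1 z2 /= [/IHp[y1 <-] /IHp[y2 <-]]; exists (y1, y2).
Qed.

Lemma kallD V (P Q S : V -> Prop) p q (y z : kos V p q) :
  (forall u v, P u -> Q v -> S (u + v)) -> kall P y -> kall Q z -> kall S (y + z).
Proof.
move=> h; elim: p q y z => [|p IHp] [|q] y z //=; first exact: h.
  exact: IHp.
by move=> [? ?] [? ?]; split; apply: IHp.
Qed.

Lemma kallZ V (P Q : V -> Prop) a p q (z : kos V p q) :
  (forall u, P u -> Q (a *: u)) -> kall P z -> kall Q (a *: z).
Proof.
move=> h; elim: p q z => [|p IHp] [|q] z //=; first exact: h.
  exact: IHp.
by move=> [? ?]; split; apply: IHp.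
Qed.

Lemma kallN V (P : V -> Prop) p q (z : kos V p q) :
  (forall u, P u -> P (- u)) -> kall P z -> kall P (- z).
Proof.
by move=> h; rewrite -!scaleN1r; apply: kallZ => u Pu; rewrite scaleN1r; apply: h.
Qed.

Lemma kall0 V (P : V -> Prop) p q : P 0 -> kall P (0 : kos V p q).
Proof. by move=> P0; elim: p q => [|p IHp] [|q] //=. Qed.

Lemma kall_kd V (P Q : V -> Prop) p q (z : kos V p q.+1) :
  Q 0 -> (forall u v, Q u -> Q v -> Q (u + v)) -> (forall u, Q u -> Q (- u)) ->
  (forall j u, (j < p)%N -> P u -> Q (x j *: u)) ->
  kall P z -> kall Q (kd z).
Proof.
move=> Q0 QD QN Qx.
suff h r : forall s (y : kos V r s.+1), (r <= p)%N ->
    kall P y -> kall Q (kd y) by exact: h.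
elim: r => [|r IHr] {z} q z lt_rp.
  by move=> _; apply: kall0.
have le_rp := ltnW lt_rp.
case: q z => [|q] [z1 z2] /= [h1 h2].
  by apply: kallD QD (IHr _ _ le_rp h1) (kallZ _ h2) => u; apply: Qx.
split; last by apply: kallN => //; apply: IHr.
by apply: kallD QD (IHr _ _ le_rp h1) (kallZ _ h2) => u; apply: Qx.
Qed.

(** A regular sequence has an acyclic Koszul complex. The images of [kd] in degree 0 are the
    elements of (x_0, ..., x_(p-1)) V, so the hypothesis says that x_p is a nonzerodivisor modulo
    them. The e_p-component of a cycle is then a boundary, by regularity in degree 0 and by
    induction above, and what remains is a cycle on fewer elements. *)
Lemma kos_exact V P :
  (forall p, (p < P)%N -> forall v : kos V p 0,
     (exists y, kd y = x p *: v) -> exists y, kd y = v) ->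
  forall q (z : kos V P q.+1), kd z = 0 -> exists w, kd w = z.
Proof.
elim: P => [|p IHp] reg q z.
  by exists 0; rewrite /= [RHS]kos00.
have {}IHp := IHp (fun r lt_rp => reg r (ltnW lt_rp)).
case: z => z1 z2 dz.
have [w2 w2E] : exists w, kd w = z2.
  case: q z1 z2 dz => [|q] z1 z2.
    move=> /= dz; apply: reg => //; exists (- z1).
    by apply/eqP; rewrite linearN /= eq_sym -addr_eq0 addrC dz.
  by case=> _ /eqP; rewrite oppr_eq0 => /eqP; apply: IHp.
have [w1 w1E] : exists w, kd w = z1 + x p *: w2.
  apply: IHp; rewrite linearD linearZ /= w2E.
  by case: q z1 z2 w2 w2E dz => [|q] z1 z2 w2 w2E //= [].
by exists (w1, - w2); rewrite /= w1E scalerN addrK linearN /= w2E opprK.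
Qed.

End Koszul.

(** * Setting variables to zero *)

Section Monomials.
Context (K : fieldType) (n : nat).
Local Notation R := {mpoly K[n]}.
Implicit Types (f g : R) (P : pred 'X_{1..n}) (A : pred nat).

Lemma mcoeffXM f m k :
  ('X_[m] * f)@_k = if (m <= k)%MM then f@_(k - m) else 0.
Proof.
rewrite mulrC; case: ifP => [le_mk|/negP nle].
  by rewrite -{1}(submK le_mk) addmC mcoeffMX.
apply: memN_msupp_eq0; rewrite (perm_mem (msuppMX _ _)).
by apply/mapP => -[m' _ kE]; apply: nle; rewrite kE lem_addr.
Qed.

Lemma mpolyX_neq0 m : 'X_[m] != 0 :> R.
Proof. by rewrite -msupp_eq0 msuppX. Qed.

Definition mrestr P f : R := \sum_(m <- msupp f | P m) f@_m *: 'X_[m].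

Lemma mcoeff_mrestr P f m : (mrestr P f)@_m = if P m then f@_m else 0.
Proof.
rewrite /mrestr raddf_sum /=.
case: (boolP (m \in msupp f)) => [mf|mf].
  rewrite big_mkcond (bigD1_seq m) ?msupp_uniq //= big1 ?addr0.
    by rewrite mcoeffZ mcoeffX eqxx mulr1.
  move=> k km; rewrite mcoeffZ mcoeffX (negbTE km) mulr0.
  by case: ifP.
rewrite (memN_msupp_eq0 mf) if_same big_seq_cond big1 // => k /andP[kf _].
rewrite mcoeffZ mcoeffX; case: eqP => [km|_]; rewrite ?mulr0 //.
by rewrite -km kf in mf.
Qed.

Lemma mrestrD P : {morph mrestr P : f g / f + g}.
Proof.
move=> f g; apply/mpolyP => m; rewrite mcoeffD !mcoeff_mrestr mcoeffD.
by case: ifP; rewrite ?addr0.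
Qed.

Lemma mrestr0 P : mrestr P 0 = 0.
Proof. by apply/mpolyP => m; rewrite mcoeff_mrestr !mcoeff0 if_same. Qed.

Lemma mpoly_factorX m f :
  (forall k, k \in msupp f -> (m <= k)%MM) -> exists g, f = 'X_[m] * g.
Proof.
move=> hf; exists (\sum_(k <- msupp f) f@_k *: 'X_[k - m]).
rewrite {1}[f]mpolyE mulr_sumr; rewrite big_seq [RHS]big_seq.
apply: eq_bigr => k /hf le_mk.
by rewrite -scalerAr -mpolyXD addmC submK.
Qed.

(** Indexed by [nat], as [kos] requires; the value 0 beyond the last variable is a filler. *)
Definition xvar (j : nat) : R := if insub j is Some i then 'X_i else 0.

Lemma xvarE (i : 'I_n) : xvar i = 'X_i.
Proof. by rewrite /xvar valK. Qed.

(** The substitution x_i = 0 for i in [A], performed by deleting every monomial that contains such a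
    variable. *)
Definition mkill A : R -> R := mrestr (fun m => [forall i : 'I_n, A i ==> (m i == 0%N)]).

Lemma mkillX A (i : 'I_n) f :
  mkill A ('X_i * f) = if A i then 0 else 'X_i * mkill A f.
Proof.
apply/mpolyP => m; rewrite mcoeff_mrestr mcoeffXM lep1mP.
case Ai: (A i).
  case: ifP => [/forallP/(_ i)|]; rewrite mcoeff0 // Ai => /eqP ->.
  by rewrite eqxx.
rewrite mcoeffXM lep1mP mcoeff_mrestr.
case: (m i =P 0%N) => mi; rewrite ?if_same //=.
congr (if _ then _ else _); apply: eq_forallb => j.
case: (eqVneq j i) => [->|ji]; first by rewrite Ai.
by rewrite mnmBE mnm1E [i == j]eq_sym (negbTE ji) subn0.
Qed.

Lemma mkill_xvar A j f :
  mkill A (xvar j * f) = if A j then 0 else xvar j * mkill A f.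
Proof.
rewrite /xvar; case: insubP => [i _ <-|_]; first exact: mkillX.
by rewrite !mul0r /mkill mrestr0 if_same.
Qed.

Lemma mkill1_factor j f : exists g, f - mkill (pred1 j) f = xvar j * g.
Proof.
have h k : k \in msupp (f - mkill (pred1 j) f) ->
    exists2 i : 'I_n, j = i & k i != 0%N.
  rewrite mcoeff_msupp mcoeffB mcoeff_mrestr.
  case: ifP => [|/forallPn[i]]; first by rewrite subrr eqxx.
  by rewrite negb_imply => /andP[/eqP <- ki] _; exists i.
case: (ltnP j n) => [lt_jn|le_nj].
  rewrite -[j]/(val (Ordinal lt_jn)) xvarE; apply: mpoly_factorX.
  move=> k /h[i ji ki]; rewrite lep1mP.
  by have -> : Ordinal lt_jn = i by apply: val_inj.
exists 0; rewrite mulr0; apply/mpolyP => k; rewrite mcoeff0.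
apply/eqP; rewrite mcoeff_eq0; apply/negP => /h[i ji _].
by rewrite ji leqNgt ltn_ord in le_nj.
Qed.

Lemma mkill_comp A B f : mkill A (mkill B f) = mkill (predU A B) f.
Proof.
apply/mpolyP => m; rewrite !mcoeff_mrestr.
have -> : [forall i : 'I_n, predU A B i ==> (m i == 0%N)] =
    [forall i : 'I_n, A i ==> (m i == 0%N)] &&
    [forall i : 'I_n, B i ==> (m i == 0%N)].
  apply/forallP/andP => [h|[/forallP hA /forallP hB] i].
    split; apply/forallP => i; apply/implyP => Ci; have := h i.
      by rewrite /= Ci.
    by rewrite /= Ci orbT.
  by apply/implyP => /orP[]; [exact/implyP/hA | exact/implyP/hB].
by case: ifP.
Qed.

Lemma eq_mkill A (B : pred nat) f : (forall i : 'I_n, A i = B i) -> mkill A f = mkill B f.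
Proof.
move=> AB; apply/mpolyP => m; rewrite !mcoeff_mrestr.
by under eq_forallb do rewrite AB.
Qed.

End Monomials.

(** * Acyclicity of the Koszul complex of the variables on free modules *)

Section KoszulRows.
Context (K : fieldType) (n : nat).
Local Notation R := {mpoly K[n]}.
Local Notation xv := (@xvar K n).

Definition rkill (A : pred nat) r (v : 'rV[R]_r) : 'rV[R]_r := map_mx (mkill A) v.

Lemma rkill0 A r : @rkill A r 0 = 0.
Proof. by apply/rowP => i; rewrite !mxE /mkill mrestr0. Qed.

Lemma rkillD A r : {morph @rkill A r : u v / u + v}.
Proof. by move=> u v; apply/rowP => i; rewrite !mxE /mkill mrestrD. Qed.

Lemma rkill_xvar A j r (v : 'rV[R]_r) :
  rkill A (xv j *: v) = if A j then 0 else xv j *: rkill A v.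
Proof.
by apply/rowP => i; rewrite !mxE mkill_xvar; case: (A j); rewrite !mxE.
Qed.

Lemma rkill1_factor j r (v : 'rV[R]_r) :
  exists w, v - rkill (pred1 j) v = xv j *: w.
Proof.
have pick i : {g | v 0 i - mkill (pred1 j) (v 0 i) = xv j * g}.
  by apply: constructive_indefinite_description; apply: mkill1_factor.
exists (\row_i sval (pick i)); apply/rowP => i; rewrite !mxE.
by case: (pick i).
Qed.

Lemma rkill_kd (A : pred nat) r p (y : kos 'rV[R]_r p 1) :
  (forall j, (j < p)%N -> A j) -> rkill A (kbase (kd xv y)) = 0.
Proof.
elim: p y => [|p IHp] /= y hA; first by rewrite rkill0.
rewrite linearD linearZ /= rkillD rkill_xvar hA // addr0 IHp // => j lt_jp.
by apply: hA; apply: ltnW.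
Qed.

(** Together with [rkill_kd], this identifies the boundaries in degree 0 with the kernel of x_0 =
    ... = x_(p-1) = 0. The difference between a vector and its value at x_p = 0 is divisible by x_p,
    which drives the induction. *)
Lemma kd_rkill r p (v : kos 'rV[R]_r p 0) :
  rkill (fun j => j < p)%N (kbase v) = 0 -> exists y, kd xv y = v.
Proof.
elim: p v => [|p IHp] v /= hv.
  have vE : rkill (fun j => j < 0)%N v = v :> 'rV[R]_r.
    apply/rowP => i; rewrite mxE; apply/mpolyP => m; rewrite mcoeff_mrestr.
    by case: ifP => // /forallPn[].
  by exists 0; exact: etrans (esym hv) vE.
have [w hw] := rkill1_factor p (kbase v).
have [y yE] : exists y, kd xv y = kinj p (rkill (pred1 p) (kbase v)).
  apply: IHp; rewrite kinjK; apply/rowP => i; move/rowP/(_ i): hv.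
  rewrite !mxE mkill_comp => hv; rewrite -hv; apply: eq_mkill => j /=.
  by rewrite orbC -leq_eqVlt ltnS.
exists (y, kinj p w) => /=; rewrite yE -[RHS](@kbaseK _ _ p).
by rewrite -linearZ -hw -linearD /= addrC subrK.
Qed.

Lemma kos_row_exact r P : (P <= n)%N ->
  forall q (z : kos 'rV[R]_r P q.+1), kd xv z = 0 -> exists w, kd xv w = z.
Proof.
move=> lePn; apply: kos_exact => p lt_pP v [y yE]; apply: kd_rkill.
have := @rkill_kd (fun j => j < p)%N r p y (fun j h => h); rewrite yE.
rewrite linearZ /= rkill_xvar ltnn => /rowP h; apply/rowP => i.
move: (h i); rewrite !mxE => /eqP.
have lt_pn := leq_trans lt_pP lePn.
by rewrite -[p]/(val (Ordinal lt_pn)) xvarE mulf_eq0 (negbTE (mpolyX_neq0 _ _)) => /eqP.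
Qed.

End KoszulRows.

(** * Koszul cycles and free resolutions *)

Section Zigzag.
Context (K : fieldType) (n : nat).
Local Notation R := {mpoly K[n]}.
Local Notation xv := (@xvar K n).
Local Notation const := (map_mx (mcoeff (0%MM : 'X_{1..n}))).

Lemma mkill_all (f : R) : mkill (fun j => j < n)%N f = (f@_0)%:MP.
Proof.
apply/mpolyP => m; rewrite mcoeff_mrestr mcoeffC.
case: (m =P 0%MM) => [->|/eqP m0].
  rewrite mulr1; case: ifP => // /forallPn[i].
  by rewrite mnm0E eqxx implybT.
rewrite mulr0; case: ifP => // /forallP h.
case/eqP: m0; apply/mnmP => i; rewrite mnm0E.
by have := h i; rewrite ltn_ord => /eqP.
Qed.

Lemma const_kd r (y : kos 'rV[R]_r n 1) : const (kbase (kd xv y)) = 0.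
Proof.
have := @rkill_kd _ _ (fun j => j < n)%N r n y (fun j h => h).
move=> /rowP h; apply/rowP => i; have := h i; rewrite !mxE mkill_all.
by move/eqP; rewrite mpolyC_eq0 => /eqP.
Qed.

Lemma const0_kd r (v : 'rV[R]_r) : const v = 0 -> exists y, kd xv y = kinj n v.
Proof.
move=> /rowP h; apply: kd_rkill; rewrite kinjK; apply/rowP => i.
by have := h i; rewrite !mxE mkill_all => ->.
Qed.

Lemma kmap_kinj (S : comNzRingType) (V W : lmodType S) (f : V -> W) p v :
  kmap f (kinj p v) = kinj p (f v).
Proof. by elim: p. Qed.

Lemma kmap_lift_mod (S : comNzRingType) (V W : lmodType S) (f : V -> W)
    (J : W -> Prop) p q (z : kos W p q) :
  kall (fun w => exists v, J (w - f v)) z -> exists y, kall J (z - kmap f y).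
Proof.
elim: p q z => [|p IHp] [|q] z //=.
  exact: IHp.
by case: z => z1 z2 /= [/IHp[y1 h1] /IHp[y2 h2]]; exists (y1, y2).
Qed.

(** Addition recursing as [zig] does, so that the target types of [zig] agree by conversion. *)
Fixpoint tadd (p q : nat) : nat := if q is q'.+1 then tadd p.+1 q' else p.

Lemma taddE p q : tadd p q = (p + q)%N.
Proof. by elim: q p => [|q IHq] p /=; rewrite ?addn0 // IHq addSnnS. Qed.

Context (I : R -> Prop) (F : free_complex K n).
Context (Iid : is_ideal I).
Context (hF : graded_free_resolution I F).

Local Notation V p := 'rV[R]_(gfr_rank F p).
Local Notation D p := (mulmxr (gfr_diff F p) : {linear V p.+1 -> V p}).
Local Notation aug := (mulmxr (gfr_aug F) : {linear V 0 -> 'rV[R]_1}).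
Local Notation J := (fun w : 'rV[R]_1 => I (w 0 0)).

Let exF i (v : V i.+1) : v *m gfr_diff F i = 0 <-> exists w, v = w *m gfr_diff F i.+1.
Proof. by case: hF. Qed.

Let DD i (v : V i.+2) : v *m gfr_diff F i.+1 *m gfr_diff F i = 0.
Proof. by apply/exF; exists v. Qed.

(* The zigzag through the double complex [kos F] relating Koszul cycles of    *)
(* [R/I] to cycles of [F (x) K].                                              *)
Fixpoint zig (q p : nat) : kos (V p) n q.+1 -> V (tadd p q).+1 -> Prop :=
  match q return kos (V p) n q.+1 -> V (tadd p q).+1 -> Prop with
  | 0 => fun a v => kd xv a = kmap (D p) (kinj n v)
  | q'.+1 => fun a v => exists2 b : kos (V p.+1) n q'.+1,
      kd xv a = kmap (D p) b & zig b v
  end.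

Lemma zigP q p c (a a' : kos (V p) n q.+1) v v' :
  zig a v -> zig a' v' -> zig (c *: a + a') (c *: v + v').
Proof.
elim: q p a a' v v' => [|q IHq] p a a' v v' /=.
  by move=> h h'; rewrite !linearP /= h h'.
move=> [b hb zb] [b' hb' zb']; exists (c *: b + b'); last exact: IHq.
by rewrite !linearP /= hb hb'.
Qed.

Lemma zig0 q p : @zig q p 0 0.
Proof.
elim: q p => [|q IHq] p; first by rewrite /= !linear0.
by exists 0; rewrite ?linear0 //; apply: IHq.
Qed.

(** Lift the Koszul boundary of [a] through the differential of [F]. The Koszul boundary of the lift
    is killed by that differential, hence lifts again by exactness of [F]. *)
Lemma zig_exists q p (a : kos (V p) n q.+1) :
  kall (fun v => exists w, w *m gfr_diff F p = v) (kd xv a) ->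
  exists v, zig a v.
Proof.
elim: q p a => [|q IHq] p a /kmap_lift[b bE].
  by exists (kbase b); rewrite /= kbaseK -bE.
have [v zv] : exists v, zig b v.
  apply: IHq; apply: (@kall_impl _ _ (fun v => v *m gfr_diff F p = 0)).
    by move=> v /exF[w ->]; exists w.
  apply/(kall_kmapE (D p) (fun v => v = 0))/kall_eq0.
  by rewrite kmap_linear_kd bE kdK.
by exists v; exists b.
Qed.

(** At the end of the zigzag the image of [v] under the differential of [F] is a Koszul boundary, so
    its entries have no constant term. *)
Lemma zig_cycle q p (a : kos (V p) n q.+1) v :
  zig a v -> const (v *m gfr_diff F (tadd p q)) = 0.
Proof.
elim: q p a v => [|q IHq] p a v /=; last by case=> b _; apply: IHq.
by rewrite kmap_kinj => h; rewrite -(const_kd a) h kinjK.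
Qed.

(** Injectivity on homology: exactness of the Koszul complexes of the free modules of [F] lets the
    zigzag be retraced from its end to its start. *)
Lemma zig_boundary q p (a : kos (V p) n q.+1) v :
  zig a v -> (exists y, const (v - y *m gfr_diff F (tadd p q).+1) = 0) ->
  exists a' a'', a = kmap (D p) a' + kd xv a''.
Proof.
elim: q p a v => [|q IHq] p a v /=.
  move=> h [y /const0_kd[b hb]].
  have [a'' ha''] : exists w, kd xv w = a - kmap (D p) b.
    apply: kos_row_exact => //; rewrite linearB /= -kmap_linear_kd hb h.
    by rewrite !kmap_kinj /= mulmxBl DD subr0 subrr.
  by exists b, a''; rewrite ha'' addrC subrK.
case=> b hb zb hv; have [b' [b'' bE]] := IHq _ _ _ zb hv.
have [a'' ha''] : exists w, kd xv w = a - kmap (D p) b''.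
  apply: kos_row_exact => //; rewrite linearB /= -kmap_linear_kd hb bE linearD /=.
  rewrite kmap_comp addrK; apply/kall_eq0/kall_kmapE/kallT => u /=.
  exact: DD.
by exists b'', a''; rewrite ha'' addrC subrK.
Qed.

(** Koszul homology of R/I embeds in the homology of F (x) K. Lift each cycle to F_0, follow its
    zigzag and take constant terms: the rows obtained are cycles, independent modulo the image of
    the next differential. *)
Lemma koszul_tor_lower q N (z : 'I_N -> kos 'rV[R]_1 n q.+1) :
  (forall a, kall J (kd xv (z a))) ->
  (forall c : 'I_N -> K,
     (exists w, kall J (\sum_a (c a)%:MP *: z a - kd xv w)) -> forall a, c a = 0) ->
  (N + \rank (tensor_diff F q.+1) <= \rank (kermx (tensor_diff F q)))%N.
Proof.
move=> zcyc zind.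
case: hF => _ _ hsurj hker _; case: Iid => I0 ID IM.
have IN f : I f -> I (- f) by move=> If; rewrite -mulN1r; apply: IM.
have JD (u v : 'rV[R]_1) : J u -> J v -> J (u + v) by move=> *; rewrite mxE; apply: ID.
have JN (u : 'rV[R]_1) : J u -> J (- u) by move=> *; rewrite mxE; apply: IN.
have JZ a (u : 'rV[R]_1) : J u -> J (a *: u) by move=> *; rewrite mxE; apply: IM.
have J0 : J (0 : 'rV[R]_1) by rewrite mxE.
have kdJ p s (y : kos 'rV[R]_1 p s.+1) : kall J y -> kall J (kd xv y).
  by apply: kall_kd => // j u _; apply: JZ.
have lift a : {y : kos (V 0) n q.+1 | kall J (z a - kmap aug y)}.
  apply: constructive_indefinite_description; apply: kmap_lift_mod.
  apply: kallT => u; have [v hv] := hsurj (u 0 0).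
  exists v; suff -> : (u - aug v) 0 0 = u 0 0 - (v *m gfr_aug F) 0 0 by [].
  by rewrite mxE; congr (_ + _); rewrite mxE.
pose y a := sval (lift a).
have yz a : kall J (z a - kmap aug (y a)) by rewrite /y; case: (lift a).
have zigy a : {v | zig (y a) v}.
  apply: constructive_indefinite_description; apply: zig_exists.
  apply: (@kall_impl _ _ (fun v => J (aug v))).
    by move=> v /hker[w ->]; exists w.
  apply/(kall_kmapE aug J); rewrite kmap_linear_kd.
  have -> : kmap aug (y a) = z a - (z a - kmap aug (y a)).
    by rewrite opprB addrC subrK.
  by rewrite linearB /=; apply: kallD JD (zcyc a) (kallN JN (kdJ _ _ _ (yz a))).
pose v a := sval (zigy a).
have zv a : zig (y a) (v a) by rewrite /v; case: (zigy a).
suff: (N + \rank (tensor_diff F (tadd 0 q).+1) <=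
       \rank (kermx (tensor_diff F (tadd 0 q))))%N by rewrite taddE.
set T := tensor_diff F _.+1.
pose M := \matrix_a const (v a).
have Mker : (M <= kermx (tensor_diff F (tadd 0 q)))%MS.
  apply/sub_kermxP/row_matrixP => a; rewrite row_mul rowK row0.
  by rewrite -map_mxM; apply: zig_cycle (zv a).
have Tker : (T <= kermx (tensor_diff F (tadd 0 q)))%MS.
  have DD0 : gfr_diff F (tadd 0 q).+1 *m gfr_diff F (tadd 0 q) = 0.
    by apply/row_matrixP => a; rewrite row_mul row0 rowE; apply: DD.
  by apply/sub_kermxP; rewrite -map_mxM DD0 map_mx0.
(* If a combination of the rows is a boundary, [zig_boundary] writes the same combination of the
   lifts as D a' + kd a''. The augmentation sends the first summand into I and the second to a
   Koszul boundary, so the independence of the [z a] applies. *)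
have Mind (c : 'rV[K]_N) : (c *m M <= T)%MS -> c = 0.
  move=> /submxP[y0 hy0].
  have zigc : zig (\sum_a (c 0 a)%:MP *: y a) (\sum_a (c 0 a)%:MP *: v a).
    elim: (index_enum _) => [|a s IHs]; rewrite ?big_nil; first exact: zig0.
    by rewrite !big_cons; apply: zigP.
  have cM : const (\sum_a (c 0 a)%:MP *: v a) = c *m M.
    rewrite mulmx_sum_row raddf_sum; apply: eq_bigr => a _ /=.
    by rewrite rowK; apply/rowP => j; rewrite !mxE mcoeffCM.
  have [a' [a'' E]] : exists a' a'',
      \sum_a (c 0 a)%:MP *: y a = kmap (D 0) a' + kd xv a''.
    apply: zig_boundary zigc _; exists (map_mx (@mpolyC n K) y0).
    rewrite raddfB /= cM hy0 map_mxM -map_mx_comp map_mx_id ?subrr //.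
    by move=> k /=; rewrite mpolyCK.
  have h : exists w, kall J (\sum_a (c 0 a)%:MP *: z a - kd xv w).
    exists (kmap aug a'').
    have -> : \sum_a (c 0 a)%:MP *: z a - kd xv (kmap aug a'') =
      \sum_a (c 0 a)%:MP *: (z a - kmap aug (y a)) + kmap aug (kmap (D 0) a').
      rewrite -kmap_linear_kd -[kd xv a''](addKr (kmap (D 0) a')) -E.
      rewrite linearD linearN /= opprD opprK linear_sum /=.
      under [in RHS]eq_bigr do rewrite scalerBr.
      rewrite sumrB -addrA; congr (_ + _); rewrite addrC; congr (_ + _); congr (- _).
      by apply: eq_bigr => a _; rewrite linearZ.
    apply: (kallD JD).
      elim: (index_enum _) => [|a s IHs]; rewrite ?big_nil ?big_cons; first exact: kall0.
      by apply: kallD JD _ IHs; apply: kallZ (yz a) => u; apply: JZ.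
    rewrite kmap_comp; apply/kall_kmapE/kallT => u /=.
    by apply/hker; exists u.
  by apply/rowP => a; rewrite mxE; apply: zind h a.
have Mfree : row_free M.
  by apply: inj_row_free => c cM; apply: Mind; rewrite cM sub0mx.
have MT : (M :&: T = 0)%MS.
  apply/eqP/rowV0P => u; rewrite sub_capmx => /andP[/submxP[c ->] /Mind ->].
  by rewrite mul0mx.
rewrite -{1}(eqP Mfree) -(mxrank_disjoint_sum MT).
by apply: mxrankS; rewrite addsmx_sub Mker Tker.
Qed.

End Zigzag.

(** * Existence of graded free resolutions *)

Section Noetherian.
Context (K : fieldType) (n : nat).
Local Notation R := {mpoly K[n]}.

(** Induction on the number [k] of coordinates compared, keeping all [n] coordinates of the
    monomials. *)
Lemma dickson (P : 'X_{1..n} -> Prop) :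
  exists2 s : seq 'X_{1..n}, forall m, m \in s -> P m &
    forall m, P m -> exists2 m', m' \in s & (m' <= m)%MM.
Proof.
suff /(_ n P (leqnn n))[s sP hs] : forall k (P : 'X_{1..n} -> Prop), (k <= n)%N ->
    exists2 s : seq 'X_{1..n}, forall m, m \in s -> P m &
    forall m, P m -> exists2 m', m' \in s &
      forall i : 'I_n, (i < k)%N -> (m' i <= m i)%N.
  exists s => // m /hs[m' m's h]; exists m' => //.
  by apply/mnm_lepP => i; apply: h.
elim=> [|k IHk] {}P lt_kn.
  case: (classic (exists m, P m)) => [[m Pm]|noP].
    exists [:: m] => [m'|m' _]; first by rewrite inE => /eqP ->.
    by exists m; rewrite ?inE.
  by exists [::] => // m Pm; case: noP; exists m.
have [s sP hs] := IHk P (ltnW lt_kn).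
(* Monomials with new coordinate at least [M] are dominated by [s]; each of the finitely many
   smaller values of that coordinate gets its own list. *)
pose ik := Ordinal lt_kn; pose M := (\max_(m <- s) m ik)%N.
have pick c : {t : seq 'X_{1..n} | (forall m, m \in t -> P m /\ m ik = c) /\
    forall m, P m /\ m ik = c -> exists2 m', m' \in t &
      forall i : 'I_n, (i < k)%N -> (m' i <= m i)%N}.
  apply: constructive_indefinite_description.
  by have [t tP ht] := IHk (fun m => P m /\ m ik = c) (ltnW lt_kn); exists t.
exists (s ++ flatten [seq sval (pick c) | c <- iota 0 M]) => [m|m Pm].
  rewrite mem_cat => /orP[/sP//|/flatten_mapP[c _]].
  by case: (pick c) => t [h _] /= /h[].
case: (leqP M (m ik)) => [le_Mm|lt_mM].
  have [m' m's hm'] := hs _ Pm; exists m'; first by rewrite mem_cat m's.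
  move=> i; rewrite ltnS leq_eqVlt => /orP[/eqP ik'|/hm'//].
  have -> : i = ik by apply: val_inj.
  by apply: leq_trans le_Mm; rewrite /M (big_rem m' m's) /= leq_maxl.
have := erefl (sval (pick (m ik))); case: {2}(pick (m ik)) => t [ht1 ht2] /= tE.
have [m' m't hm'] := ht2 m (conj Pm erefl); exists m'.
  rewrite mem_cat; apply/orP; right; apply/flatten_mapP; exists (m ik).
    by rewrite mem_iota.
  by rewrite tE.
move=> i; rewrite ltnS leq_eqVlt => /orP[/eqP ik'|/hm'//].
have -> : i = ik by apply: val_inj.
by have [_ ->] := ht1 _ m't.
Qed.

(** Dickson's lemma on leading monomials, then division by well-founded induction on the leading
    monomial. *)
Lemma ideal_fg (I : R -> Prop) : is_ideal I ->
  exists k (g : 'I_k -> R), (forall i, I (g i)) /\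
    forall f, I f -> exists c : 'I_k -> R, f = \sum_i c i * g i.
Proof.
case=> I0 ID IM.
have [s sP hs] := dickson (fun m => exists2 f, I f & f != 0 /\ mlead f = m).
have pick (i : 'I_(size s)) : {g | I g /\ g != 0 /\ mlead g = nth 0%MM s i}.
  apply: constructive_indefinite_description.
  by have [g] := sP _ (mem_nth 0%MM (ltn_ord i)); exists g.
exists (size s), (fun i => sval (pick i)); split.
  by move=> i; case: (pick i) => g [].
move=> f If; move: {2}(mlead f) (erefl (mlead f)) => m.
elim: m / (ltom_wf m) f If => m _ IHm f If fm.
case: (eqVneq f 0) => [->|f0].
  by exists (fun=> 0); rewrite big1 // => i _; rewrite mul0r.
have [m' m's le_m'] : exists2 m', m' \in s & (m' <= mlead f)%MM.
  by apply: hs; exists f.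
have lt_i : (index m' s < size s)%N by rewrite index_mem.
pose i := Ordinal lt_i.
have [Ig [g0 gm]] := svalP (pick i); set g := sval (pick i) in Ig g0 gm.
rewrite nth_index // in gm.
pose q := (mleadc f / mleadc g) *: 'X_[mlead f - m'] * g.
have cg : mleadc g != 0 by rewrite mleadc_eq0.
have c0 : mleadc f / mleadc g != 0.
  by rewrite mulf_neq0 ?invr_eq0 // mleadc_eq0.
have qm : mlead q = mlead f.
  rewrite /q mleadM //; last by rewrite scaler_eq0 negb_or c0 mpolyX_neq0.
  by rewrite mleadZ // mleadXm gm submK.
have qc : mleadc q = mleadc f.
  rewrite qm /q -scalerAl mcoeffZ mcoeffXM lem_subr.
  have -> : (mlead f - (mlead f - m') = mlead g)%MM.
    by rewrite gm; apply/mnmP => j; rewrite !mnmBE subKn //; apply: (mnm_lepP le_m').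
  by rewrite divfK.
have Iq : I q by apply: IM.
have Ifq : I (f - q) by apply: ID => //; rewrite -mulN1r; apply: IM.
have [fq0|fq0] := eqVneq (f - q) 0.
  exists (fun j => if j == i then (mleadc f / mleadc g) *: 'X_[mlead f - m'] else 0).
  rewrite (bigD1 i) //= eqxx big1 ?addr0 => [|j /negbTE ->]; last by rewrite mul0r.
  by apply/eqP; rewrite -subr_eq0 fq0.
have lt_m : (mlead (f - q) < m)%O.
  rewrite -fm lt_neqAle; apply/andP; split; last first.
    apply: le_trans (mleadB_le _ _) _.
    by rewrite qm joinxx.
  apply/eqP => e; move: (mleadc_eq0 (f - q)).
  by rewrite e mcoeffB -{2}qm qc subrr eqxx (negbTE fq0).
have [c hc] := IHm _ lt_m _ Ifq erefl.
exists (fun j => c j +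
  if j == i then (mleadc f / mleadc g) *: 'X_[mlead f - m'] else 0).
under eq_bigr do rewrite mulrDl.
rewrite big_split /= -hc (bigD1 i) //= eqxx big1 ?addr0 => [|j /negbTE ->].
  by rewrite subrK.
by rewrite mul0r.
Qed.

Definition submodule r (N : 'rV[R]_r -> Prop) : Prop :=
  N 0 /\ forall a u v, N u -> N v -> N (a *: u + v).

(** Induction on the rank: the first coordinates form a finitely generated ideal, and the vectors
    with first coordinate 0 form a submodule of smaller rank. *)
Lemma submodule_fg r (N : 'rV[R]_r -> Prop) : submodule N ->
  exists k (M : 'M[R]_(k, r)), forall v, N v <-> exists w, v = w *m M.
Proof.
have rowE k s (M : 'M[R]_(k, s)) (S : 'rV[R]_s -> Prop) w :
    submodule S -> (forall i, S (row i M)) -> S (w *m M).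
  move=> [S0 Sl] SM; rewrite mulmx_sum_row.
  by elim/big_rec: _ => // i x _; apply: Sl.
elim: r N => [|r IHr] N hN.
  exists 0%N, 0 => v; rewrite [v]thinmx0; split=> _; last exact: hN.1.
  by exists 0; rewrite mul0mx.
have [N0 Nl] := hN.
have NN v : N v -> N (- v) by move=> Nv; rewrite -scaleN1r -[_ *: _]addr0; apply: Nl.
pose I0 f := exists v', N (row_mx (f%:M : 'M_1) v').
have I0id : is_ideal I0.
  split.
  - by exists 0; rewrite raddf0 row_mx0.
  - move=> f g [u Nu] [v Nv]; exists (u + v).
    by rewrite raddfD -add_row_mx -[row_mx _ u]scale1r; apply: Nl.
  move=> a f [u Nu]; exists (a *: u).
  by rewrite -scale_scalar_mx -scale_row_mx -[_ *: _]addr0; apply: Nl.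
have [k [g [Ig hg]]] := ideal_fg I0id.
have pick i : {v' | N (row_mx ((g i)%:M : 'M_1) v')}.
  exact: constructive_indefinite_description (Ig i).
pose L : 'M_(k, 1 + r) := \matrix_i row_mx ((g i)%:M : 'M_1) (sval (pick i)).
have NL i : N (row i L) by rewrite rowK; apply: (svalP (pick i)).
have hN' : submodule (fun v' => N (row_mx (0 : 'M_1) v')).
  split; first by rewrite row_mx0.
  move=> a u v Nu Nv; suff -> : row_mx (0 : 'M_1) (a *: u + v) =
      a *: row_mx (0 : 'M_1) u + row_mx (0 : 'M_1) v by apply: Nl.
  by rewrite scale_row_mx scaler0 add_row_mx addr0.
have [k' [M' hM']] := IHr _ hN'.
pose Z : 'M_(k', 1 + r) := row_mx (0 : 'M_(k', 1)) M'.
exists (k + k')%N, (col_mx L Z) => v; split; last first.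
  case=> w ->; apply: rowE => // i; rewrite -(splitK i); case: (split i) => j /=.
    by rewrite rowKu.
  have -> : row (rshift k j) (col_mx L Z) = row_mx (0 : 'M_1) (row j M').
    by rewrite rowKd row_row_mx row0.
  apply/hM'; exists (delta_mx 0 j).
  by rewrite -rowE.
move=> Nv; pose f := v 0 0.
have vE : v = row_mx (f%:M : 'M_1) (rsubmx (v : 'rV_(1 + r))).
  have <- : lsubmx (v : 'rV_(1 + r)) = f%:M by rewrite [lsubmx _]mx11_scalar mxE lshift0.
  by rewrite hsubmxK.
have [c hc] : exists c : 'I_k -> R, f = \sum_i c i * g i.
  by apply: hg; exists (rsubmx (v : 'rV_(1 + r))); rewrite -vE.
pose c' : 'rV_k := \row_i c i.
have cL : c' *m L = row_mx (f%:M : 'M_1) (rsubmx (c' *m L)).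
  suff <- : lsubmx (c' *m L) = f%:M by rewrite hsubmxK.
  rewrite [lsubmx _]mx11_scalar hc; congr _%:M; rewrite !mxE.
  apply: eq_bigr => i _; rewrite !mxE.
  by case: splitP => // j _; rewrite !mxE !ord1 mulr1n.
have Nw : N (v - c' *m L) by rewrite addrC; rewrite -scaleN1r; apply: Nl => //; apply: rowE.
have lw : lsubmx (v - c' *m L : 'rV_(1 + r)) = 0.
  by rewrite linearB /= {1}vE cL !row_mxKl subrr.
have wE : row_mx (0 : 'M_1) (rsubmx (v - c' *m L : 'rV_(1 + r))) = v - c' *m L.
  by rewrite -lw hsubmxK.
have [w hw] := (hM' (rsubmx (v - c' *m L : 'rV_(1 + r)))).1 (eq_ind_r N Nw wE).
have wZ : w *m Z = row_mx (0 : 'M_1) (w *m M') by rewrite mul_mx_row mulmx0.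
exists (row_mx c' w); rewrite mul_row_col wZ -hw wE.
by rewrite addrC subrK.
Qed.

End Noetherian.

(** * Graded submodules of free modules and iterated syzygies *)

Section GradedModules.
Context (K : fieldType) (n : nat).
Local Notation R := {mpoly K[n]}.
Implicit Types f g : R.

Lemma pihomogMr s e f g : g \is e.-homog ->
  pihomog mdeg s (f * g) = if (e <= s)%N then pihomog mdeg (s - e) f * g else 0.
Proof.
move=> hg; pose N := maxn (msize f) s.+1.
rewrite {1}(@pihomog_partitionE n K mdeg N f) ?leq_maxl // mulr_suml linear_sum /=.
have piE (k : 'I_N) : pihomog mdeg s (pihomog mdeg k f * g) =
    if (k + e == s)%N then pihomog mdeg k f * g else 0.
  have hk : pihomog mdeg k f * g \is (k + e).-homog.
    by apply: dhomogM => //; apply: pihomogP.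
  case: eqP => [<-|/eqP ne]; first exact: pihomog_dE.
  exact: pihomog_ne0 ne hk.
under eq_bigr do rewrite piE.
rewrite -big_mkcond; case: ifP => [le_es|/negbT lt_se].
  have lt_N : (s - e < N)%N by rewrite /N; lia.
  rewrite (big_pred1 (Ordinal lt_N)) // => k /=.
  by apply/eqP/eqP => [h|->]; [apply: val_inj => /=; lia | rewrite /=; lia].
rewrite big_pred0 // => k; apply/eqP; lia.
Qed.

(** The component of degree [d] when the [b]-th basis vector has degree [deg b]; the test guards
    against truncated subtraction. *)
Definition hproj r (deg : 'I_r -> nat) (d : nat) (v : 'rV[R]_r) : 'rV[R]_r :=
  \row_b (if (deg b <= d)%N then pihomog mdeg (d - deg b) (v 0 b) else 0).

Definition homogmx k r (dk : 'I_k -> nat) (dr : 'I_r -> nat) (M : 'M[R]_(k, r)) :=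
  forall a b, M a b != 0 ->
    exists2 e, dk a = (dr b + e)%N & M a b \is e.-homog.

Definition graded r (deg : 'I_r -> nat) (N : 'rV[R]_r -> Prop) :=
  forall d v, N v -> N (hproj deg d v).

Lemma hproj_is_additive r (deg : 'I_r -> nat) d : {morph hproj deg d : u v / u + v}.
Proof.
move=> u v; apply/rowP => b; rewrite !mxE.
by case: ifP; rewrite ?linearD ?addr0.
Qed.

Lemma hprojZ r (deg : 'I_r -> nat) d (c : K) v :
  hproj deg d (c%:MP *: v) = c%:MP *: hproj deg d v.
Proof.
apply/rowP => b; rewrite !mxE !mul_mpolyC.
by case: ifP; rewrite ?linearZ // scaler0.
Qed.

Lemma hproj0 r (deg : 'I_r -> nat) d : hproj deg d 0 = 0.
Proof. by apply/rowP => b; rewrite !mxE linear0 if_same. Qed.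

Lemma hprojB r (deg : 'I_r -> nat) d u v :
  hproj deg d (u - v) = hproj deg d u - hproj deg d v.
Proof.
apply/rowP => b; rewrite !mxE.
by case: ifP; rewrite ?linearB ?subr0.
Qed.

Lemma hproj_id r (deg : 'I_r -> nat) d v :
  hproj deg d (hproj deg d v) = hproj deg d v.
Proof. by apply/rowP => b; rewrite !mxE; case: (_ <= _)%N; rewrite ?pihomog_id. Qed.

Lemma hproj_partition r (deg : 'I_r -> nat) v :
  exists D, v = \sum_(d < D) hproj deg d v.
Proof.
pose s b := msize (v 0 b); pose D := (\max_b (deg b + s b))%N; exists D.
apply/rowP => b; rewrite summxE.
have le_D : (deg b + s b <= D)%N by apply: (leq_bigmax b).
under eq_bigr do rewrite mxE.
rewrite {1}(@pihomog_partitionE n K mdeg (D - deg b)%N (v 0 b)); last by rewrite -/(s b); lia.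
rewrite -(big_mkord xpredT (fun d => if (deg b <= d)%N then
  pihomog mdeg (d - deg b) (v 0 b) else 0)) (big_cat_nat (n := deg b)) //=; last by lia.
rewrite [X in X + _]big_nat [X in X + _]big1 ?add0r => [|d /andP[_ lt_d]]; last first.
  by rewrite leqNgt lt_d.
rewrite -[X in \sum_(X <= _ < _) _]add0n big_addn big_mkord; apply: eq_bigr => d _.
by rewrite leq_addl addnK.
Qed.

Lemma hproj_mulmx k r (dk : 'I_k -> nat) (dr : 'I_r -> nat) M d v :
  homogmx dk dr M -> hproj dr d (v *m M) = hproj dk d v *m M.
Proof.
move=> hM; apply/rowP => b; rewrite !mxE.
under [in RHS]eq_bigr do rewrite mxE.
case: ifP => [le_d|/negbT gt_d].
  rewrite linear_sum; apply: eq_bigr => a _ /=.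
  have [->|/hM[e ae hMe]] := eqVneq (M a b) 0; first by rewrite !mulr0 linear0.
  rewrite (pihomogMr _ _ hMe) ae leq_subRL // subnDA.
  by case: ifP; rewrite ?mul0r.
rewrite big1 // => a _.
have [->|/hM[e ae _]] := eqVneq (M a b) 0; first by rewrite mulr0.
by rewrite ae ifF ?mul0r //; lia.
Qed.

Lemma graded_fg r (deg : 'I_r -> nat) (N : 'rV[R]_r -> Prop) :
  submodule N -> graded deg N ->
  exists k (dk : 'I_k -> nat) (M : 'M[R]_(k, r)), homogmx dk deg M /\
    forall v, N v <-> exists w, v = w *m M.
Proof.
move=> Nsub Ngr; have [k [M hM]] := submodule_fg Nsub.
have [N0 Nl] := Nsub.
have pick i : {D | row i M = \sum_(d < D) hproj deg d (row i M)}.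
  exact/constructive_indefinite_description/hproj_partition.
(* One bound for all rows, so that the homogeneous components of the generators form a single matrix
   indexed by 'I_D * 'I_k. *)
pose D := (\max_i sval (pick i))%N.
have MD i : row i M = \sum_(d < D) hproj deg d (row i M).
  have [leD] : (sval (pick i) <= D)%N by apply: (leq_bigmax i).
  have {1}-> := svalP (pick i).
  rewrite (big_ord_widen D (fun d => hproj deg d (row i M))) // big_mkcond.
  apply: eq_bigr => d _; case: ltnP => // le_d.
  rewrite (svalP (pick i)) /= (big_morph _ (hproj_is_additive deg d) (hproj0 deg d)).
  rewrite big1 // => d' _; apply/rowP => b; rewrite !mxE.
  case: ifP => // le_b; case: ifP => le_b'; last by rewrite linear0.
  rewrite (@pihomog_ne0 _ _ _ (d' - deg b)%N) ?pihomogP //.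
  have lt_d := leq_trans (ltn_ord d') le_d.
  by rewrite neq_ltn ltn_sub2r // (leq_ltn_trans le_b').
pose T : finType := ('I_D * 'I_k)%type.
pose ev (a : 'I_#|T|) : T := enum_val a.
pose M' : 'M_(#|T|, r) := \matrix_a hproj deg (ev a).1 (row (ev a).2 M).
exists #|T|, (fun a => val (ev a).1), M'; split.
  move=> a b; rewrite !mxE; case: ifP => [le_b _|]; last by rewrite eqxx.
  by exists ((ev a).1 - deg b)%N; rewrite ?subnKC // pihomogP.
have NM' a : N (row a M').
  by rewrite rowK; apply/Ngr/hM; exists (delta_mx 0 (ev a).2); rewrite -rowE.
move=> v; split; last first.
  case=> w ->; rewrite mulmx_sum_row.
  by elim/big_rec: _ => // i x _; apply: Nl.
case/hM=> w ->.
exists (\row_a w 0 (ev a).2); rewrite !mulmx_sum_row.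
rewrite [RHS](reindex (@enum_rank T)) /=; last by apply: onW_bij; apply: enum_rank_bij.
under [in RHS]eq_bigr do rewrite mxE rowK /ev enum_rankK.
rewrite -(pair_bigA _ (fun (d : 'I_D) i => w 0 i *: hproj deg d (row i M))).
rewrite exchange_big /=.
by apply: eq_bigr => i _; rewrite {1}MD scaler_sumr.
Qed.

Record graded_submodule := GradedSubmodule {
  gs_rank : nat;
  gs_deg : 'I_gs_rank -> nat;
  gs_mem : 'rV[R]_gs_rank -> Prop;
  _ : submodule gs_mem;
  _ : graded gs_deg gs_mem
}.

Lemma syzygies (N : graded_submodule) :
  exists (S : graded_submodule) (M : 'M[R]_(gs_rank S, gs_rank N)),
  [/\ homogmx (@gs_deg S) (@gs_deg N) M,
      forall v, @gs_mem N v <-> exists w, v = w *m M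
    & forall w, @gs_mem S w <-> w *m M = 0].
Proof.
case: N => r deg N Nsub Ngr /=.
have [k [dk [M [homM hM]]]] := graded_fg Nsub Ngr.
have Ssub : submodule (fun w => w *m M = 0).
  split; first by rewrite mul0mx.
  by move=> a u v u0 v0; rewrite mulmxDl -scalemxAl u0 v0 scaler0 addr0.
have Sgr : graded dk (fun w => w *m M = 0).
  by move=> d v v0; rewrite -(hproj_mulmx _ _ homM) v0 hproj0.
by exists (GradedSubmodule Ssub Sgr), M.
Qed.

(** Start from I inside F_0 = R, with the identity as augmentation, and choose syzygies
    repeatedly. *)
Lemma graded_free_resolution_exists (I : R -> Prop) :
  graded_ideal I -> exists F, graded_free_resolution I F.
Proof.
move=> [[I0 ID IM] Igr].
have Isub : submodule (fun v : 'rV[R]_1 => I (v 0 0)).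
  split; first by rewrite mxE.
  by move=> a u v Iu Iv; rewrite !mxE; apply: ID => //; apply: IM.
have Igr1 : graded (fun _ : 'I_1 => 0%N) (fun v : 'rV[R]_1 => I (v 0 0)).
  by move=> d v Iv; rewrite mxE; apply: Igr.
have next (N : graded_submodule) : {S : graded_submodule &
    {M : 'M[R]_(gs_rank S, gs_rank N) |
     [/\ homogmx (@gs_deg S) (@gs_deg N) M,
         forall v, @gs_mem N v <-> exists w, v = w *m M
       & forall w, @gs_mem S w <-> w *m M = 0]}}.
  have /constructive_indefinite_description[S hS] := syzygies N.
  by exists S; apply: constructive_indefinite_description.
pose st := fix st i := if i is j.+1 then projT1 (next (st j))
                       else GradedSubmodule Isub Igr1.
pose diff i : 'M[R]_(gs_rank (st i.+1), gs_rank (st i)) := sval (projT2 (next (st i))).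
have hd i := svalP (projT2 (next (st i))).
exists (@FreeComplex K n (fun i => gs_rank (st i)) (fun i => @gs_deg (st i)) diff 1%:M).
split=> /=.
- by move=> i; have [h _ _] := hd i.
- by move=> b; rewrite mxE !ord1 dhomog1.
- by move=> f; exists f%:M; rewrite mulmx1 mxE subrr.
- by move=> v; rewrite mulmx1; have [_ h _] := hd 0%N; apply: h.
move=> i v; have [_ _ h1] := hd i; have [_ h2 _] := hd i.+1.
by rewrite -h1; apply: h2.
Qed.

End GradedModules.

(** * The staircase of an almost revlex ideal *)

Section RevLex.
Context (n : nat).
Implicit Types u v w m : 'X_{1..n}.

Definition rlt u v : bool :=
  (mdeg u < mdeg v)%N || ((mdeg u == mdeg v) &&
    [exists i : 'I_n, (v i < u i)%N && [forall j : 'I_n, (i < j)%N ==> (u j == v j)]]).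

Lemma rltP u v : reflect (revlex_gt v u) (rlt u v).
Proof.
apply: (iffP orP) => [[lt|/andP[/eqP eq /existsP[i /andP[lt /forallP h]]]]|].
- by left.
- right; split=> //; exists i; split=> // j lt_ij.
  by have := h j; rewrite lt_ij => /eqP.
case=> [lt|[eq [i [lt h]]]]; [by left | right].
rewrite eq eqxx /=; apply/existsP; exists i; rewrite lt /=.
by apply/forallP => j; apply/implyP => /h ->.
Qed.

Lemma rlt_degP u v : mdeg u = mdeg v ->
  reflect (exists2 i : 'I_n, (v i < u i)%N & forall j : 'I_n, (i < j)%N -> u j = v j)
    (rlt u v).
Proof.
move=> e; apply: (iffP (rltP u v)) => [[|[_ [i [lt h]]]]|[i lt h]].
- by rewrite e ltnn.
- by exists i => // j /h.
- by right; split=> //; exists i; split=> // j /h.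
Qed.

Lemma rlt_irr : irreflexive rlt.
Proof. by move=> u; apply/negP => /(rlt_degP erefl)[i]; rewrite ltnn. Qed.

Lemma rlt_mdeg u v : rlt u v -> (mdeg u <= mdeg v)%N.
Proof. by case/orP => [/ltnW//|/andP[/eqP ->]]. Qed.

Lemma rlt_trans : transitive rlt.
Proof.
move=> v u w uv vw; have le_uv := rlt_mdeg uv; have le_vw := rlt_mdeg vw.
case: (ltnP (mdeg u) (mdeg w)) => [lt|le_wu]; first by rewrite /rlt lt.
have e1 : mdeg u = mdeg v by lia.
have e2 : mdeg v = mdeg w by lia.
move/(rlt_degP e1): uv => [i lti hi]; move/(rlt_degP e2): vw => [j ltj hj].
apply/(rlt_degP (etrans e1 e2)).
case: (ltngtP i j) => [lt_ij|lt_ji|/val_inj ij].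
- exists j; first by rewrite hi.
  by move=> k lt_jk; rewrite hi ?hj // (ltn_trans lt_ij).
- exists i; first by rewrite -hj.
  by move=> k lt_ik; rewrite hi ?hj // (ltn_trans lt_ji).
- exists i; first by rewrite (leq_trans _ lti) // ij ltnW.
  by move=> k lt_ik; rewrite hi ?hj // -ij.
Qed.

Lemma rlt_asym u v : rlt u v -> rlt v u -> False.
Proof. by move=> uv /(rlt_trans uv); rewrite rlt_irr. Qed.

Lemma rlt_total u v : u != v -> rlt u v || rlt v u.
Proof.
move=> uv; case: (ltngtP (mdeg u) (mdeg v)) => [lt|lt|e].
- by rewrite /rlt lt.
- by rewrite [rlt v u]/rlt lt orbT.
have [i0 ne0] : exists i, u i != v i.
  apply/existsP; rewrite -negb_forall; apply: contra uv => /forallP h.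
  by apply/eqP/mnmP => i; apply/eqP.
case: (@arg_maxnP _ i0 (fun i => u i != v i) val ne0) => i ne hi.
have eqj (j : 'I_n) : (i < j)%N -> u j = v j.
  by move=> lt_ij; apply/eqP/negPn/negP => /hi /(leq_trans lt_ij); rewrite ltnn.
case: (ltngtP (u i) (v i)) => [lt|lt|]; last by move/eqP: ne.
  by apply/orP; right; apply/(rlt_degP (esym e)); exists i => // j /eqj.
by apply/orP; left; apply/(rlt_degP e); exists i => // j /eqj.
Qed.

Lemma rltD m u v : rlt (u + m) (v + m) = rlt u v.
Proof.
rewrite /rlt !mdegD ltn_add2r eqn_add2r; congr (_ || (_ && _)).
apply: eq_existsb => i; rewrite !mnmDE ltn_add2r; congr (_ && _).
by apply: eq_forallb => j; rewrite !mnmDE eqn_add2r.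
Qed.

Definition xpow (p b : nat) : 'X_{1..n} := [multinom (b * (i == p :> nat))%N | i < n].

Lemma mdeg_xpow p b : (p < n)%N -> mdeg (xpow p b) = b.
Proof.
move=> lt_pn; rewrite mdegE (bigD1 (Ordinal lt_pn)) //= mnmE eqxx muln1.
rewrite big1 ?addn0 // => i; rewrite mnmE -val_eqE /= => /negbTE ->.
by rewrite muln0.
Qed.

Definition supp_below (p : nat) u := forall i : 'I_n, (p <= i)%N -> u i = 0%N.

Lemma rlt_last p u v : mdeg u = mdeg v -> supp_below p.+1 u -> supp_below p.+1 v ->
  forall lt_pn : (p < n)%N, (v (Ordinal lt_pn) < u (Ordinal lt_pn))%N -> rlt u v.
Proof.
move=> e su sv lt_pn lt; apply/(rlt_degP e); exists (Ordinal lt_pn) => // j lt_j.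
by rewrite su ?sv.
Qed.

End RevLex.

(** * Standard monomials, one variable at a time *)

Section Staircase.
Context (n : nat) (h : nat -> nat).

(* The Hilbert function of [A / g A] when [A] has Hilbert function [f] and    *)
(* multiplication by the linear form [g] has full rank in every degree.       *)
Definition dplus (f : nat -> nat) (t : nat) : nat :=
  if t is s.+1 then (f t - f s)%N else f 0%N.

(** The Hilbert function expected after n - p hyperplane sections, that is, in the first [p]
    variables. *)
Definition hilb (p : nat) : nat -> nat := iter (n - p) dplus h.

(* [stair p t] lists the standard monomials of degree [t] in the first [p]    *)
(* variables, in increasing revlex order, of the almost revlex ideal with     *)
(* Hilbert function [hilb p].  Multiplication by the last variable preserves  *)
(* the position in the list.                                                  *)
Fixpoint stair (p : nat) : nat -> seq 'X_{1..n} :=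
  match p with
  | 0 => fun t => nseq (hilb 0 t) 0%MM
  | q.+1 => fun t => take (hilb q.+1 t)
      [seq (w + xpow n q (t - mdeg w))%MM |
         w <- flatten [seq stair q e | e <- iota 0 t.+1]]
  end.

(** Deleting x_p sends a monomial of degree [t] in p + 1 variables to one of degree at most [t] in
    [p] variables. Thus [flat p t] enumerates the candidates for [stair p.+1 t]. *)
Definition flat (p t : nat) := flatten [seq stair p e | e <- iota 0 t.+1].

Definition std (p : nat) (u : 'X_{1..n}) : bool := u \in stair p (mdeg u).

Definition pos (p : nat) (u : 'X_{1..n}) : nat := index u (flat p (mdeg u)).

Context (hilb0 : forall t, hilb 0 t.+1 = 0%N).
Context (h0 : (h 0 <= 1)%N).

Lemma hilbS p : (p < n)%N -> hilb p = dplus (hilb p.+1).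
Proof. by move=> lt_pn; rewrite /hilb -(subnSK lt_pn). Qed.

Lemma hilb_full : hilb n = h.
Proof. by rewrite /hilb subnn. Qed.

Lemma hilb_step p t : (p < n)%N ->
  hilb p t.+1 = (hilb p.+1 t.+1 - hilb p.+1 t)%N.
Proof. by move=> lt_pn; rewrite (hilbS lt_pn). Qed.

Lemma hilb_at0 p : hilb p 0 = h 0%N.
Proof. by rewrite /hilb; elim: (n - p)%N. Qed.

(** If [hilb p.+1] vanishes at [t], so does [hilb p], hence [hilb p] vanishes at t + 1 by induction;
    then [hilb p.+1] cannot grow from [t] to t + 1. *)
Lemma hilb_persist p t : (p <= n)%N -> hilb p t = 0%N -> hilb p t.+1 = 0%N.
Proof.
elim: p t => [|p IHp] t le_pn h0t; first exact: hilb0.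
have : hilb p t = 0%N by rewrite hilbS //; case: t h0t => [|t] /= ->.
by move/(IHp _ (ltnW le_pn)); rewrite (hilb_step _ le_pn) h0t subn0.
Qed.

Definition hsum (p t : nat) := (\sum_(0 <= e < t.+1) hilb p e)%N.

Lemma hilb_le_sum p t : (p < n)%N -> (hilb p.+1 t <= hsum p t)%N.
Proof.
move=> lt_pn; elim: t => [|t IHt]; rewrite /hsum.
  by rewrite big_nat1 !hilb_at0.
by rewrite big_nat_recr //= -/(hsum p t) (hilb_step _ lt_pn); lia.
Qed.

(** As long as [hilb p] is positive the subtraction in [dplus] is not truncated, so [hilb p.+1] is a
    cumulative sum and [take] discards no candidate. *)
Lemma hilb_eq_sum p t : (p < n)%N -> (0 < hilb p t)%N -> hilb p.+1 t = hsum p t.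
Proof.
move=> lt_pn; elim: t => [|t IHt]; rewrite /hsum.
  by rewrite big_nat1 !hilb_at0.
move=> pt; have {}IHt : hilb p.+1 t = hsum p t.
  by apply: IHt; rewrite lt0n;
    apply: contraL pt => /eqP /(hilb_persist (ltnW lt_pn)) ->.
rewrite big_nat_recr //= -/(hsum p t) -IHt.
by move: pt; rewrite (hilb_step _ lt_pn); lia.
Qed.

Lemma hilb_incr p t : (p < n)%N -> (hilb p.+1 t < hilb p.+1 t.+1)%N ->
  hilb p.+1 t = hsum p t.
Proof.
move=> lt_pn lt; have pt : (0 < hilb p t.+1)%N by rewrite (hilb_step _ lt_pn) subn_gt0.
by apply: hilb_eq_sum => //; rewrite lt0n;
  apply: contraL pt => /eqP /(hilb_persist (ltnW lt_pn)) ->.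
Qed.

Lemma stairS p t : stair p.+1 t =
  take (hilb p.+1 t) [seq (w + xpow n p (t - mdeg w))%MM | w <- flat p t].
Proof. by []. Qed.

Lemma flatS p t : flat p t.+1 = flat p t ++ stair p t.+1.
Proof.
by rewrite /flat -[t.+2]addn1 iotaD map_cat flatten_cat /= cats0.
Qed.

Lemma size_flat_gen p t : (forall e, size (stair p e) = hilb p e) ->
  size (flat p t) = hsum p t.
Proof.
move=> hs; elim: t => [|t IHt]; rewrite /hsum.
  by rewrite /flat /= cats0 big_nat1.
by rewrite flatS size_cat big_nat_recr //= -/(hsum p t) IHt hs.
Qed.

Lemma size_stair p t : (p <= n)%N -> size (stair p t) = hilb p t.
Proof.
elim: p t => [|p IHp] t lt_pn; first by rewrite size_nseq.
rewrite stairS size_takel // size_map size_flat_gen ?hilb_le_sum // => e.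
exact: IHp (ltnW lt_pn).
Qed.

Lemma size_flat p t : (p <= n)%N -> size (flat p t) = hsum p t.
Proof. by move=> le_pn; apply: size_flat_gen => e; apply: size_stair. Qed.

Lemma flatP p t w :
  reflect (exists2 e, (e <= t)%N & w \in stair p e) (w \in flat p t).
Proof.
apply: (iffP flatten_mapP) => [[e]|[e le_et we]].
  by rewrite mem_iota add0n ltnS => le_et; exists e.
by exists e; rewrite ?mem_iota ?add0n ?ltnS.
Qed.

Lemma stair_deg_supp p t w : (p <= n)%N -> w \in stair p t ->
  mdeg w = t /\ supp_below p w.
Proof.
elim: p t w => [|p IHp] t w lt_pn.
  case: t => [|t]; last by rewrite /= hilb0.
  rewrite /= mem_nseq => /andP[_ /eqP ->]; split; first exact: mdeg0.
  by move=> i _; rewrite mnm0E.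
rewrite stairS => /mem_take/mapP[v /flatP[e le_et]].
move=> /(IHp _ _ (ltnW lt_pn))[ve sv] ->; split.
  by rewrite mdegD mdeg_xpow // ve subnKC.
move=> i lt_pi; rewrite mnmDE sv ?(ltnW lt_pi) // mnmE.
by rewrite gtn_eqF // muln0.
Qed.

Lemma flat_stdE p t w : (p <= n)%N -> (w \in flat p t) = (mdeg w <= t)%N && std p w.
Proof.
move=> le_pn; apply/flatP/andP => [[e le_et we]|[le_wt sw]].
  have [we' _] := stair_deg_supp le_pn we.
  by rewrite /std we'.
by exists (mdeg w).
Qed.

Lemma stdP p t w : (p <= n)%N -> (w \in stair p t) = (mdeg w == t) && std p w.
Proof.
move=> le_pn; apply/idP/andP => [wt|[/eqP <-]//].
by have [we _] := stair_deg_supp le_pn wt; rewrite /std we eqxx.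
Qed.

Lemma std_supp p w : (p <= n)%N -> std p w -> supp_below p w.
Proof. by move=> le_pn /(stair_deg_supp le_pn)[]. Qed.

Lemma flat_sorted_gen p t : (p <= n)%N ->
  (forall e, sorted (@rlt n) (stair p e)) -> sorted (@rlt n) (flat p t).
Proof.
move=> le_pn srt; elim: t => [|t IHt]; first by rewrite /flat /= cats0.
rewrite (sorted_pairwise (@rlt_trans n)) flatS pairwise_cat.
rewrite -!(sorted_pairwise (@rlt_trans n)) IHt srt !andbT.
apply/allrelP => u v; rewrite flat_stdE // stdP //.
by move=> /andP[le_u _] /andP[/eqP ve _]; rewrite /rlt ve ltnS le_u.
Qed.

(** Completing to degree [t] by x_p preserves the order of [flat]: a candidate of smaller degree
    receives a larger power of x_p and becomes smaller, while candidates of equal degree receive the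
    same power. *)
Lemma stair_sorted p t : (p <= n)%N -> sorted (@rlt n) (stair p t).
Proof.
elim: p t => [|p IHp] t le_pn.
  rewrite /=; have : (hilb 0 t <= 1)%N by case: t => [|t]; rewrite ?hilb_at0 ?hilb0.
  by case: (hilb 0 t) => [|[]].
have {}IHp e := IHp e (ltnW le_pn).
rewrite stairS; apply: take_sorted; rewrite (sorted_pairwise (@rlt_trans n)).
have flat_pw : pairwise (@rlt n) (flat p t).
  rewrite -(sorted_pairwise (@rlt_trans n)).
  by apply: flat_sorted_gen IHp; apply: ltnW.
rewrite pairwise_map.
apply: (sub_in_pairwise _ (_ : all [in flat p t] _) flat_pw); last exact/allP.
move=> u v /=; rewrite !flat_stdE ?(ltnW le_pn) //.
move=> /andP[le_u su] /andP[le_v sv] uv /=.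
have [lt|] := ltnP (mdeg u) (mdeg v).
  apply: (@rlt_last _ p _ _ _ _ _ le_pn); rewrite ?mdegD ?mdeg_xpow ?subnKC //.
  - move=> i lt_pi; rewrite mnmDE mnmE (std_supp _ su) ?gtn_eqF ?muln0 //; exact: ltnW.
  - move=> i lt_pi; rewrite mnmDE mnmE (std_supp _ sv) ?gtn_eqF ?muln0 //; exact: ltnW.
  rewrite !mnmDE !mnmE eqxx !muln1 (std_supp _ su) ?(std_supp _ sv) //=; try exact: ltnW.
  lia.
move=> le_vu; have e : mdeg u = mdeg v.
  by apply/eqP; rewrite eqn_leq le_vu (rlt_mdeg uv).
by rewrite e rltD.
Qed.

Lemma flat_sorted p t : (p <= n)%N -> sorted (@rlt n) (flat p t).
Proof. by move=> le_pn; apply: flat_sorted_gen => // e; apply: stair_sorted. Qed.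

(** The lists [flat p t] are prefixes of one another, so the position is independent of the cut-off
    degree. *)
Lemma pos_flat p t w : (p <= n)%N -> std p w -> (mdeg w <= t)%N ->
  index w (flat p t) = pos p w.
Proof.
move=> le_pn sw; elim: t => [|t IHt]; first by rewrite leqn0 /pos => /eqP ->.
rewrite leq_eqVlt => /orP[/eqP <- //|lt_wt].
by rewrite flatS index_cat flat_stdE // -ltnS lt_wt sw IHt.
Qed.

Lemma ltn_pos p w : (p <= n)%N -> std p w -> (pos p w < hsum p (mdeg w))%N.
Proof. by move=> le_pn sw; rewrite -size_flat // index_mem flat_stdE // leqnn. Qed.

Lemma rlt_pos p u v : (p <= n)%N -> std p u -> std p v ->
  rlt u v = (pos p u < pos p v)%N.
Proof.
move=> le_pn su sv; pose t := maxn (mdeg u) (mdeg v).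
have um : u \in flat p t by rewrite flat_stdE // su leq_maxl.
have vm : v \in flat p t by rewrite flat_stdE // sv leq_maxr.
rewrite -(pos_flat le_pn su (leq_maxl _ (mdeg v))).
rewrite -(pos_flat le_pn sv (leq_maxr (mdeg u) _)) -/t.
have srt := flat_sorted t le_pn.
have lt_index x y : x \in flat p t -> y \in flat p t ->
    (index x (flat p t) < index y (flat p t))%N -> rlt x y.
  exact: (sorted_ltn_index (@rlt_trans n) srt).
case: (ltngtP (index u (flat p t)) (index v (flat p t))) => [lt|lt|e].
- exact: lt_index.
- by apply/negP => uv; apply: (rlt_asym uv); apply: lt_index.
by rewrite -(nth_index 0%MM um) e nth_index // rlt_irr.
Qed.

(** The working criterion for standardness: w x_p^b is kept exactly when [w] comes early enough in
    [flat]. It turns divisibility and exchange properties into comparisons of positions. *)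
Lemma std_mulX p w b : (p < n)%N -> std p w ->
  std p.+1 (w + xpow n p b) = (pos p w < hilb p.+1 (mdeg w + b))%N.
Proof.
move=> lt_pn sw; have le_pn := ltnW lt_pn.
have wf t : (mdeg w <= t)%N -> w \in flat p t by move=> le; rewrite flat_stdE // le.
rewrite /std mdegD mdeg_xpow // stairS; set t := (mdeg w + b)%N.
have le_wt : (mdeg w <= t)%N by apply: leq_addr.
have bE : b = (t - mdeg w)%N by rewrite /t addKn.
pose f (v : 'X_{1..n}) := (v + xpow n p (t - mdeg v))%MM.
have f_inj : {in flat p t &, injective f}.
  move=> u v; rewrite !flat_stdE // => /andP[_ su] /andP[_ sv] fuv.
  apply/mnmP => i; move/mnmP/(_ i): fuv; rewrite !mnmDE !mnmE.
  case: (leqP p i) => [le_pi|lt_ip]; first by rewrite !(std_supp le_pn) ?su.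
  by rewrite (ltn_eqF lt_ip) !muln0 !addn0.
rewrite {1}bE -/(f w) -map_take; apply/mapP/idP.
  case=> v vt wv; have vm := mem_take vt.
  have <- : v = w by apply: f_inj (wf _ le_wt) _ => //.
  move: vt; rewrite in_take //.
  by move: vm; rewrite flat_stdE // => /andP[le_v sv]; rewrite pos_flat.
move=> lt; exists w => //.
by rewrite in_take ?wf // pos_flat.
Qed.

Lemma stdS_split p u : (p < n)%N -> std p.+1 u ->
  exists2 w, std p w & exists b, u = (w + xpow n p b)%MM.
Proof.
move=> lt_pn; rewrite /std stairS => /mem_take/mapP[w].
by rewrite flat_stdE ?(ltnW lt_pn) // => /andP[_ sw] ->;
  exists w => //; exists (mdeg u - mdeg w)%N.
Qed.

Lemma std_lt_size p w : (p < n)%N -> std p w ->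
  (pos p w < hilb p.+1 (mdeg w))%N.
Proof.
move=> lt_pn sw; have le_pn := ltnW lt_pn.
rewrite hilb_eq_sum ?ltn_pos // -size_stair //.
by move: sw; rewrite /std; case: (stair p (mdeg w)).
Qed.

Lemma stdS_base p u : (p < n)%N -> supp_below p u -> std p.+1 u = std p u.
Proof.
move=> lt_pn su; have u0 : (u + xpow n p 0)%MM = u.
  by apply/mnmP => i; rewrite mnmDE mnmE mul0n addn0.
apply/idP/idP => [/(stdS_split lt_pn)[w sw [b uE]]|sw]; last first.
  by rewrite -u0 std_mulX // addn0 std_lt_size.
suff -> : u = w by [].
have b0 : b = 0%N.
  have := su (Ordinal lt_pn) (leqnn _).
  by rewrite uE mnmDE mnmE eqxx muln1 => /eqP; rewrite addn_eq0 => /andP[_ /eqP].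
by rewrite uE b0; apply/mnmP => i; rewrite mnmDE mnmE mul0n addn0.
Qed.

(** Lowering the degree by one could hurt only where [hilb p.+1] increases, but there nothing was
    discarded in degree [s]. *)
Lemma pos_pred p w s : (p < n)%N -> std p w -> (mdeg w <= s)%N ->
  (pos p w < hilb p.+1 s.+1)%N -> (pos p w < hilb p.+1 s)%N.
Proof.
move=> lt_pn sw le_ws lt; case: (leqP (hilb p.+1 s.+1) (hilb p.+1 s)) => [le|lt'].
  exact: leq_trans lt le.
rewrite hilb_incr //; apply: leq_trans (ltn_pos (ltnW lt_pn) sw) _.
rewrite /hsum [X in (_ <= X)%N](big_cat_nat (n := (mdeg w).+1)) //=.
exact: leq_addr.
Qed.

Lemma xpowS p b (lt_pn : (p < n)%N) :
  xpow n p b.+1 = (xpow n p b + U_(Ordinal lt_pn))%MM.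
Proof.
apply/mnmP => i; rewrite mnmDE !mnmE -val_eqE /= eq_sym.
by case: (p == i); rewrite ?muln1 ?muln0 ?addn1.
Qed.

(** The nonstandard monomials span an ideal. Division by x_p is [pos_pred]; division by an earlier
    variable lowers the degree of the x_p-free part, hence also its position. *)
Lemma std_div p u (k : 'I_n) : (p <= n)%N -> std p (u + U_(k)) -> std p u.
Proof.
elim: p u => [|p IHp] u lt_pn.
  move=> /(std_supp (leq0n n))/(_ k (leq0n k)).
  by rewrite mnmDE mnm1E eqxx addn1.
have le_pn := ltnW lt_pn.
move=> suk; have [w sw [b uE]] := stdS_split lt_pn suk.
have lt_pos : (pos p w < hilb p.+1 (mdeg w + b))%N.
  by rewrite -std_mulX // -uE.
case: (eqVneq (k : nat) p) => [kp|kp].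
  case: b uE lt_pos => [|b] uE lt_pos.
    move/mnmP/(_ k): uE; rewrite !mnmDE mnm1E mnmE eqxx (std_supp le_pn sw) ?kp //.
    by rewrite addn1.
  have kE : k = Ordinal lt_pn by apply: val_inj.
  have -> : u = (w + xpow n p b)%MM.
    by apply: (@addIm _ U_(k)%MM); rewrite uE (xpowS _ lt_pn) kE addmA.
  by rewrite std_mulX // pos_pred ?leq_addr // -addnS.
have wk : (0 < w k)%N.
  move/mnmP/(_ k): uE; rewrite !mnmDE mnm1E mnmE eqxx (negbTE kp) muln0; lia.
have wE : w = (w - U_(k) + U_(k))%MM by rewrite submK // lep1mP -lt0n.
have sw' : std p (w - U_(k)) by apply: IHp; rewrite // -wE.
have -> : u = (w - U_(k) + xpow n p b)%MM.
  by apply: (@addIm _ U_(k)%MM); rewrite uE {1}wE -!addmA [(U_(k) + _)%MM]addmC.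
have dw : mdeg w = (mdeg (w - U_(k))%MM).+1 by rewrite {1}wE mdegD mdeg1 addn1.
rewrite std_mulX // pos_pred ?leq_addr // -addSn -dw.
apply: ltn_trans lt_pos; rewrite -rlt_pos //.
by rewrite /rlt dw ltnSn.
Qed.

Lemma rlt_borel (j q : 'I_n) u : (j < q)%N -> rlt (u + U_(q)) (u + U_(j)).
Proof.
move=> lt_jq; apply/rlt_degP; first by rewrite !mdegD !mdeg1.
exists q => [|i lt_qi].
  by rewrite !mnmDE !mnm1E eqxx -val_eqE /= ltn_eqF // addn1 addn0.
by rewrite !mnmDE !mnm1E -!val_eqE /= (ltn_eqF lt_qi) (ltn_eqF (ltn_trans lt_jq lt_qi)).
Qed.

(** Strong stability of the ideal, seen on its complement: replacing x_j by a later variable makes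
    the x_p-free part revlex-smaller, so its position decreases while the cut-off stays the same. *)
Lemma std_borel p u (j q : 'I_n) : (p <= n)%N -> (j < q)%N -> (q < p)%N ->
  std p (u + U_(j)) -> std p (u + U_(q)).
Proof.
elim: p u => [|p IHp] u // lt_pn lt_jq lt_qp suj.
have le_pn := ltnW lt_pn.
have [w sw [b uE]] := stdS_split lt_pn suj.
have lt_pos : (pos p w < hilb p.+1 (mdeg w + b))%N by rewrite -std_mulX // -uE.
have jp : (j == p :> nat) = false.
  by apply/negbTE; rewrite ltnS in lt_qp; rewrite ltn_eqF // (leq_trans lt_jq).
have wj : (0 < w j)%N.
  move/mnmP/(_ j): uE; rewrite !mnmDE mnm1E mnmE eqxx jp muln0; lia.
pose w0 := (w - U_(j))%MM.
have wE : w = (w0 + U_(j))%MM by rewrite submK // lep1mP -lt0n.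
have u0E : u = (w0 + xpow n p b)%MM.
  by apply: (@addIm _ U_(j)%MM); rewrite uE {1}wE -!addmA [(U_(j) + _)%MM]addmC.
have dw : mdeg w = (mdeg w0).+1 by rewrite {1}wE mdegD mdeg1 addn1.
case: (eqVneq (q : nat) p) => [qp|qp].
  have sw0 : std p w0 by apply: (@std_div _ _ j); rewrite // -wE.
  have qE : q = Ordinal lt_pn by apply: val_inj.
  have -> : (u + U_(q) = w0 + xpow n p b.+1)%MM.
    by rewrite u0E (xpowS _ lt_pn) qE addmA.
  rewrite std_mulX // addnS -addSn -dw; apply: ltn_trans lt_pos.
  by rewrite -rlt_pos // /rlt dw ltnSn.
have sw' : std p (w0 + U_(q)).
  by apply: IHp; rewrite // -?wE //; move: lt_qp; rewrite ltnS leq_eqVlt (negbTE qp).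
have -> : (u + U_(q) = w0 + U_(q) + xpow n p b)%MM.
  by rewrite u0E -!addmA [(U_(q) + _)%MM]addmC.
rewrite std_mulX //; have -> : mdeg (w0 + U_(q))%MM = mdeg w.
  by rewrite mdegD mdeg1 dw addn1.
apply: ltn_trans lt_pos; rewrite -rlt_pos // [X in rlt _ X]wE.
exact: rlt_borel.
Qed.

Lemma supp_split p u : (p < n)%N -> supp_below p.+1 u ->
  exists2 w, supp_below p w & exists b, u = (w + xpow n p b)%MM.
Proof.
move=> lt_pn su; pose b := u (Ordinal lt_pn).
exists [multinom if i == p :> nat then 0%N else u i | i < n].
  move=> i; rewrite mnmE leq_eqVlt eq_sym; case: eqP => //= _; exact: su.
exists b; apply/mnmP => i; rewrite mnmDE !mnmE; case: eqP => [ip|_].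
  by rewrite muln1 add0n; congr (u _); apply: val_inj.
by rewrite muln0 addn0.
Qed.

(** The almost revlex property. Write u = w x_p^b and v = y x_p^c. If c > b, then [v] is below [u];
    if b = 0, induction applies. Otherwise u / x_p is standard, so [w] is standard but positioned
    past the cut-off, hence after [y]; comparing degrees puts [v] below [u] again. *)
Lemma std_generator p u v : (p <= n)%N -> supp_below p u -> supp_below p v ->
  std p v -> ~~ std p u ->
  (forall k u', u = (u' + U_(k))%MM -> std p u') ->
  mdeg v = mdeg u -> ~~ rlt u v.
Proof.
elim: p u v => [|p IHp] u v lt_pn su sv stv stu gu e.
  have u0 (w : 'X_{1..n}) : supp_below 0 w -> w = 0%MM.
    by move=> sz; apply/mnmP => i; rewrite sz ?mnm0E.
  by rewrite (u0 u su) (u0 v sv) rlt_irr.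
have le_pn := ltnW lt_pn.
have [y sty [c vE]] := stdS_split lt_pn stv.
have lt_y : (pos p y < hilb p.+1 (mdeg y + c))%N by rewrite -std_mulX // -vE.
have [w sw [b uE]] := supp_split lt_pn su.
have ev : mdeg v = (mdeg y + c)%N by rewrite vE mdegD mdeg_xpow.
have eu : mdeg u = (mdeg w + b)%N by rewrite uE mdegD mdeg_xpow.
have vp : v (Ordinal lt_pn) = c.
  by rewrite vE mnmDE mnmE eqxx muln1 (std_supp le_pn sty) //=.
have up : u (Ordinal lt_pn) = b by rewrite uE mnmDE mnmE eqxx muln1 sw.
case: (ltnP b c) => [lt_bc|le_cb].
  apply/negP => uv; apply: (rlt_asym uv).
  by apply: (rlt_last e sv su (lt_pn := lt_pn)); rewrite up vp.
case: b uE eu up le_cb => [|b] uE eu up le_cb.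
  have xp0 z : (z + xpow n p 0)%MM = z.
    by apply/mnmP => i; rewrite mnmDE mnmE mul0n addn0.
  have c0 : c = 0%N by lia.
  rewrite xp0 in uE; rewrite c0 xp0 in vE.
  apply: IHp => //; rewrite ?uE ?vE //.
  - by apply: std_supp.
  - by rewrite -stdS_base // -uE.
  - move=> k u' wE; rewrite -stdS_base //.
      by apply: (gu k); rewrite uE.
    move=> i le_pi; have := sw i le_pi; rewrite wE mnmDE; lia.
have stw : std p w.
  have stw : std p.+1 (w + xpow n p b).
    by apply: (gu (Ordinal lt_pn)); rewrite uE (xpowS _ lt_pn) addmA.
  have [w' sw' [b' wE']] := stdS_split lt_pn stw.
  suff -> : w = w' by [].
  apply/mnmP => i; move/mnmP/(_ i): wE'; rewrite !mnmDE !mnmE.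
  case: (leqP p i) => [le_pi|lt_ip]; first by rewrite sw ?(std_supp le_pn sw').
  by rewrite (ltn_eqF lt_ip) !muln0 !addn0.
have ge_w : (hilb p.+1 (mdeg u) <= pos p w)%N.
  by rewrite leqNgt eu -std_mulX // -uE.
have yw : rlt y w by rewrite (rlt_pos le_pn sty stw) (leq_trans lt_y) // -ev e.
apply/negP => uv; apply: (rlt_asym uv).
have := rlt_mdeg yw; rewrite leq_eqVlt => /orP[/eqP e'|lt_d]; last by lia.
have cb : c = b.+1 by lia.
by rewrite uE vE cb rltD.
Qed.

(** In these monomial bases, multiplication by x_p^s is the partial identity on positions, which is
    why it has full rank. *)
Lemma nth_stair_shift p t s r : (p < n)%N ->
  (r < hilb p.+1 t)%N -> (r < hilb p.+1 (t + s))%N ->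
  nth 0%MM (stair p.+1 (t + s)) r = (nth 0%MM (stair p.+1 t) r + xpow n p s)%MM.
Proof.
move=> lt_pn lt_rt lt_rts; have le_pn := ltnW lt_pn.
rewrite !stairS !nth_take //.
have lt_rf : (r < size (flat p t))%N.
  by rewrite size_flat // (leq_trans lt_rt) // hilb_le_sum.
have flat_nth : nth 0%MM (flat p (t + s)) r = nth 0%MM (flat p t) r.
  elim: s {lt_rts} => [|s IHs]; first by rewrite addn0.
  rewrite addnS flatS nth_cat IHs; case: ltnP => // le_r.
  have : (size (flat p t) <= size (flat p (t + s)))%N.
    elim: s {IHs le_r} => [|s IHs]; first by rewrite addn0.
    by rewrite addnS flatS size_cat (leq_trans IHs) // leq_addr.
  by move/(leq_trans lt_rf); rewrite ltnNge le_r.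
have lt_rfs : (r < size (flat p (t + s)))%N.
  by rewrite size_flat // (leq_trans lt_rts) // hilb_le_sum.
rewrite !(nth_map 0%MM) // flat_nth -addmA; congr (_ + _)%MM.
have : nth 0%MM (flat p t) r \in flat p t by apply: mem_nth.
rewrite flat_stdE // => /andP[le_d _].
apply/mnmP => i; rewrite mnmDE !mnmE -mulnDl; congr (_ * _)%N.
by lia.
Qed.

Lemma stair_uniq p t : (p <= n)%N -> uniq (stair p t).
Proof.
by move=> le_pn; apply: sorted_uniq (@rlt_trans n) (@rlt_irr n) _ (stair_sorted _ le_pn).
Qed.

Lemma std_lift p q u : (p <= q <= n)%N -> supp_below p u -> std q u = std p u.
Proof.
move=> /andP[le_pq le_qn] su; elim: q le_pq le_qn => [|q IHq].
  by rewrite leqn0 => /eqP ->.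
rewrite leq_eqVlt => /orP[/eqP <- //|le_pq] lt_qn.
rewrite stdS_base ?IHq ?(ltnW lt_qn) // => i le_qi.
by apply: su; rewrite ltnS in le_pq; apply: leq_trans le_qi.
Qed.

End Staircase.

Arguments stair : simpl never.

(** * Monomial ideals *)

Section MonomialIdeals.
Context (K : fieldType) (n : nat).
Local Notation R := {mpoly K[n]}.
Implicit Types (S : 'X_{1..n} -> Prop) (f g : R) (I : R -> Prop).

Definition monid S f : Prop := forall m, m \in msupp f -> S m.

Lemma monid_is_ideal S : (forall m k, S m -> S (m + k)%MM) -> is_ideal (monid S).
Proof.
move=> Sup; split.
- by move=> m; rewrite msupp0.
- move=> f g If Ig m /msuppD_le; rewrite mem_cat => /orP[/If|/Ig] //.
move=> r f If m /msuppM_le/allpairsP[[m1 m2] /= [_ /If m2f ->]].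
by rewrite addmC; apply: Sup.
Qed.

Lemma monidX S m : monid S 'X_[m] <-> S m.
Proof.
split=> [h|Sm k]; first by apply: h; rewrite msuppX inE.
by rewrite msuppX inE => /eqP ->.
Qed.

Lemma ideal_sub I f g : is_ideal I -> I f -> I g -> I (f - g).
Proof. by case=> _ ID IM If Ig; apply: ID => //; rewrite -mulN1r; apply: IM. Qed.

Lemma idealN I f : is_ideal I -> I f -> I (- f).
Proof. by case=> _ ID IM If; rewrite -mulN1r; apply: IM. Qed.

Lemma idealZ I (c : K) f : is_ideal I -> I f -> I (c *: f).
Proof. by case=> _ ID IM If; rewrite -mul_mpolyC; apply: IM. Qed.

Lemma ideal_sum I (T : eqType) (r : seq T) (P : pred T) (F : T -> R) :
  is_ideal I -> (forall i, i \in r -> P i -> I (F i)) -> I (\sum_(i <- r | P i) F i).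
Proof.
case=> I0 ID _ IF; rewrite big_seq_cond.
by elim/big_rec: _ => // i x /andP[ir Pi]; apply: ID; apply: IF.
Qed.

Lemma ideal_monomials I f :
  is_ideal I -> (forall m, m \in msupp f -> I 'X_[m]) -> I f.
Proof.
move=> Iid h; rewrite [f]mpolyE; apply: ideal_sum => // m mf _.
by apply: idealZ => //; apply: h.
Qed.

Lemma ideal_gen_is_ideal (G : R -> Prop) : is_ideal (ideal_gen G).
Proof.
split=> [I [] //|f g hf hg I Iid GI|r f hf I Iid GI].
  by case: (Iid) => _ ID _; apply: ID; [apply: hf | apply: hg].
by case: (Iid) => _ _; apply; apply: hf.
Qed.

Lemma ideal_gen_mem (G : R -> Prop) f : G f -> ideal_gen G f.
Proof. by move=> Gf I _; apply. Qed.

Lemma ideal_gen_min (G I : R -> Prop) f :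
  is_ideal I -> (forall g, G g -> I g) -> ideal_gen G f -> I f.
Proof. by move=> Iid GI; apply. Qed.

Lemma monid_gen S f : ideal_gen (fun p => exists2 m, S m & p = 'X_[m]) f <->
  monid (fun m => exists2 s, S s & (s <= m)%MM) f.
Proof.
split.
  apply: ideal_gen_min => [|g [m Sm ->]].
    apply: monid_is_ideal => m k [s Ss le_sm]; exists s => //.
    exact: lepm_trans le_sm (lem_addr _ _).
  by apply/monidX; exists m => //; apply: lepm_refl.
move=> h; apply: ideal_monomials => [|m /h[s Ss le_sm]].
  exact: ideal_gen_is_ideal.
rewrite -(submK le_sm) mpolyXD;
  have [_ _] := ideal_gen_is_ideal (fun p => exists2 m, S m & p = 'X_[m]).
by apply; apply: ideal_gen_mem; exists s.
Qed.

Lemma monid_graded S : (forall m k, S m -> S (m + k)%MM) -> graded_ideal (monid S).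
Proof.
move=> Sup; split; first exact: monid_is_ideal.
move=> f d If m; rewrite -[pihomog mdeg d f]/(mrestr (fun m => mdeg m == d) f).
rewrite mcoeff_msupp mcoeff_mrestr; case: ifP => [_|]; rewrite ?eqxx //.
by rewrite -mcoeff_msupp => /If.
Qed.

Lemma mcoeff_sum_nth N (s : seq 'X_{1..n}) (c : 'I_N -> K) m : uniq s -> size s = N ->
  (\sum_a c a *: 'X_[nth 0%MM s a])@_m =
  if insub (index m s) is Some a then c a else 0.
Proof.
move=> us sN; rewrite raddf_sum /=; case: insubP => [a|].
  move=> lt_a aE; rewrite (bigD1 a) //= big1 => [|b ba].
    by rewrite addr0 mcoeffZ mcoeffX aE nth_index -?index_mem ?sN ?eqxx ?mulr1.
  rewrite mcoeffZ mcoeffX; case: eqP => [bm|_]; rewrite ?mulr0 //.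
  case/eqP: ba; apply: val_inj; rewrite /= aE -bm index_uniq // sN ltn_ord //.
move=> nlt; have ms : m \notin s by rewrite -index_mem sN.
rewrite big1 // => b _.
rewrite mcoeffZ mcoeffX; case: eqP => [bm|_]; rewrite ?mulr0 //.
by rewrite -bm mem_nth // sN in ms.
Qed.

(** Equal finite dimensions in degree [t] turn an inclusion of degree-[t] parts into an equality: a
    basis modulo the larger ideal is also one modulo the smaller. *)
Lemma hilbert_function_eq (I J : R -> Prop) (h : nat -> nat) t :
  is_ideal I -> is_ideal J -> is_hilbert_function I h -> is_hilbert_function J h ->
  (forall f, f \is t.-homog -> I f -> J f) ->
  forall f, f \is t.-homog -> J f -> I f.
Proof.
move=> Iid Jid hI hJ IJ f hf Jf.
have [b [b_hom b_span _]] := hI t; have [b' [b'_hom b'_span b'_free]] := hJ t.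
have pick a : {c : 'I_(h t) -> K | I (b' a - \sum_j c j *: b j)}.
  exact: constructive_indefinite_description (b_span _ (b'_hom a)).
pose X := \matrix_a \row_j sval (pick a) j.
have hX a : I (b' a - \sum_j X a j *: b j).
  under eq_bigr do rewrite !mxE; by case: (pick a).
have comb (c : 'rV_(h t)) : I (\sum_a c 0 a *: b' a - \sum_j (c *m X) 0 j *: b j).
  have -> : \sum_j (c *m X) 0 j *: b j = \sum_a c 0 a *: \sum_j X a j *: b j.
    under eq_bigr do rewrite mxE scaler_suml.
    rewrite exchange_big; apply: eq_bigr => a _ /=; rewrite scaler_sumr.
    by apply: eq_bigr => j _; rewrite scalerA.
  rewrite -sumrB; apply: ideal_sum => // a _ _.
  by rewrite -scalerBr; apply: idealZ.
have b'h (c : 'rV_(h t)) : \sum_a c 0 a *: b' a \is t.-homog.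
  by apply: rpred_sum => a _; apply: rpredZ.
have Xfree : row_free X.
  apply: inj_row_free => c cX.
  have := comb c; rewrite cX; under [X in _ - X]eq_bigr do rewrite mxE scale0r.
  rewrite big1_eq subr0 => /(IJ _ (b'h c)) /b'_free h0.
  by apply/rowP => a; rewrite mxE; apply: h0.
have [c hc] := b_span _ hf.
have Xu : X \in unitmx by rewrite -row_free_unit.
have fE : I (f - \sum_a ((\row_j c j) *m invmx X) 0 a *: b' a).
  have h1 := comb ((\row_j c j) *m invmx X); rewrite mulmxKV // in h1.
  have := ideal_sub Iid hc h1; suff -> : \sum_j (\row_j c j) 0 j *: b j =
      \sum_j c j *: b j by rewrite opprB addrA subrK.
  by apply: eq_bigr => j _; rewrite mxE.
have : J (\sum_a ((\row_j c j) *m invmx X) 0 a *: b' a).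
  have JfE := IJ _ (rpredB hf (b'h _)) fE.
  by have := ideal_sub Jid Jf JfE; rewrite opprB addrC subrK.
move/b'_free => c0; move: fE; rewrite big1 ?subr0 // => a _.
by rewrite c0 scale0r.
Qed.

(** Replaces the generating set by an intrinsic condition: a generator is a monomial of I none of
    whose quotients by a variable lies in I. *)
Lemma almost_revlexP I : almost_revlex I ->
  [/\ is_ideal I, forall f, I f -> forall m, m \in msupp f -> I 'X_[m]
    & forall u v, I 'X_[u] -> (forall k u', u = (u' + U_(k))%MM -> ~ I 'X_[u']) ->
        mdeg v = mdeg u -> revlex_gt v u -> I 'X_[v]].
Proof.
case=> S [gen _] hS.
have IE f : I f <-> monid (fun m => exists2 s, S s & (s <= m)%MM) f.
  by rewrite -monid_gen; apply: gen.
split.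
- have [I0 ID IM] := ideal_gen_is_ideal (fun p => exists2 m, S m & p = 'X_[m]).
  split; first exact/gen.
    by move=> f g /gen hf /gen hg; apply/gen; apply: ID.
  by move=> r f /gen hf; apply/gen; apply: IM.
- by move=> f /IE If m /If h; apply/IE/monidX.
move=> u v /IE/monidX[s Ss le_su] hu e uv.
suff us : s = u by apply: (hS u v) => //; rewrite -us.
apply/mnmP => i; apply/eqP; rewrite eqn_leq (mnm_lepP le_su) /= leqNgt.
apply/negP => lt_i; have ui : (U_(i) <= u)%MM by rewrite lep1mP; lia.
apply: (hu i (u - U_(i))%MM); first by rewrite submK.
apply/IE/monidX; exists s => //; apply/mnm_lepP => j; rewrite mnmBE mnm1E.
case: eqP => [<-|_]; last by rewrite subn0; apply: (mnm_lepP le_su).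
by rewrite -ltnS subn1 prednK // (leq_ltn_trans _ lt_i).
Qed.

(** Induction on the degree. If in degree [t] each ideal had a monomial missing from the other, both
    would be minimal generators, and the revlex-larger one would belong to both ideals. So one ideal
    contains the other in degree [t], and dimensions give equality. *)
Lemma almost_revlex_unique I J h : almost_revlex I -> almost_revlex J ->
  is_hilbert_function I h -> is_hilbert_function J h -> forall f, I f <-> J f.
Proof.
move=> /almost_revlexP[Iid Im Igen] /almost_revlexP[Jid Jm Jgen] hI hJ.
suff eqIJ m : I 'X_[m] <-> J 'X_[m].
  by move=> f; split=> [/Im h1|/Jm h1]; apply: ideal_monomials => // m /h1 /eqIJ.
move: {2}(mdeg m) (erefl (mdeg m)) => t.
elim/ltn_ind: t m => t IHt.
have half (A B : R -> Prop) : is_ideal A -> is_ideal B ->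
    (forall f, A f -> forall m, m \in msupp f -> A 'X_[m]) ->
    is_hilbert_function A h -> is_hilbert_function B h ->
    (forall m, mdeg m = t -> A 'X_[m] -> B 'X_[m]) ->
    forall m, mdeg m = t -> A 'X_[m] <-> B 'X_[m].
  move=> Aid Bid Am hA hB AB m mt; split; first exact: AB.
  apply: (hilbert_function_eq Aid Bid hA hB); last by rewrite dhomogX; apply/eqP.
  move=> f /dhomogP hf Af; apply: ideal_monomials => // k kf.
  by exact: (AB k (etrans (hf k kf) mt) (Am _ Af _ kf)).
case: (classic (exists2 u, mdeg u = t & I 'X_[u] /\ ~ J 'X_[u])) =>
  [[u1 u1t [Iu1 Ju1]]|no].
  case: (classic (exists2 u, mdeg u = t & J 'X_[u] /\ ~ I 'X_[u])) =>
    [[u2 u2t [Ju2 Iu2]]|no].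
    exfalso.
    have g1 k u' : u1 = (u' + U_(k))%MM -> ~ I 'X_[u'].
      move=> uE Iu'; apply: Ju1; rewrite uE mpolyXD mulrC.
      have [_ _] := Jid; apply; apply/(IHt (mdeg u')) => //.
      by rewrite -u1t uE mdegD mdeg1 addn1.
    have g2 k u' : u2 = (u' + U_(k))%MM -> ~ J 'X_[u'].
      move=> uE Ju'; apply: Iu2; rewrite uE mpolyXD mulrC.
      have [_ _] := Iid; apply; apply/(IHt (mdeg u')) => //.
      by rewrite -u2t uE mdegD mdeg1 addn1.
    have ne : u1 != u2 by apply/eqP => e; apply: Ju1; rewrite e.
    case/orP: (rlt_total ne) => /rltP gt.
      by apply: Iu2; apply: Igen gt; rewrite ?u1t.
    by apply: Ju1; apply: Jgen gt; rewrite ?u1t.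
  move=> m mt; apply: iff_sym; apply: (half J I) => // k kt Jk.
  by apply: NNPP => Ik; apply: no; exists k.
apply: half => // k kt Ik.
by apply: NNPP => Jk; apply: no; exists k.
Qed.

End MonomialIdeals.

(** * The almost revlex ideal with a given Hilbert function *)

Section StaircaseIdeal.
Context (K : fieldType) (n : nat) (h : nat -> nat).
Context (hilb0 : forall t, hilb n h 0 t.+1 = 0%N) (h0 : (h 0 <= 1)%N).
Local Notation R := {mpoly K[n]}.
Local Notation std := (@std n h).
Local Notation stair := (stair n h).
Local Notation hilb := (hilb n h).

(** An ideal of the full ring for every [p]: since [std p] restricts the support, it contains all
    variables of index at least [p]. By [add_gens_stairI] it is [stairI n] plus these variables. *)
Definition stairI (p : nat) : R -> Prop := monid (fun m => ~~ std p m).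

Lemma std_divm p u m : (p <= n)%N -> std p (u + m)%MM -> std p u.
Proof.
move=> le_pn; move: {2}(mdeg m) (erefl (mdeg m)) => d.
elim: d m u => [|d IHd] m u.
  by move/eqP; rewrite mdeg_eq0 => /eqP ->; rewrite addm0.
move=> md; have [i mi] : exists i, m i != 0%N.
  apply/existsP; rewrite -negb_forall; apply/negP => /forallP m0.
  suff mE : m = 0%MM by rewrite mE mdeg0 in md.
  by apply/mnmP => i; rewrite mnm0E; apply/eqP.
have mE : m = (m - U_(i) + U_(i))%MM by rewrite submK // lep1mP.
rewrite mE addmA => /(std_div hilb0 h0 le_pn)/IHd; apply.
by apply: succn_inj; rewrite -md [in RHS]mE mdegD mdeg1 addn1.
Qed.

Lemma nstd_up p m k : (p <= n)%N -> ~~ std p m -> ~~ std p (m + k)%MM.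
Proof. by move=> le_pn; apply: contra => /(std_divm le_pn). Qed.

Lemma stairI_graded p : (p <= n)%N -> graded_ideal (stairI p).
Proof. by move=> le_pn; apply: monid_graded => m k; apply: nstd_up. Qed.

Lemma stairI_is_ideal p : (p <= n)%N -> is_ideal (stairI p).
Proof. by move=> le_pn; have [] := stairI_graded le_pn. Qed.

Lemma nth_stair_std p t r : (p <= n)%N -> (r < hilb p t)%N ->
  std p (nth 0%MM (stair p t) r) /\ mdeg (nth 0%MM (stair p t) r) = t.
Proof.
move=> le_pn lt_r.
have : nth 0%MM (stair p t) r \in stair p t by rewrite mem_nth // size_stair.
by rewrite (stdP hilb0) // => /andP[/eqP -> ->].
Qed.

Lemma stairI_hilbert p : (p <= n)%N -> is_hilbert_function (stairI p) (hilb p).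
Proof.
move=> le_pn t; exists (fun a => 'X_[nth 0%MM (stair p t) a]).
have us := stair_uniq hilb0 h0 t le_pn.
have ss := size_stair h0 t le_pn.
split.
- move=> a; rewrite dhomogX; apply/eqP.
  by have [_ ] := nth_stair_std le_pn (ltn_ord a).
- move=> f hf; exists (fun a => f@_(nth 0%MM (stair p t) a)) => m.
  rewrite mcoeff_msupp mcoeffB mcoeff_sum_nth //.
  apply: contraNN => sm.
  have [mt|mt] := eqVneq (mdeg m) t.
    have ms : m \in stair p t by rewrite -mt.
    case: insubP => [a _ ->|]; first by rewrite nth_index // subrr.
    by rewrite -{1}ss index_mem ms.
  rewrite (dhomog_nemf_coeff hf mt) sub0r oppr_eq0.
  case: insubP => [a lt_a aE|//].
  case/eqP: mt; have := nth_stair_std le_pn lt_a.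
  by rewrite nth_index -?index_mem ?ss // => -[].
move=> c Ic a; apply/eqP/negPn/negP => ca.
have := Ic (nth 0%MM (stair p t) a).
have [-> _] := nth_stair_std le_pn (ltn_ord a).
rewrite mcoeff_msupp mcoeff_sum_nth // index_uniq ?ss //.
by rewrite valK => /(_ ca).
Qed.

Lemma mult_xvar p s (f : R) (lt_pn : (p < n)%N) :
  'X_(Ordinal lt_pn) ^+ s * f = 'X_[xpow n p s] * f.
Proof.
rewrite mpolyXn; congr ('X_[_] * f); apply/mnmP => j.
by rewrite mulmnE mnm1E mnmE -val_eqE /= mulnC eq_sym.
Qed.

Lemma stairI_SLP p (lt_pn : (p < n)%N) : SLP (stairI p.+1) 'X_(Ordinal lt_pn).
Proof.
move=> i s _; case: (leqP (hilb p.+1 i) (hilb p.+1 (i + s))) => [le_h|lt_h].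
  left=> f hf; rewrite mult_xvar => If m mf; apply/negP => sm.
  have mi : mdeg m = i by apply: (dhomogP _ _ _ hf).
  have ms : m \in stair p.+1 i by rewrite -mi.
  have lt_r : (index m (stair p.+1 i) < hilb p.+1 i)%N.
    by rewrite -(size_stair h0 i lt_pn) index_mem.
  have lt_r' := leq_trans lt_r le_h.
  have := nth_stair_shift hilb0 h0 lt_pn lt_r lt_r'; rewrite nth_index // => E.
  have [sE _] := nth_stair_std lt_pn lt_r'; rewrite E in sE.
  have := If (m + xpow n p s)%MM.
  by rewrite mulrC addmC mcoeff_msupp mcoeffMX -mcoeff_msupp addmC sE => /(_ mf).
right=> g hg.
have fac m : mdeg m = (i + s)%N -> std p.+1 m ->
    (xpow n p s <= m)%MM /\ mdeg (m - xpow n p s)%MM = i.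
  move=> mis sm; have ms : m \in stair p.+1 (i + s) by rewrite -mis.
  have lt_r' : (index m (stair p.+1 (i + s)) < hilb p.+1 (i + s))%N.
    by rewrite -(size_stair h0 _ lt_pn) index_mem.
  have lt_r := ltn_trans lt_r' lt_h.
  have := nth_stair_shift hilb0 h0 lt_pn lt_r lt_r'; rewrite nth_index // => ->.
  split; first exact: lem_addl.
  by rewrite addmK; have [_] := nth_stair_std lt_pn lt_r.
exists (\sum_(m <- msupp g | std p.+1 m) g@_m *: 'X_[m - xpow n p s]).
  rewrite big_seq_cond; apply: rpred_sum => m /andP[mg sm]; apply: rpredZ.
  by rewrite dhomogX; apply/eqP; have [] := fac m (dhomogP _ _ _ hg m mg) sm.
rewrite mult_xvar mulr_sumr big_seq_cond.
rewrite (eq_bigr (fun m => g@_m *: 'X_[m])); last first.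
  move=> m /andP[mg sm]; have [le_x _] := fac m (dhomogP _ _ _ hg m mg) sm.
  by rewrite -scalerAr -mpolyXD addmC submK.
rewrite -big_seq_cond -/(mrestr (std p.+1) g) => m.
rewrite mcoeff_msupp mcoeffB mcoeff_mrestr.
by case: ifP => // _; rewrite subrr eqxx.
Qed.

Lemma add_gens_stairI (g : 'I_n -> R) k : (k <= n)%N ->
  (forall i, g i = 'X_(rev_ord i)) ->
  forall f, add_gens (stairI n) g k f <-> stairI (n - k) f.
Proof.
move=> le_kn gE f; have le_nk : (n - k <= n)%N by apply: leq_subr.
split.
  apply: ideal_gen_min; first exact: stairI_is_ideal.
  move=> f' [If' m /If'|[j lt_jk ->]].
    apply: contra => sm; rewrite (std_lift hilb0 h0 (p := n - k)) ?le_nk ?leqnn //.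
    exact: (std_supp hilb0 le_nk sm).
  rewrite gE; apply/monidX/negP => /(std_supp hilb0 le_nk)/(_ (rev_ord j)).
  by rewrite mnm1E eqxx /= => /(_ (leq_sub2l n lt_jk)).
move=> If; apply: ideal_monomials => [|m /If sm]; first exact: ideal_gen_is_ideal.
case: (boolP [forall i : 'I_n, (n - k <= i)%N ==> (m i == 0%N)]) => [/forallP sup|].
  apply: ideal_gen_mem; left; apply/monidX.
  rewrite (std_lift hilb0 h0 (p := n - k)) ?le_nk ?leqnn // => i le_i.
  by apply/eqP; have := sup i; rewrite le_i.
case/forallPn => i; rewrite negb_imply => /andP[le_i mi].
have mE : m = (m - U_(i) + U_(i))%MM by rewrite submK // lep1mP.
rewrite mE mpolyXD; 
  have [_ _] := ideal_gen_is_ideal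
    (fun f => stairI n f \/ exists2 j : 'I_n, (j < k)%N & f = g j).
apply; apply: ideal_gen_mem; right; exists (rev_ord i); last by rewrite gE rev_ordK.
by rewrite /=; have := ltn_ord i; lia.
Qed.

Lemma SLP_ext (I J : R -> Prop) l : (forall f, I f <-> J f) -> SLP I l -> SLP J l.
Proof.
move=> IJ hI i s s0; case: (hI i s s0) => [inj|surj]; [left|right].
  by move=> f hf /IJ/(inj _ hf)/IJ.
by move=> g /surj[f hf /IJ fg]; exists f.
Qed.

Lemma stairI_kSLP : kSLP n (stairI n).
Proof.
exists (fun i => 'X_(rev_ord i)); split=> [i|i].
  by rewrite dhomogX; apply/eqP/mdeg1.
apply: (@SLP_ext (stairI (n - i))) => [f|].
  by apply: iff_sym; apply: add_gens_stairI => //; apply: (ltnW (ltn_ord i)).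
have lt_pn : (n - i.+1 < n)%N by have := ltn_ord i; lia.
have -> : rev_ord i = Ordinal lt_pn by apply: val_inj.
by rewrite -subnSK //; apply: stairI_SLP.
Qed.

Lemma stairI_artinian T : (forall t, (T <= t)%N -> h t = 0%N) ->
  artinian (stairI n).
Proof.
move=> hT; pose s := flat n h n T; exists (size s), (fun a => 'X_[nth 0%MM s a]).
have us : uniq s.
  exact: sorted_uniq (@rlt_trans n) (@rlt_irr n) _ (flat_sorted hilb0 h0 T (leqnn n)).
move=> f; exists (fun a => f@_(nth 0%MM s a)) => m.
rewrite mcoeff_msupp mcoeffB mcoeff_sum_nth //; apply: contraNN => sm.
have ms : m \in s.
  rewrite (flat_stdE hilb0) // sm andbT leqNgt; apply/negP => lt_T.
  have := size_stair h0 (mdeg m) (leqnn n); rewrite hilb_full hT ?(ltnW lt_T) //.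
  have sm' : m \in stair n (mdeg m) := sm.
  by move/size0nil => E; rewrite E in sm'.
case: insubP => [a _ ->|]; first by rewrite nth_index // subrr.
by rewrite index_mem ms.
Qed.

Lemma stairI_almost_revlex : almost_revlex (stairI n).
Proof.
(* The nonstandard monomials whose quotients by a variable are all standard, that is, the minimal
   generators. *)
pose S m := ~~ std n m /\ forall k u', m = (u' + U_(k))%MM -> std n u'.
have Sdiv m : ~~ std n m -> exists2 s, S s & (s <= m)%MM.
  move: {2}(mdeg m) (erefl (mdeg m)) => d; elim: d m => [|d IHd] m md sm.
    exists m; last exact: lepm_refl.
    by split=> // k u' E; move: md; rewrite E mdegD mdeg1 addn1.
  case: (classic (S m)) => [Sm|nS]; first by exists m; rewrite ?lepm_refl.
  have [k [u' [E su']]] : exists k u', m = (u' + U_(k))%MM /\ ~~ std n u'.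
    apply: NNPP => no; apply: nS; split=> // k u' E.
    by apply/negPn/negP => su'; apply: no; exists k, u'.
  have du' : mdeg u' = d by move: md; rewrite E mdegD mdeg1 addn1 => -[].
  have [s Ss le_s] := IHd u' du' su'; exists s => //.
  by rewrite E; apply: lepm_trans le_s (lem_addr _ _).
have Smin s m : S s -> S m -> (s <= m)%MM -> s = m.
  move=> [ss _] [_ hm] le_sm; apply/mnmP => i; apply/eqP.
  rewrite eqn_leq (mnm_lepP le_sm) /= leqNgt; apply/negP => lt_i.
  have mE : m = (m - U_(i) + U_(i))%MM by rewrite submK // lep1mP; lia.
  case/negP: ss; apply: (@std_divm n s (m - U_(i) - s)%MM (leqnn n)).
  rewrite addmC submK; first exact: hm mE.
  apply/mnm_lepP => j; rewrite mnmBE mnm1E; case: eqP => [<-|_].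
    by rewrite -ltnS subn1 prednK // (leq_ltn_trans _ lt_i).
  by rewrite subn0; apply: (mnm_lepP le_sm).
exists S; last first.
  move=> u v [su hu] e /rltP uv; apply/monidX/negP => sv.
  have supp (w : 'X_{1..n}) : supp_below n w by move=> i; rewrite leqNgt ltn_ord.
  by have := std_generator hilb0 h0 (leqnn n) (supp u) (supp v) sv su hu e; rewrite uv.
split=> [f|Tm TS Tgen m Sm].
  rewrite monid_gen; split=> If m /If; first exact: Sdiv.
  move=> [s [ss _] le_sm]; rewrite -(submK le_sm) addmC.
  exact: nstd_up (leqnn n) ss.
have : stairI n 'X_[m] by apply/monidX; case: Sm.
move/Tgen/monid_gen/monidX => [s Ts le_sm].
by rewrite -(Smin s m (TS s Ts) Sm le_sm).
Qed.

Lemma stairI_borel (u : 'X_{1..n}) (j q : 'I_n) : (j < q)%N ->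
  ~~ std n (u + U_(q))%MM -> ~~ std n (u + U_(j))%MM.
Proof. by move=> lt_jq; apply: contra; apply: std_borel. Qed.

End StaircaseIdeal.

(** * Koszul cycles of the almost revlex ideal *)

Section LinearCombinations.
Context (K : fieldType) (n : nat).
Local Notation R := {mpoly K[n]}.

(** Coefficients are indexed by [nat], so that concatenating families only shifts indices. *)
Definition lc (V : lmodType R) (s : seq V) (c : nat -> K) : V :=
  \sum_(i < size s) (c i)%:MP *: nth 0 s i.

Lemma lc_cat (V : lmodType R) (s t : seq V) c :
  lc (s ++ t) c = lc s c + lc t (fun i => c (size s + i)%N).
Proof.
rewrite /lc size_cat big_split_ord /=; congr (_ + _); apply: eq_bigr => i _ /=.
  by rewrite nth_cat ltn_ord.
by rewrite nth_cat ltnNge leq_addr addKn.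
Qed.

Lemma lc_map (V W : lmodType R) (f : V -> W) (s : seq V) c :
  (forall a u v, f (a *: u + v) = a *: f u + f v) ->
  lc (map f s) c = f (lc s c).
Proof.
move=> fP; have f0 : f 0 = 0.
  by have := fP (-1) 0 0; rewrite scaler0 addr0 scaleN1r addNr.
rewrite /lc size_map.
under eq_bigr => i _ do rewrite (nth_map 0) //.
apply: (big_ind2 (fun u v => u = f v)) => // [u1 u2 v1 v2 -> ->|i _].
  by have := fP 1 u2 v2; rewrite !scale1r.
by have := fP (c i)%:MP (nth 0 s i) 0; rewrite !addr0 f0 addr0.
Qed.

Lemma lc0 (V : lmodType R) (s : seq V) c :
  (forall i, (i < size s)%N -> c i = 0) -> lc s c = 0.
Proof. by move=> c0; rewrite /lc big1 // => i _; rewrite c0 // mpolyC0 scale0r. Qed.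

Lemma lc_delta (V : lmodType R) (s : seq V) i : (i < size s)%N ->
  lc s (fun j => (j == i)%:R) = nth 0 s i.
Proof.
move=> lt_i; rewrite /lc (bigD1 (Ordinal lt_i)) //= eqxx mpolyC1 scale1r.
by rewrite big1 ?addr0 // => j;
  rewrite -val_eqE /= => /negbTE ->; rewrite mpolyC0 scale0r.
Qed.

Local Notation V1 := 'rV[R]_1.

(** The chains u e_S with u in [us] and S a [q]-element subset of {0, ..., p - 1}. *)
Fixpoint kemb (p q : nat) (us : seq 'X_{1..n}) {struct p} : seq (kos V1 p q) :=
  match p return seq (kos V1 p q) with
  | 0 => match q return seq (kos V1 0 q) with
    | 0 => [seq const_mx 'X_[u] | u <- us]
    | _.+1 => [::]
    end
  | p'.+1 => match q return seq (kos V1 p'.+1 q) with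
    | 0 => kemb p' 0 us
    | q'.+1 => [seq (z, 0 : kos V1 p' q') | z <- kemb p' q'.+1 us] ++
               [seq (0 : kos V1 p' q'.+1, z) | z <- kemb p' q' us]
    end
  end.

Lemma size_kemb p q us : size (kemb p q us) = ('C(p, q) * size us)%N.
Proof.
elim: p q => [|p IHp] [|q] /=.
- by rewrite size_map bin0 mul1n.
- by rewrite bin0n mul0n.
- by rewrite IHp !bin0.
by rewrite size_cat !size_map !IHp binS mulnDl.
Qed.

Lemma lc_pair (W1 W2 : lmodType R) (s : seq W1) (t : seq W2) c :
  lc ([seq (z, 0 : W2) | z <- s] ++ [seq (0 : W1, z) | z <- t]) c =
  (lc s c, lc t (fun i => c (size s + i)%N)).
Proof.
rewrite lc_cat size_map (lc_map (f := fun z : W1 => (z, 0 : W2))).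
  rewrite (lc_map (f := fun z : W2 => (0 : W1, z))).
    by congr (_, _); rewrite /= ?addr0 ?add0r.
  by move=> a u v; congr (_, _); rewrite /= scaler0 addr0.
by move=> a u v; congr (_, _); rewrite /= scaler0 addr0.
Qed.

Lemma mcoeff_lcX us c :
  (lc [seq const_mx 'X_[u] | u <- us] c : V1) 0 0 =
    \sum_(i < size us) c i *: 'X_[nth 0%MM us i].
Proof.
rewrite /lc summxE size_map; apply: eq_bigr => i _.
by rewrite (nth_map 0%MM) // !mxE mul_mpolyC.
Qed.

Lemma kemb_supp p q us c : uniq us ->
  kall (fun w : V1 => forall m, m \in msupp (w 0 0) -> m \in us)
    (lc (kemb p q us) c).
Proof.
move=> uus; elim: p q c => [|p IHp] [|q] c //=.
- move=> m; rewrite mcoeff_lcX mcoeff_msupp mcoeff_sum_nth //.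
  by case: insubP => [i|]; rewrite ?index_mem ?eqxx.
by rewrite lc_pair /=; split; apply: IHp.
Qed.

Lemma kemb_free p q us c : uniq us -> lc (kemb p q us) c = 0 ->
  forall i, (i < size (kemb p q us))%N -> c i = 0.
Proof.
move=> uus; elim: p q c => [|p IHp] [|q] c //=.
- move/(congr1 (fun w : V1 => w 0 0)); rewrite mcoeff_lcX mxE.
  move=> E i; rewrite size_map => lt_i.
  have := congr1 (mcoeff (nth 0%MM us i)) E.
  rewrite mcoeff_sum_nth // index_uniq // mcoeff0.
  by rewrite insubT.
  exact: IHp.
rewrite lc_pair => -[E1 E2] i; rewrite size_cat !size_map => lt_i.
case: (ltnP i (size (kemb p q.+1 us))) => [lt|ge]; first exact: (IHp _ _ E1).
have := IHp _ _ E2 (i - size (kemb p q.+1 us))%N.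
by rewrite subnKC // ltn_subLR //; apply.
Qed.

End LinearCombinations.

(** * Independent Koszul cycles from strong stability *)

Section StaircaseCycles.
Context (K : fieldType) (n : nat) (h : nat -> nat).
Context (hilb0 : forall t, hilb n h 0 t.+1 = 0%N) (h0 : (h 0 <= 1)%N).
Local Notation R := {mpoly K[n]}.
Local Notation V1 := 'rV[R]_1.
Local Notation xv := (@xvar K n).
Local Notation I := (@stairI K n h n).
Local Notation J := (fun w : V1 => I (w 0 0)).

(* Standard monomials of degree less than [T] in the first [p + 1] variables  *)
(* annihilated by the last one.                                               *)
Definition corner (T p : nat) : seq 'X_{1..n} :=
  flatten [seq drop (hilb n h p.+1 e.+1) (stair n h p.+1 e) | e <- iota 0 T].

Lemma size_corner T p : (p < n)%N ->
  size (corner T p) = (\sum_(e < T) (hilb n h p.+1 e - hilb n h p.+1 e.+1))%N.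
Proof.
move=> lt_pn; elim: T => [|T IHT]; first by rewrite big_ord0.
rewrite /corner -[T.+1]addn1 iotaD map_cat flatten_cat size_cat -/(corner T p) IHT.
by rewrite addn1 big_ord_recr /= cats0 size_drop size_stair.
Qed.

(** Multiplication by x_p preserves positions, so the monomials that leave the staircase are those
    positioned past the length of the next list. *)
Lemma cornerP T p u : (p < n)%N -> u \in corner T p ->
  [/\ (mdeg u < T)%N, std h p.+1 u & ~~ std h p.+1 (u + xpow n p 1)].
Proof.
move=> lt_pn /flatten_mapP[e]; rewrite mem_iota add0n => /andP[_ lt_eT] ud.
have us := mem_drop ud; have [ue _] := stair_deg_supp hilb0 lt_pn us.
split; rewrite ?ue //; first by rewrite /std ue.
have us1 := size_stair h0 e.+1 lt_pn; have us0 := size_stair h0 e lt_pn.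
apply/negP => su; have su' : (u + xpow n p 1)%MM \in stair n h p.+1 e.+1.
  by have := su; rewrite /std mdegD mdeg_xpow // ue addn1.
set r := index (u + xpow n p 1)%MM (stair n h p.+1 e.+1).
have lt_r : (r < hilb n h p.+1 (e + 1))%N by rewrite addn1 -us1 index_mem.
have lt_r0 : (r < hilb n h p.+1 e)%N.
  rewrite addn1 in lt_r; apply: leq_trans lt_r _; rewrite leqNgt; apply/negP => lt.
  by move: ud; rewrite drop_oversize // us0 ltnW.
have := nth_stair_shift hilb0 h0 lt_pn lt_r0 lt_r.
rewrite addn1 nth_index // => /addIm uE.
have : uniq (stair n h p.+1 e) by apply: stair_uniq.
rewrite -(cat_take_drop (hilb n h p.+1 e.+1) (stair n h p.+1 e)) cat_uniq.
case/and3P=> _ /hasP[]; exists u => //=.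
rewrite uE; rewrite addn1 in lt_r.
by rewrite in_take ?mem_nth ?us0 // index_uniq ?us0 // stair_uniq.
Qed.

Lemma corner_uniq T p : (p < n)%N -> uniq (corner T p).
Proof.
move=> lt_pn; elim: T => [|T IHT] //.
rewrite /corner -[T.+1]addn1 iotaD map_cat flatten_cat /= cats0 -/(corner T p).
rewrite cat_uniq IHT drop_uniq ?stair_uniq // andbT.
apply/hasPn => u /mem_drop us; apply/negP => /cornerP[] // lt_u _ _.
by have [ue _] := stair_deg_supp hilb0 lt_pn us; rewrite ue ltnn in lt_u.
Qed.

(** The chains u e_S e_r with r < p, u in [corner T r] and S a [q]-element subset of {0, ..., r -
    1}. *)
Fixpoint kfam (T p q : nat) : seq (kos V1 p q.+1) :=
  match p return seq (kos V1 p q.+1) with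
  | 0 => [::]
  | p'.+1 => [seq (z, 0 : kos V1 p' q) | z <- kfam T p' q] ++
             [seq (0 : kos V1 p' q.+1, z) | z <- kemb K p' q (corner T p')]
  end.

Lemma size_kfam T p q : size (kfam T p q) =
  (\sum_(r < p) 'C(r, q) * size (corner T r))%N.
Proof.
elim: p => [|p IHp]; first by rewrite big_ord0.
by rewrite big_ord_recr /= size_cat !size_map IHp size_kemb.
Qed.

Lemma kfam_supp T p q c : (p <= n)%N ->
  kall (fun w : V1 => forall m, m \in msupp (w 0 0) -> supp_below p m)
    (lc (kfam T p q) c).
Proof.
elim: p c => [|p IHp] c lt_pn //=; rewrite lc_pair /=; split.
  apply: kall_impl (IHp _ (ltnW lt_pn)) => w hw m /hw hm i lt_pi.
  by apply: hm; apply: ltnW.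
apply: kall_impl (kemb_supp _ _ _ (corner_uniq T lt_pn)) => w hw m /hw.
by case/cornerP => // _ sm _; apply: (std_supp hilb0 lt_pn sm).
Qed.

Let Iid : is_ideal I := stairI_is_ideal K hilb0 h0 (leqnn n).
Let JD (u v : V1) : J u -> J v -> J (u + v).
Proof. by case: Iid => _ ID _ *; rewrite /= mxE; apply: ID. Qed.
Let JN (u : V1) : J u -> J (- u).
Proof. by move=> Ju; rewrite /= mxE; apply: (idealN Iid). Qed.
Let JZ a (u : V1) : J u -> J (a *: u).
Proof. by case: Iid => _ _ IM *; rewrite /= mxE; apply: IM. Qed.
Let J0 : J (0 : V1).
Proof. by case: Iid => I0 _ _; rewrite /= mxE. Qed.

Lemma stairI_borel_mul (p : nat) j (f : R) : (p < n)%N -> (j < p)%N ->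
  I (xv p * f) -> I (xv j * f).
Proof.
move=> lt_pn lt_jp; have lt_jn := ltn_trans lt_jp lt_pn.
rewrite -[p]/(val (Ordinal lt_pn)) -[j]/(val (Ordinal lt_jn)) !xvarE => If m.
rewrite mulrC (perm_mem (msuppMX _ _)) => /mapP[k kf ->].
rewrite addmC; apply: (stairI_borel hilb0 h0 (q := Ordinal lt_pn)) => //.
by apply: If; rewrite mulrC (perm_mem (msuppMX _ _)) addmC map_f.
Qed.

Lemma Jkd_borel p q (z : kos V1 p q.+1) : (p < n)%N ->
  kall (fun w : V1 => J (xv p *: w)) z -> kall J (kd xv z).
Proof.
move=> lt_pn; apply: kall_kd => // j u lt_jp.
by rewrite /= !mxE; apply: stairI_borel_mul.
Qed.

Lemma corner_xvar T p q c : (p < n)%N ->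
  kall (fun w : V1 => J (xv p *: w)) (lc (kemb K p q (corner T p)) c).
Proof.
move=> lt_pn; apply: kall_impl (kemb_supp _ _ _ (corner_uniq T lt_pn)) => w hw.
rewrite mxE -[p]/(val (Ordinal lt_pn)) xvarE => m.
rewrite mulrC (perm_mem (msuppMX _ _)) => /mapP[k /hw /cornerP[] // _ hk nk ->].
rewrite (_ : U_(Ordinal lt_pn)%MM = xpow n p 1); last first.
  by apply/mnmP => i; rewrite mnm1E mnmE mul1n -val_eqE /= eq_sym.
rewrite addmC; move: nk; apply: contra => sk.
rewrite -(std_lift hilb0 h0 (q := n)) ?lt_pn ?leqnn // => i lt_pi.
have := std_supp hilb0 lt_pn hk lt_pi; rewrite mnmDE mnmE => ->.
by rewrite gtn_eqF.
Qed.

(** The boundary of u e_S e_r has coefficients x_r u and x_j u with j < r, up to sign; the first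
    lies in I since u is a corner, the others by strong stability. *)
Lemma kfam_cycle T p q c : (p <= n)%N -> kall J (kd xv (lc (kfam T p q) c)).
Proof.
elim: p q c => [|p IHp] q c lt_pn; first exact: kall0.
rewrite [kfam _ _ _]/= lc_pair.
have h1 := IHp q c (ltnW lt_pn).
set z' := lc _ c in h1 *; set z'' := lc _ _.
have h2 : kall (fun w : V1 => J (xv p *: w)) z'' by apply: corner_xvar.
case: q z' h1 z'' h2 => [|q] z' h1 z'' h2 /=.
  by apply: (kallD JD h1); apply: kallZ h2 => u.
split; first by apply: (kallD JD h1); apply: kallZ h2 => u.
by apply: (kallN JN); apply: Jkd_borel.
Qed.

(** Induction on the last variable: setting x_p = 0 isolates the relation among the chains without
    e_p. The coefficient of e_p is then shown to lie in I, although only standard monomials occur in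
    it. *)
Lemma kfam_free T p q c w : (p <= n)%N ->
  kall J (lc (kfam T p q) c - kd xv w) ->
  forall i, (i < size (kfam T p q))%N -> c i = 0.
Proof.
elim: p q c w => [|p IHp] q c w lt_pn //.
rewrite [kfam _ _ _]/= lc_pair.
set z' := lc _ c; set z'' := lc _ (fun i => c _).
case: w => w' w'' /= [h1 h2].
have le_pn := ltnW lt_pn.
pose E := @rkill K n (pred1 p) 1 : V1 -> V1.
have JE (u : V1) : J u -> J (E u).
  move=> Ju m; rewrite mxE mcoeff_msupp mcoeff_mrestr.
  by case: ifP => _; rewrite ?eqxx // -mcoeff_msupp; apply: Ju.
have Ekd s (y : kos V1 p s.+1) : kmap E (kd xv y) = kd xv (kmap E y).
  apply: kmap_kd => [|u v|j v lt_jp]; [exact: rkill0 | exact: rkillD |].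
  by rewrite /E rkill_xvar /= ltn_eqF.
have EX s (y : kos V1 p s) : kmap E (xv p *: y) = 0.
  apply/kall_eq0/kall_kmapE; apply: (kallZ (P := fun=> True)); last exact: kallT.
  by move=> u _; rewrite /E rkill_xvar /= eqxx.
have ED s : {morph @kmap _ V1 V1 E p s : u v / u + v}.
  exact/kmapD/rkillD.
have EN s (y : kos V1 p s) : kmap E (- y) = - kmap E y.
  apply: (addrI (kmap E y)); rewrite -ED !subrr.
  by apply/kall_eq0/kall_kmapE/kall0; apply: rkill0.
(* The chains of [kfam T p q] involve only variables below x_p, so [E], the substitution x_p = 0,
   fixes them. *)
have Ez' : kmap E z' = z'.
  rewrite -[RHS]kmap_id; apply: kall_eq.
  apply: kall_impl (kfam_supp T q c le_pn) => u hu.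
  apply/rowP => i; rewrite !ord1 mxE; apply/mpolyP => m; rewrite mcoeff_mrestr.
  case: ifP => // /forallPn[k]; rewrite negb_imply => /andP[/eqP kp mk].
  apply/esym/memN_msupp_eq0/negP => /hu/(_ k); rewrite kp leqnn => /(_ isT) mk0.
  by rewrite mk0 in mk.
have JEk s (y : kos V1 p s) : kall J y -> kall J (kmap E y).
  by move=> Jy; apply/kall_kmapE; apply: kall_impl Jy => u; apply: JE.
have c0 : forall i, (i < size (kfam T p q))%N -> c i = 0.
  apply: (IHp q c (kmap E w') le_pn); rewrite -/z'.
  by have := JEk _ _ h1; rewrite ED EN ED Ekd EX addr0 Ez'.
have z'0 : z' = 0 by apply: lc0.
have h3 : kall J (kd xv w' + xv p *: w'').
  by have := kallN JN h1; rewrite z'0 sub0r opprK.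
(* Subtracting from [h3] its value at x_p = 0 leaves a multiple of x_p, to which strong stability
   applies in [h5]. *)
have [v hv] : exists v, w' - kmap E w' = xv p *: v.
  have [v hv] : exists v, kmap (fun u : V1 => xv p *: u) v = w' - kmap E w'.
    apply: kmap_lift; rewrite -kmap_subid; apply/kall_kmapE/kallT => u.
    by have [y ->] := rkill1_factor p u; exists y.
  by exists v; rewrite -hv kmap_scale.
have h4 : kall J (xv p *: (kd xv v + w'')).
  have := kallD JD h3 (kallN JN (JEk _ _ h3)).
  by rewrite ED EX addr0 Ekd addrAC -linearB hv linearZ /= -scalerDr.
have h5 : kall J (kd xv w'').
  have <- : kd xv (kd xv v + w'') = kd xv w'' by rewrite linearD /= kdK add0r.
  apply: Jkd_borel => //; apply/(kall_kmapE (fun u : V1 => xv p *: u) J).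
  by rewrite kmap_scale.
have h6 : kall J z''.
  by have := kallD JD h2 (kallN JN h5); rewrite opprK addrK.
have z''0 : z'' = 0.
  apply/kall_eq0; apply: kall_impl
    (kall_and h6 (kemb_supp _ _ _ (corner_uniq T lt_pn))).
  move=> u [Ju hu]; apply/rowP => i; rewrite !ord1 mxE; apply/mpolyP => m.
  rewrite mcoeff0; apply/eqP; rewrite mcoeff_eq0; apply/negP => mu.
  have [_ sm _] := cornerP lt_pn (hu m mu).
  have := Ju m mu; rewrite (std_lift hilb0 h0 (p := p.+1)) ?sm ?lt_pn ?leqnn //.
  exact: (std_supp hilb0 lt_pn sm).
move=> i; rewrite size_cat !size_map => lt_i.
case: (ltnP i (size (kfam T p q))) => [/c0//|ge].
have := kemb_free (corner_uniq T lt_pn) z''0 (i := (i - size (kfam T p q))%N).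
by rewrite subnKC // ltn_subLR //; apply.
Qed.

End StaircaseCycles.

(** * Quotients by linear forms *)

Section HyperplaneSection.
Context (K : fieldType) (n : nat).
Local Notation R := {mpoly K[n]}.
Context (J : R -> Prop) (h : nat -> nat) (g : R).
Context (Jgr : graded_ideal J).
Context (hJ : is_hilbert_function J h).
Context (g1 : g \is 1.-homog).
Context (Jfull : WLP J g).

Let Jid : is_ideal J. Proof. by case: Jgr. Qed.

Lemma multiplication_matrix e (b : 'I_(h e) -> R) (b' : 'I_(h e.+1) -> R) :
  (forall a, b a \is e.-homog) ->
  (forall f, f \is e.-homog -> exists c : 'I_(h e) -> K, J (f - \sum_a c a *: b a)) ->
  (forall c : 'I_(h e) -> K, J (\sum_a c a *: b a) -> forall a, c a = 0) ->
  (forall a, b' a \is e.+1.-homog) ->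
  (forall f, f \is e.+1.-homog ->
     exists c : 'I_(h e.+1) -> K, J (f - \sum_a c a *: b' a)) ->
  (forall c : 'I_(h e.+1) -> K, J (\sum_a c a *: b' a) -> forall a, c a = 0) ->
  exists2 X : 'M[K]_(h e, h e.+1), \rank X = minn (h e) (h e.+1) &
    forall c : 'rV_(h e), J (g * (\sum_a c 0 a *: b a) - \sum_j (c *m X) 0 j *: b' j).
Proof.
move=> b_hom b_span b_free b'_hom b'_span b'_free.
have gb_hom a : g * b a \is e.+1.-homog by rewrite -add1n; apply: dhomogM.
have pick a : {c : 'I_(h e.+1) -> K | J (g * b a - \sum_j c j *: b' j)}.
  exact: constructive_indefinite_description (b'_span _ (gb_hom a)).
pose X : 'M_(h e, h e.+1) := \matrix_(a, j) sval (pick a) j.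
have XJ a : J (g * b a - \sum_j X a j *: b' j).
  by under eq_bigr do rewrite mxE; case: (pick a).
have comb (c : 'rV_(h e)) :
    J (g * (\sum_a c 0 a *: b a) - \sum_j (c *m X) 0 j *: b' j).
  have -> : \sum_j (c *m X) 0 j *: b' j = \sum_a c 0 a *: \sum_j X a j *: b' j.
    under eq_bigr do rewrite mxE scaler_suml.
    rewrite exchange_big; apply: eq_bigr => a _ /=; rewrite scaler_sumr.
    by apply: eq_bigr => j _; rewrite scalerA.
  rewrite mulr_sumr -sumrB; apply: ideal_sum => // a _ _.
  by rewrite -scalerAr -scalerBr; apply: idealZ.
exists X => //; case: (Jfull e) => [inj|surj].
  have Xfree : row_free X.
    apply: inj_row_free => c cX; have := comb c; rewrite cX.
    under [X in _ - X]eq_bigr do rewrite mxE scale0r.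
    rewrite big1_eq subr0 -[g in g * _]expr1 => /inj Jc.
    apply/rowP => a; rewrite mxE; apply: (b_free (fun k => c 0 k)); apply: Jc.
    by apply: rpred_sum => k _; exact: rpredZ (b_hom k).
  rewrite (eqP Xfree); apply/esym/minn_idPl.
  by rewrite -(eqP Xfree) rank_leq_col.
have Xfull : row_full X.
  rewrite -sub1mx; apply/row_subP => j.
  have [|f fe Jf] := surj (b' j); first by rewrite addn1.
  have [d hd] := b_span _ fe.
  have E : J (b' j - \sum_l ((\row_a d a) *m X) 0 l *: b' l).
    have h2 := comb (\row_a d a); have [_ ID IM] := Jid.
    have dE : \sum_a (\row_k d k) 0 a *: b a = \sum_a d a *: b a.
      by apply: eq_bigr => a _; rewrite mxE.
    rewrite dE in h2; have := ID _ _ (ID _ _ Jf (IM g _ hd)) h2.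
    by congr J; rewrite expr1; ring.
  apply/submxP; exists (\row_a d a); rewrite rowE mulmx1.
  apply/rowP => l; apply/eqP; rewrite -subr_eq0; apply/eqP.
  have : J (\sum_l ((delta_mx 0 j - (\row_a d a) *m X) 0 l) *: b' l).
    suff -> : \sum_l ((delta_mx 0 j - (\row_a d a) *m X) 0 l) *: b' l =
      b' j - \sum_l ((\row_a d a) *m X) 0 l *: b' l by [].
    under eq_bigr do rewrite !mxE scalerBl.
    rewrite sumrB; congr (_ - _).
      rewrite (bigD1 j) //= !eqxx scale1r big1 ?addr0 // => k kj.
      by rewrite (negbTE kj) scale0r.
    by apply: eq_bigr => k _; rewrite !mxE.
  by move/b'_free/(_ l); rewrite !mxE.
rewrite (eqP Xfull); apply/esym/minn_idPr.
by rewrite -(eqP Xfull) rank_leq_row.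
Qed.

(** The kernel of multiplication by [g] in degree [e]: full rank gives dimension h e - min(h e, h (e
    + 1)), the truncated difference. *)
Lemma colon_spanned e : spanned_mod (h e - h e.+1)
  (fun u : 'rV[R]_1 => u 0 0 \is e.-homog /\ J (g * u 0 0)) (fun u => J (u 0 0)).
Proof.
have [b [b_hom b_span b_free]] := hJ e; have [b' [b'_hom b'_span b'_free]] := hJ e.+1.
have [X rX XJ] := multiplication_matrix b_hom b_span b_free b'_hom b'_span b'_free.
have [_ ID _] := Jid.
pose Y := row_base (kermx X).
pose comb (c : 'rV_(h e)) : R := \sum_a c 0 a *: b a.
have comb_hom c : comb c \is e.-homog.
  by apply: rpred_sum => k _; exact: rpredZ.
exists (\rank (kermx X)); first by rewrite mxrank_ker rX; lia.
exists (fun r => const_mx (comb (row r Y))).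
  move=> r; rewrite mxE; split; first exact: comb_hom.
  have := XJ (row r Y); suff -> : row r Y *m X = 0.
    under [X in _ - X]eq_bigr do rewrite mxE scale0r.
    by rewrite big1_eq subr0.
  by apply/sub_kermxP; rewrite (submx_trans (row_sub _ _)) // eq_row_base.
move=> u [uh Ju]; have [c hc] := b_span _ uh.
have cE : comb (\row_a c a) = \sum_a c a *: b a.
  by apply: eq_bigr => a _; rewrite mxE.
have cX : (\row_a c a) *m X = 0.
  apply/rowP => j; rewrite [RHS]mxE; apply: b'_free.
  have := XJ (\row_a c a); rewrite -/(comb _) cE => h1.
  have [_ _ IM] := Jid; have := ideal_sub Jid Ju (IM g _ hc).
  rewrite mulrBr opprB addrC subrK => h2.
  by have := ideal_sub Jid h2 h1; rewrite opprB addrC subrK.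
have : (\row_a c a <= Y)%MS by rewrite eq_row_base; apply/sub_kermxP.
case/submxP=> l hl; exists (fun r => l 0 r).
suff E : comb (l *m Y) =
    (\sum_r (l 0 r)%:MP *: const_mx (comb (row r Y)) : 'rV[R]_1) 0 0.
  by move: hc; rewrite -cE hl E => hc; rewrite !mxE in hc *.
have combP a (x y : 'rV_(h e)) : comb (a *: x + y) = a *: comb x + comb y.
  rewrite /comb scaler_sumr -big_split; apply: eq_bigr => k _ /=.
  by rewrite !mxE scalerDl scalerA.
have comb0 : comb 0 = 0 by rewrite /comb big1 // => k _; rewrite mxE scale0r.
rewrite summxE mulmx_sum_row.
elim: (index_enum _) => [|r s IHs]; rewrite ?big_nil // !big_cons.
by rewrite combP IHs !mxE mul_mpolyC.
Qed.

Definition hyperplane_section (J' : R -> Prop) :=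
  forall f, J' f <-> exists w, J (f - g * w).

Lemma hyperplane_section_hilbert J' : hyperplane_section J' ->
  is_hilbert_function J' (dplus h).
Proof.
move=> hJ' [|e] /=.
  have [b [b_hom b_span b_free]] := hJ 0; exists b; split=> //.
    move=> f fh; have [c hc] := b_span f fh; exists c; apply/hJ'.
    by exists 0; rewrite mulr0 subr0.
  move=> c /hJ'[w Jw] a; apply: b_free.
  have [_ Jg] := Jgr; have := Jg _ 0%N Jw; rewrite linearB /=.
  rewrite mulrC (pihomogMr _ _ g1) /= subr0 pihomog_dE //.
  by apply: rpred_sum => k _; exact: rpredZ (b_hom k).
have [b [b_hom b_span b_free]] := hJ e; have [b' [b'_hom b'_span b'_free]] := hJ e.+1.
have [X rX XJ] := multiplication_matrix b_hom b_span b_free b'_hom b'_span b'_free.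
have [_ ID IM] := Jid.
pose Y := row_base (X^C)%MS.
pose comb (c : 'rV_(h e.+1)) : R := \sum_a c 0 a *: b' a.
have comb_hom c : comb c \is e.+1.-homog.
  by apply: rpred_sum => k _; exact: rpredZ.
have combP a (x y : 'rV_(h e.+1)) : comb (a *: x + y) = a *: comb x + comb y.
  rewrite /comb scaler_sumr -big_split; apply: eq_bigr => k _ /=.
  by rewrite !mxE scalerDl scalerA.
have comb0 : comb 0 = 0 by rewrite /comb big1 // => k _; rewrite mxE scale0r.
have combY (d : 'I_(\rank (X^C)%MS) -> K) :
    comb ((\row_r d r) *m Y) = \sum_r d r *: comb (row r Y).
  rewrite mulmx_sum_row.
  elim: (index_enum _) => [|r s IHs]; rewrite ?big_nil // !big_cons.
  by rewrite combP IHs !mxE.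
have <- : \rank (X^C)%MS = (h e.+1 - h e)%N by rewrite mxrank_compl rX; lia.
exists (fun r => comb (row r Y)); split=> //.
  move=> f fh; have [c hc] := b'_span f fh.
  have : (\row_a c a <= X + Y)%MS.
    have /eqmxP/andP[_ s1] := adds_eqmx (eqmx_refl X) (eq_row_base (X^C)%MS).
    apply: submx_trans s1; apply: submx_full.
    by rewrite addsmx_compl_full.
  case/sub_addsmxP=> -[x y] /= xy; exists (fun r => y 0 r); apply/hJ'.
  exists (\sum_a x 0 a *: b a).
  have cE : \sum_a c a *: b' a = comb (x *m X) + comb (y *m Y).
    rewrite -[X in X + _]scale1r -combP scale1r -xy.
    by apply: eq_bigr => a _; rewrite mxE.
  have yE : \sum_r y 0 r *: comb (row r Y) = comb (y *m Y).
    rewrite -combY; congr (comb (_ *m _)).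
    by apply/rowP => r; rewrite mxE.
  have h1 := XJ x; rewrite -/(comb _) in h1; rewrite cE in hc; rewrite yE.
  by have := ideal_sub Jid hc h1; congr J; ring.
move=> d /hJ'[w Jw].
have fh : comb ((\row_r d r) *m Y) \is e.+1.-homog by [].
(* Since [J] is graded and [g] linear, [w] may be replaced by its component of degree [e]. *)
have [_ Jg] := Jgr; have := Jg _ e.+1 Jw; rewrite linearB /=.
rewrite mulrC (pihomogMr _ _ g1) ltnS leq0n subn1 /=.
rewrite -combY pihomog_dE // => Jw'.
have [x hx] := b_span _ (pihomogP mdeg e w).
have h1 := XJ (\row_a x a); rewrite -/(comb _) in h1.
have xE : \sum_a (\row_k x k) 0 a *: b a = \sum_a x a *: b a.
  by apply: eq_bigr => a _; rewrite mxE.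
rewrite xE in h1.
have Jd : J (comb ((-1) *: ((\row_a x a) *m X) + (\row_r d r) *m Y)).
  rewrite combP scaleN1r.
  by have := ID _ _ (ID _ _ Jw' (IM g _ hx)) h1; congr J; ring.
have E : (\row_r d r) *m Y = (\row_a x a) *m X.
  apply/eqP; rewrite -subr_eq0 addrC -scaleN1r; apply/eqP/rowP => j.
  by rewrite [RHS]mxE; apply: b'_free Jd j.
have : ((\row_r d r) *m Y <= X :&: X^C)%MS.
  by rewrite sub_capmx {1}E submxMl (submx_trans (submxMl _ _)) // eq_row_base.
rewrite capmx_compl => /submx0null Y0.
have : row_free Y by apply: row_base_free.
move/row_free_inj => injY; move=> a.
have /rowP/(_ a) : \row_r d r = 0 by apply: (injY); rewrite Y0 mul0mx.
by rewrite !mxE.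
Qed.

End HyperplaneSection.

(** * Ideals extended by linear forms *)

Section LinearForms.
Context (K : fieldType) (n : nat).
Local Notation R := {mpoly K[n]}.
Implicit Types (I : R -> Prop) (f : R).

Lemma ideal_gen_graded (G : R -> Prop) :
  (forall f d, G f -> ideal_gen G (pihomog mdeg d f)) -> graded_ideal (ideal_gen G).
Proof.
move=> hG; split; first exact: ideal_gen_is_ideal.
have [G0 GD GM] := ideal_gen_is_ideal G.
move=> f d hf; move: d; move: hf.
apply: (@ideal_gen_min _ _ G (fun f => forall d, ideal_gen G (pihomog mdeg d f))).
  split.
  - by move=> d; rewrite linear0.
  - by move=> u v hu hv d; rewrite linearD; apply: GD; [apply: hu | apply: hv].
  move=> r u hu d; elim/mpolyind: r => [|c m r _ _ IHr].
    by rewrite mul0r linear0.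
  rewrite mulrDl linearD; apply: GD => //.
  rewrite -scalerAl linearZ /=; apply: (idealZ _ (ideal_gen_is_ideal G)).
  have hm : ('X_[m] : R) \is (mdeg m).-homog by rewrite dhomogX; apply/eqP.
  rewrite mulrC (pihomogMr _ _ hm); case: ifP => // _.
  by rewrite mulrC; apply: GM; apply: hu.
by move=> u Gu d; apply: hG.
Qed.

Lemma ideal_vars I f : is_ideal I -> (forall i, I 'X_i) -> f@_0 = 0 -> I f.
Proof.
move=> Iid IX f0; apply: (ideal_monomials Iid) => m mf.
have m0 : m != 0%MM by apply: contraTneq mf => ->; rewrite mcoeff_msupp f0 eqxx.
have [i mi] : exists i, m i != 0%N.
  apply/existsP; rewrite -negb_forall; apply: contra m0 => /forallP m0.
  by apply/eqP/mnmP => i; rewrite mnm0E; apply/eqP.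
rewrite -(@submK _ U_(i)%MM m) ?lep1mP // mpolyXD.
by case: Iid => _ _; apply.
Qed.

Section AddGens.
Context (g : 'I_n -> R) (g_hom : forall i, g i \is 1.-homog).

Lemma add_gens_is_ideal I k : is_ideal (add_gens I g k).
Proof. exact: ideal_gen_is_ideal. Qed.

Lemma add_gens_sub I k f : I f -> add_gens I g k f.
Proof. by move=> If; apply: ideal_gen_mem; left. Qed.

Lemma add_gens_form I k (j : 'I_n) : (j < k)%N -> add_gens I g k (g j).
Proof. by move=> lt_jk; apply: ideal_gen_mem; right; exists j. Qed.

Lemma add_gens_graded I k : graded_ideal I -> graded_ideal (add_gens I g k).
Proof.
move=> [Iid Igr]; apply: ideal_gen_graded => f d [If|[j lt_jk ->]].
  by apply: ideal_gen_mem; left; apply: Igr.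
have [d1|d1] := eqVneq 1%N d.
  by rewrite -d1 pihomog_dE //; apply: add_gens_form.
rewrite (pihomog_ne0 d1 (g_hom j)).
by have [] := add_gens_is_ideal I k.
Qed.

Lemma add_gensS I (k : 'I_n) f :
  add_gens I g k.+1 f <-> exists w, add_gens I g k (f - g k * w).
Proof.
have [G0 GD GM] := add_gens_is_ideal I k.
split.
  apply: (@ideal_gen_min _ _ _ (fun f => exists w, add_gens I g k (f - g k * w))).
    split.
    - by exists 0; rewrite mulr0 subr0.
    - move=> u v [w1 h1] [w2 h2]; exists (w1 + w2).
      by have := GD _ _ h1 h2; congr (add_gens I g k); ring.
    move=> r u [w h1]; exists (r * w).
    by have := GM r _ h1; congr (add_gens I g k); ring.
  move=> u [Iu|[j]].
    by exists 0; rewrite mulr0 subr0; apply: add_gens_sub.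
  rewrite ltnS leq_eqVlt => /orP[/eqP/val_inj -> ->|lt_jk ->].
    by exists 1; rewrite mulr1 subrr.
  by exists 0; rewrite mulr0 subr0; apply: add_gens_form.
move=> [w hw]; have [G0' GD' GM'] := add_gens_is_ideal I k.+1.
rewrite -(subrK (g k * w) f); apply: GD'; last first.
  by rewrite mulrC; apply: GM'; apply: add_gens_form.
apply: ideal_gen_min hw => [|u [Iu|[j lt_jk ->]]]; first exact: add_gens_is_ideal.
  exact: add_gens_sub.
by apply: add_gens_form; apply: ltnW.
Qed.

Lemma add_gens_leq I k k' f : (k <= k')%N -> add_gens I g k f -> add_gens I g k' f.
Proof.
move=> le_k; apply: ideal_gen_min => [|u [Iu|[j lt_jk ->]]].
- exact: add_gens_is_ideal.
- exact: add_gens_sub.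
by apply: add_gens_form; apply: leq_trans le_k.
Qed.

Definition lin_ideal (k : nat) : R -> Prop := add_gens (fun f => f = 0) g k.

Lemma lin_ideal_sub I k f : is_ideal I -> lin_ideal k f -> add_gens I g k f.
Proof.
move=> [I0 _ _]; apply: ideal_gen_min => [|u [->|[j lt_jk ->]]].
- exact: add_gens_is_ideal.
- exact: add_gens_sub.
exact: add_gens_form.
Qed.

Lemma add_gens_split I k f : is_ideal I -> add_gens I g k f ->
  exists2 l, lin_ideal k l & I (f - l).
Proof.
move=> [I0 ID IM]; have [G0 GD GM] := add_gens_is_ideal (fun f => f = 0) k.
apply: (@ideal_gen_min _ _ _ (fun f => exists2 l, lin_ideal k l & I (f - l))).
  split.
  - by exists 0; rewrite ?subr0.
  - move=> u v [l1 h1 i1] [l2 h2 i2]; exists (l1 + l2); first exact: GD.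
    by rewrite opprD addrACA; apply: ID.
  move=> r u [l h i]; exists (r * l); first exact: GM.
  by rewrite -mulrBr; apply: IM.
move=> u [Iu|[j lt_jk ->]]; first by exists 0; rewrite ?subr0.
by exists (g j); rewrite ?subrr //; apply: add_gens_form.
Qed.

Lemma lin_ideal0 f : lin_ideal 0 f -> f = 0.
Proof.
apply: (@ideal_gen_min _ _ _ (fun f => f = 0)) => [|u [->|[]]//].
by split=> // [u v -> ->|r u ->]; rewrite ?addr0 ?mulr0.
Qed.

Definition form_mx : 'M[K]_n := \matrix_(i, j) (g i)@_(U_(j)).

Lemma formE f : f \is 1.-homog -> f = \sum_j f@_(U_(j)) *: 'X_j.
Proof.
move=> hf; apply/mpolyP => m; rewrite raddf_sum /=.
have [m1|m1] := eqVneq (mdeg m) 1%N.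
  have /existsP[i /eqP ->] : [exists i : 'I_n, m == U_(i)%MM].
    by rewrite -mdeg_eq1 m1.
  rewrite (bigD1 i) //= big1 => [|j ji].
    by rewrite addr0 mcoeffZ mcoeffXU eqxx mulr1.
  by rewrite mcoeffZ mcoeffXU (negbTE ji) mulr0.
rewrite (dhomog_nemf_coeff hf m1) big1 // => j _.
rewrite mcoeffZ mcoeffX; case: eqP => [mE|_]; rewrite ?mulr0 //.
by rewrite -mE mdeg1 in m1.
Qed.

Lemma form_mxE i : g i = \sum_j form_mx i j *: 'X_j.
Proof. by rewrite {1}[g i]formE //; apply: eq_bigr => j _; rewrite mxE. Qed.

Definition lin_subst (P : 'M[K]_n) : R -> R :=
  comp_mpoly [tuple \sum_j P i j *: 'X_j | i < n].

Lemma lin_substX P i : lin_subst P 'X_i = \sum_j P i j *: 'X_j.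
Proof. by rewrite /lin_subst /comp_mpoly mmapX mmap1U tnth_mktuple. Qed.

Lemma lin_subst_form P (c : 'rV_n) :
  lin_subst P (\sum_i c 0 i *: 'X_i) = \sum_j (c *m P) 0 j *: 'X_j.
Proof.
rewrite /lin_subst linear_sum /=.
under eq_bigr => i _ do rewrite linearZ /= -/(lin_subst P _) lin_substX scaler_sumr.
rewrite exchange_big; apply: eq_bigr => j _ /=.
by rewrite mxE scaler_suml; apply: eq_bigr => i _; rewrite scalerA.
Qed.

Context (g_unit : form_mx \in unitmx).

Lemma form_sum (c : 'rV_n) : \sum_i c 0 i *: g i = \sum_j (c *m form_mx) 0 j *: 'X_j.
Proof.
under eq_bigr do rewrite form_mxE scaler_sumr.
rewrite exchange_big; apply: eq_bigr => j _ /=.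
by rewrite mxE scaler_suml; apply: eq_bigr => i _; rewrite scalerA.
Qed.

Lemma lin_ideal_full f : lin_ideal n f <-> f@_0 = 0.
Proof.
split.
  apply: (@ideal_gen_min _ _ _ (fun f => f@_0 = 0)) => [|u [->|[j _ ->]]].
  - split=> [|u v u0 v0|r u u0]; first exact: mcoeff0.
      by rewrite mcoeffD u0 v0 addr0.
    by rewrite rmorphM /= u0 mulr0.
  - exact: mcoeff0.
  have m0 : mdeg (0%MM : 'X_{1..n}) != 1%N by rewrite mdeg0.
  exact: (dhomog_nemf_coeff (g_hom j) m0).
move=> f0; apply: ideal_vars f0 => [|i]; first exact: add_gens_is_ideal.
have XE : 'X_i = \sum_j ((delta_mx 0 i : 'rV_n) *m invmx form_mx) 0 j *: g j.
  rewrite form_sum mulmxKV // (bigD1 i) //= big1 => [|j ji].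
    by rewrite addr0 mxE !eqxx scale1r.
  by rewrite mxE (negbTE ji) andbF scale0r.
rewrite XE; apply: ideal_sum => [|j _ _]; first exact: add_gens_is_ideal.
by apply: (idealZ _ (add_gens_is_ideal _ _)); apply: add_gens_form.
Qed.

(* Killing [g 0, ..., g (k - 1)] by a linear substitution identifies          *)
(* [lin_ideal k] with the kernel of a ring morphism to a domain.              *)
Lemma lin_ideal_regular (k : 'I_n) f : lin_ideal k (g k * f) -> lin_ideal k f.
Proof.
pose G := form_mx.
pose U : 'M_n := \matrix_(i, j) (if (i < k)%N then G i j else 0).
(* The projection along the span of the first [k] forms onto a complement: the substitution kills
   these forms and is the identity modulo them, while independence keeps the image of [g k]
   nonzero. *)
pose P := proj_mx U^C%MS U.
have capU : (U^C :&: U = 0)%MS by rewrite capmxC capmx_compl.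
have [L0 LD LM] := add_gens_is_ideal (fun f => f = 0) k.
have Lid := add_gens_is_ideal (fun f => f = 0) k.
have rowU (j : 'I_n) : (j < k)%N -> row j U = row j G.
  by move=> lt_jk; apply/rowP => l; rewrite !mxE lt_jk.
have rho_g (j : 'I_n) : (j < k)%N -> lin_subst P (g j) = 0.
  move=> lt_jk; have -> : g j = \sum_i (row j G) 0 i *: 'X_i.
    by rewrite {1}form_mxE; apply: eq_bigr => i _; rewrite [in RHS]mxE.
  rewrite lin_subst_form -rowU // proj_mx_0 ?row_sub //.
  by rewrite big1 // => i _; rewrite mxE scale0r.
have rhoM u v : lin_subst P (u * v) = lin_subst P u * lin_subst P v
    by rewrite /lin_subst rmorphM.
have L_rhoX i : lin_ideal k ('X_i - lin_subst P 'X_i).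
  have : ((delta_mx 0 i : 'rV_n) - (delta_mx 0 i : 'rV_n) *m P <= U)%MS.
    by apply: proj_mx_compl_sub; rewrite submx_full // addsmxC addsmx_compl_full.
  case/submxP=> d dE.
  have -> : 'X_i - lin_subst P 'X_i = \sum_j (d *m U) 0 j *: 'X_j.
    have formB (A B : 'rV[K]_n) : \sum_j (A - B) 0 j *: 'X_j =
        \sum_j A 0 j *: 'X_j - \sum_j B 0 j *: 'X_j :> R.
      by rewrite -sumrB; apply: eq_bigr => j _; rewrite !mxE scalerBl.
    rewrite -dE formB lin_substX; congr (_ - _).
      rewrite (bigD1 i) //= mxE !eqxx scale1r big1 ?addr0 // => j ji.
      by rewrite mxE (negbTE ji) andbF scale0r.
    by apply: eq_bigr => j _; rewrite -rowE [in RHS]mxE.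
  have -> : \sum_j (d *m U) 0 j *: 'X_j =
      \sum_(i < n | (i < k)%N) d 0 i *: g i.
    rewrite [RHS]big_mkcond.
    have -> : \sum_(i < n) (if (i < k)%N then d 0 i *: g i else 0) =
        \sum_i (\row_i (if (i < k)%N then d 0 i else 0)) 0 i *: g i.
      by apply: eq_bigr => j _; rewrite mxE; case: ifP; rewrite ?scale0r.
    rewrite form_sum; apply: eq_bigr => j _; congr (_ *: _).
    rewrite !mxE; apply: eq_bigr => l _; rewrite !mxE.
    by case: ifP; rewrite ?mulr0 ?mul0r.
  by apply: ideal_sum => // j _ lt_jk; apply: (idealZ _ Lid); apply: add_gens_form.
have L_rho u : lin_ideal k (u - lin_subst P u).
  have L_mono m : lin_ideal k ('X_[m] - lin_subst P 'X_[m]).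
    move: {2}(mdeg m) (erefl (mdeg m)) => d; elim: d m => [|d IHd] m.
      by move/eqP; rewrite mdeg_eq0 => /eqP ->;
        rewrite mpolyX0 /lin_subst rmorph1 subrr.
    move=> md; have [i mi] : exists i, m i != 0%N.
      apply/existsP; rewrite -negb_forall; apply/negP => /forallP m0.
      suff mE : m = 0%MM by rewrite mE mdeg0 in md.
      by apply/mnmP => i; rewrite mnm0E; apply/eqP.
    have mE : m = (m - U_(i) + U_(i))%MM by rewrite submK // lep1mP.
    have md' : mdeg (m - U_(i))%MM = d.
      by apply: succn_inj; rewrite -md [in RHS]mE mdegD mdeg1 addn1.
    rewrite mE mpolyXD rhoM; set a := 'X_[_]; set b := 'X_i.
    have := LD _ _ (LM b _ (IHd _ md')) (LM (lin_subst P a) _ (L_rhoX i)).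
    by rewrite -/a -/b; congr (lin_ideal k); ring.
  elim/mpolyind: u => [|c m p _ _ IHp]; first by rewrite /lin_subst linear0 subrr.
  rewrite /lin_subst linearD linearZ /= opprD addrACA -scalerBr.
  by apply: LD => //; apply: (idealZ _ Lid); apply: L_mono.
have L_ker u : lin_ideal k u -> lin_subst P u = 0.
  apply: (@ideal_gen_min _ _ _ (fun u => lin_subst P u = 0)).
    split; first by rewrite /lin_subst linear0.
      by move=> a b a0 b0; rewrite /lin_subst linearD /= -!/(lin_subst P _) a0 b0 addr0.
    by move=> r a a0; rewrite rhoM a0 mulr0.
  by move=> v [->|[j lt_jk ->]]; [rewrite /lin_subst linear0 | apply: rho_g].
have rho_gk : lin_subst P (g k) != 0.
  have gE : g k = \sum_i (row k G) 0 i *: 'X_i.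
    by rewrite {1}form_mxE; apply: eq_bigr => i _; rewrite [in RHS]mxE.
  apply/negP; rewrite gE lin_subst_form => /eqP rho0.
  have GP : row k G *m P = 0.
    apply/rowP => j; have := congr1 (mcoeff U_(j)) rho0.
    rewrite mcoeff0 raddf_sum (bigD1 j) //= big1 => [|i ij].
      by rewrite addr0 mcoeffZ mcoeffXU eqxx mulr1 => ->; rewrite mxE.
    by rewrite mcoeffZ mcoeffXU (negbTE ij) mulr0.
  have : (row k G - row k G *m P <= U)%MS.
    by apply: proj_mx_compl_sub; rewrite submx_full // addsmxC addsmx_compl_full.
  rewrite GP subr0 => /submxP[d dE].
  have dE' : delta_mx 0 k *m G = (\row_i (if (i < k)%N then d 0 i else 0)) *m G.
    rewrite -rowE dE; apply/rowP => j; rewrite !mxE; apply: eq_bigr => l _.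
    by rewrite !mxE; case: ifP; rewrite ?mulr0 ?mul0r.
  have := congr1 (mulmx^~ (invmx G)) dE'; rewrite /= !mulmxK //.
  by move/rowP/(_ k); rewrite !mxE !eqxx ltnn => /eqP; rewrite oner_eq0.
move=> /L_ker; rewrite rhoM => /eqP; rewrite mulf_eq0 (negbTE rho_gk) /= => /eqP rf.
by rewrite -[f]subr0 -rf.
Qed.

End AddGens.
End LinearForms.

(** * The upper bound *)

Section UpperBound.
Context (K : fieldType) (n : nat).
Local Notation R := {mpoly K[n]}.
Context (I : R -> Prop) (F : free_complex K n) (h : nat -> nat) (g : 'I_n -> R).
Context (Igr : graded_ideal I).
Context (hF : graded_free_resolution I F).
Context (hI : is_hilbert_function I h).
Context (g_hom : forall i, g i \is 1.-homog).
Context (g_unit : form_mx g \in unitmx).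
Context (hW : forall k : 'I_n, WLP (add_gens I g k) (g k)).

Local Notation J := (add_gens I g).
Local Notation L := (lin_ideal g).
Local Notation V i := 'rV[R]_(gfr_rank F i).
Local Notation D i := (gfr_diff F i).
Local Notation deg i := (@gfr_deg K n F i).

Let Iid : is_ideal I. Proof. by case: Igr. Qed.
Let Lid k : is_ideal (L k). Proof. exact: add_gens_is_ideal. Qed.
Let Jid k : is_ideal (J k). Proof. exact: add_gens_is_ideal. Qed.

Lemma hilbert_ext (A B : R -> Prop) f : (forall u, A u <-> B u) ->
  is_hilbert_function A f -> is_hilbert_function B f.
Proof.
move=> AB hA t; have [b [b1 b2 b3]] := hA t; exists b; split=> //.
  by move=> u /b2[c /AB hc]; exists c.
by move=> c /AB; apply: b3.
Qed.

Lemma section_hilbert k : (k <= n)%N -> is_hilbert_function (J k) (iter k dplus h).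
Proof.
elim: k => [|k IHk] lt_kn.
  apply: (hilbert_ext (A := I)) hI => u; split; first exact: add_gens_sub.
  by apply: ideal_gen_min => // w [|[]].
have := @hyperplane_section_hilbert _ _ (J k) _ (g (Ordinal lt_kn)).
apply.
- exact: add_gens_graded.
- exact: IHk (ltnW lt_kn).
- exact: g_hom.
- exact: (hW (Ordinal lt_kn)).
by move=> u; rewrite -(add_gensS g I (Ordinal lt_kn)).
Qed.

(** Vanishing in the reduction of a free module modulo the first [k] forms. *)
Definition Lv r k (v : 'rV[R]_r) : Prop := forall b, L k (v 0 b).

Lemma Lv0 r k : @Lv r k 0.
Proof. by move=> b; rewrite mxE; case: (Lid k). Qed.

Lemma LvD r k (u v : 'rV[R]_r) : Lv k u -> Lv k v -> Lv k (u + v).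
Proof.
by move=> hu hv b; rewrite mxE; case: (Lid k) => _ h1 _;
  apply: h1; [apply: hu | apply: hv].
Qed.

Lemma LvZ r k a (v : 'rV[R]_r) : Lv k v -> Lv k (a *: v).
Proof. by move=> hv b; rewrite mxE; case: (Lid k) => _ _; apply; apply: hv. Qed.

Lemma LvN r k (v : 'rV[R]_r) : Lv k v -> Lv k (- v).
Proof. by move=> hv; rewrite -scaleN1r; apply: LvZ. Qed.

Lemma Lv_mulmx r s k (v : 'rV[R]_r) (M : 'M_(r, s)) : Lv k v -> Lv k (v *m M).
Proof.
move=> hv b; rewrite mxE; apply: ideal_sum => // a _ _.
by rewrite mulrC; case: (Lid k) => _ _; apply; apply: hv.
Qed.

Lemma Lv_leq r k k' (v : 'rV[R]_r) : (k <= k')%N -> Lv k v -> Lv k' v.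
Proof. by move=> le_k hv b; apply: (add_gens_leq le_k); apply: hv. Qed.

Lemma Lv_hproj r (dr : 'I_r -> nat) k d (v : 'rV[R]_r) : Lv k v -> Lv k (hproj dr d v).
Proof.
move=> hv b; rewrite mxE; case: ifP => _; last by case: (Lid k).
have zero_graded : graded_ideal (fun f : R => f = 0).
  split; last by move=> f e ->; rewrite linear0.
  by split=> // [u w -> ->|r' u ->]; rewrite ?addr0 ?mulr0.
by have [_] := add_gens_graded g_hom k zero_graded; apply; apply: hv.
Qed.

Lemma LvS r (k : 'I_n) (v : 'rV[R]_r) : Lv k.+1 v -> exists w, Lv k (v - g k *: w).
Proof.
move=> hv; have pick b : {w | L k (v 0 b - g k * w)}.
  apply: constructive_indefinite_description.
  exact: (iffLR (add_gensS g _ k (v 0 b)) (hv b)).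
exists (\row_b sval (pick b)) => b; rewrite !mxE.
by case: (pick b).
Qed.

Lemma LvZS r (k : 'I_n) (w : 'rV[R]_r) : Lv k.+1 (g k *: w).
Proof.
move=> b; rewrite mxE mulrC; case: (Lid k.+1) => _ _; apply.
by apply: add_gens_form.
Qed.

Lemma Lv_regular r (k : 'I_n) (v : 'rV[R]_r) : Lv k (g k *: v) -> Lv k v.
Proof. by move=> hv b; have := hv b; rewrite mxE; apply: lin_ideal_regular. Qed.

Lemma hproj_formM r (dr : 'I_r -> nat) k d (w : 'rV[R]_r) :
  hproj dr d (g k *: w) = if d is e.+1 then g k *: hproj dr e w else 0.
Proof.
case: d => [|d]; apply/rowP => b; rewrite !mxE mulrC (pihomogMr _ _ (g_hom k)).
  by case: ifP; rewrite ?sub0n.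
case: (leqP (dr b) d) => [le_d|lt_d].
  rewrite (leq_trans le_d) // subSn //= subn1 /= mulrC.
  by [].
case: ifP => le_d; last by rewrite mulr0.
by rewrite (_ : (d.+1 - dr b)%N = 0%N) ?mulr0 //; lia.
Qed.

(** Bounds the homology of F / (g 0, ..., g (k - 1)) F in position i + 1 and degree [d]. The second
    summand estimates the kernel of [g k'] one position and one degree lower; position 0 is R/(I, g
    0, ..., g (k' - 1)), where full rank is available. *)
Fixpoint tor_bound (k i d : nat) : nat :=
  if k is k'.+1 then
    (tor_bound k' i d +
     if d is e.+1 then
       if i is j.+1 then tor_bound k' j e
       else iter k' dplus h e - iter k' dplus h e.+1
     else 0)%N
  else 0%N.

(* Cycles of degree [d] and boundaries of [F / (g 0, ..., g (k - 1)) F] in    *)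
(* homological degree [i + 1].                                                *)
Definition cyc k i d (v : V i.+1) : Prop :=
  hproj (deg i.+1) d v = v /\ Lv k (v *m D i).
Definition bnd k i (v : V i.+1) : Prop := exists y, Lv k (v - y *m D i.+1).

Let homD i : homogmx (deg i.+1) (deg i) (D i).
Proof. by case: hF => hom _ _ _ _ a b; apply: hom. Qed.
Let exD i (v : V i.+1) : v *m D i = 0 <-> exists w, v = w *m D i.+1.
Proof. by case: hF. Qed.
Let DD i (v : V i.+2) : v *m D i.+1 *m D i = 0.
Proof. by apply/exD; exists v. Qed.
Let homaug : homogmx (deg 0) (fun _ : 'I_1 => 0%N) (gfr_aug F).
Proof.
move=> a b _; exists (deg 0 a) => //.
by rewrite [b]ord1; case: hF => _ haug _ _ _; apply: haug.
Qed.

Lemma cyc_subspace k i d : K_subspace (@cyc k i d).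
Proof.
split; first by split; rewrite ?hproj0 ?mul0mx //; apply: Lv0.
move=> a u v [hu Lu] [hv Lw]; split.
  by rewrite hproj_is_additive hprojZ hu hv.
by rewrite mulmxDl -scalemxAl; exact: (LvD (LvZ _ Lu) Lw).
Qed.

Lemma bnd_subspace k i : K_subspace (@bnd k i).
Proof.
split; first by exists 0; rewrite mul0mx subr0; apply: Lv0.
move=> a u v [y hy] [y' hy']; exists (a%:MP *: y + y').
rewrite mulmxDl -scalemxAl opprD addrACA -scalerBr.
exact: (LvD (LvZ _ hy) hy').
Qed.

(** The part of the long exact sequence common to all positions: [T] is the connecting map, sending
    [z] to the class of a [w] with z D = g_k w modulo the first [k] forms. *)
Lemma cyc_bound_gen (k : 'I_n) i e (V' : lmodType R) (Z' B' : V' -> Prop)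
    (T : V i.+1 -> V' -> Prop) N' N0 :
  K_subspace B' -> T 0 0 ->
  (forall (a : K) z1 w1 z2 w2, T z1 w1 -> T z2 w2 ->
     T (a%:MP *: z1 + z2) (a%:MP *: w1 + w2)) ->
  (forall z w, cyc k.+1 e.+1 z -> hproj (deg i) e w = w ->
     Lv k (z *m D i - g k *: w) -> exists2 u, Z' u & T z u) ->
  (forall z u, T z u -> B' u ->
     exists y, Lv k (z *m D i - g k *: (y *m D i))) ->
  spanned_mod N' Z' B' -> spanned_mod N0 (@cyc k i e.+1) (@bnd k i) ->
  spanned_mod (N' + N0) (@cyc k.+1 i e.+1) (@bnd k.+1 i).
Proof.
move=> hB' T0 Tl TZ Tker span' span0.
apply: (spanned_mod_ext (T := T) (Z0 := @cyc k i e.+1)) span' _ => //.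
- exact: cyc_subspace.
- exact: bnd_subspace.
- move=> z [hz Lz]; have [w hw] := LvS Lz.
  apply: (TZ z (hproj (deg i) e w)) => //; first exact: hproj_id.
  have := Lv_hproj (deg i) e.+1 hw.
  by rewrite hprojB hproj_formM (hproj_mulmx _ _ (@homD i)) hz.
(* When the connecting image is trivial, subtracting a multiple of [g k], which is zero modulo k + 1
   forms, makes [z] a cycle modulo [k] forms. *)
- move=> z u [hz Lz] Tz Bu; have [y hy] := Tker _ _ Tz Bu.
  exists (z - g k *: hproj (deg i.+1) e y); last first.
    exists 0; rewrite mul0mx subr0 opprB addrC subrK.
    exact: LvZS.
  split; first by rewrite hprojB hproj_formM hz hproj_id.
  have := Lv_hproj (deg i) e.+1 hy.
  rewrite hprojB hproj_formM !(hproj_mulmx _ _ (@homD i)) hz.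
  by rewrite mulmxBl -scalemxAl.
- move=> z [hz Lz]; split=> //; exact: Lv_leq Lz.
have [M leM [b Zb hb]] := span0; exists M => //; exists b => // z Zz.
have [c [y hc]] := hb _ Zz; exists c; exists y; exact: Lv_leq hc.
Qed.

Lemma cyc_bound k i d : (k <= n)%N ->
  spanned_mod (tor_bound k i d) (@cyc k i d) (@bnd k i).
Proof.
elim: k i d => [|k IHk] i d lt_kn.
  apply: spanned_mod0 => z [_ Lz].
  have /exD[w zE] : z *m D i = 0.
    by apply/rowP => b; rewrite [RHS]mxE; apply: lin_ideal0 (Lz b).
  by exists w; rewrite zE subrr; apply: Lv0.
have {}IHk i d := IHk i d (ltnW lt_kn).
pose ok := Ordinal lt_kn.
(* In degree 0 a multiple of a linear form has no component, so the cycles for k + 1 forms are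
   cycles for [k] forms. *)
case: d => [|e].
  have [M leM [b Zb hb]] := IHk i 0%N; exists M; first by rewrite /= addn0.
  exists b => [a|z [hz Lz]].
    by have [h1 h2] := Zb a; split=> //; apply: Lv_leq h2.
  have Zz : cyc k 0 z.
    split=> //; have [w hw] := LvS (k := ok) Lz.
    have := Lv_hproj (deg i) 0 hw.
    by rewrite hprojB hproj_formM subr0 (hproj_mulmx _ _ (@homD i)) hz.
  by have [c [y hc]] := hb _ Zz; exists c; exists y; apply: Lv_leq hc.
rewrite [tor_bound _ _ _]/= addnC.
case: i => [|j].
  (* Lowest position: the augmentation sends [w] to a form of degree [e] annihilated by [g k] modulo
     J k, and [colon_spanned] counts these. *)
  pose B' (u : 'rV[R]_1) := J k (u 0 0).
  pose Z' (u : 'rV[R]_1) := u 0 0 \is e.-homog /\ J k (g ok * u 0 0).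
  pose T (z : V 1) (u : 'rV[R]_1) := exists2 w, Lv k (z *m D 0 - g ok *: w) &
    J k ((u - w *m gfr_aug F) 0 0).
  have [J0 JD JM] := Jid k.
  case: hF => _ _ hsurj hker _.
  have JL f : L k f -> J k f by apply: lin_ideal_sub.
  have Jaug (v : V 0) : Lv k v -> J k ((v *m gfr_aug F) 0 0).
    by move=> Lw; apply: JL; apply: (Lv_mulmx (gfr_aug F) Lw).
  have JDaug (v : V 1) : J k ((v *m D 0 *m gfr_aug F) 0 0).
    by apply: add_gens_sub; apply/hker; exists v.
  apply: (@cyc_bound_gen ok 0 e _ Z' B' T) => //.
  - split; first by rewrite /B' mxE.
    by move=> a u v Bu Bv; rewrite /B' !mxE; apply: JD => //; apply: JM.
  - exists 0; first by rewrite mul0mx scaler0 subr0; apply: Lv0.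
    by rewrite mul0mx subr0 mxE.
  - move=> a z1 u1 z2 u2 [w1 h1 h1'] [w2 h2 h2']; exists (a%:MP *: w1 + w2).
      have := LvD (LvZ a%:MP h1) h2; congr Lv.
      rewrite mulmxDl -scalemxAl scalerBr [g ok *: (_ + _)]scalerDr opprD addrACA.
      by rewrite !scalerA [g ok * _]mulrC.
    have := JD _ _ (JM a%:MP _ h1') h2'; congr (J k).
    rewrite mulmxDl -scalemxAl; move: (w1 *m _) (w2 *m _) => x1 x2.
    by rewrite !mxE; ring.
  - move=> z w [hz Lz] hw Lzw; exists (w *m gfr_aug F); last first.
      by exists w => //; rewrite subrr mxE.
    split.
      have := hproj_mulmx e w homaug; rewrite hw => /rowP/(_ 0).
      rewrite mxE /= subn0 => <-; exact: pihomogP.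
    have := ideal_sub (Jid k) (JDaug z) (Jaug _ Lzw).
    congr (J k); rewrite mulmxBl -scalemxAl; move: (_ *m _ *m _) (w *m _) => x1 x2.
    by rewrite !mxE; ring.
  - move=> z u [w Lzw Ju] Bu.
    have Jw : J k ((w *m gfr_aug F) 0 0).
      have := ideal_sub (Jid k) Bu Ju.
      by congr (J k); move: (w *m _) => x; rewrite !mxE; ring.
    have [l Ll Iwl] := add_gens_split Iid Jw.
    (* [v1] represents 1, so l v1 corrects [w] by a vector that is zero modulo the first [k] forms
       and moves its augmentation into I; exactness then yields [y]. *)
    have [v1 hv1] := hsurj 1.
    have /hker[y yE] : I (((w - l *: v1) *m gfr_aug F) 0 0).
      have [_ ID IM] := Iid.
      have := ID _ _ Iwl (IM l _ hv1); congr I.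
      rewrite mulmxBl -scalemxAl; move: (w *m _) (v1 *m _) => x1 x2.
      by rewrite !mxE; ring.
    exists y; rewrite -yE scalerBr opprB addrCA addrC.
    have := LvD Lzw (LvZ (g ok) (_ : Lv k (l *: v1))); rewrite addrAC => hh.
    rewrite -addrA [_ *: _ - _]addrC addrA; apply: LvD => //.
    by apply: LvZ => b; rewrite mxE mulrC; case: (Lid k) => _ _; apply.
  apply: (@colon_spanned _ _ (J k) _ (g ok)) => //.
  - exact: add_gens_graded.
  - by apply: section_hilbert; apply: ltnW.
  - exact: (hW ok).
(* Higher positions: [g k] is regular modulo the first [k] forms, so [w] itself is a cycle there. *)
pose T (z : V j.+2) (w : V j.+1) := Lv k (z *m D j.+1 - g ok *: w).
apply: (@cyc_bound_gen ok j.+1 e _ (@cyc k j e) (@bnd k j) T) => //.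
- exact: bnd_subspace.
- by rewrite /T mul0mx scaler0 subr0; apply: Lv0.
- move=> a z1 w1 z2 w2 h1 h2; have := LvD (LvZ a%:MP h1) h2; congr Lv.
  rewrite mulmxDl -scalemxAl scalerBr [g ok *: (_ + _)]scalerDr opprD addrACA.
  by rewrite !scalerA [g ok * _]mulrC.
- move=> z w [hz Lz] hw Lzw; exists w => //; split=> //.
  apply: (Lv_regular (k := ok)).
  have := LvN (Lv_mulmx (D j) Lzw).
  by rewrite mulmxBl DD sub0r opprK -scalemxAl.
move=> z w Tzw [y hy]; exists y.
have := LvD Tzw (LvZ (g ok) hy); congr Lv.
by rewrite scalerBr addrA subrK.
Qed.

End UpperBound.

(** * Degree components of F (x) K *)

Section TorDimensions.
Context (K : fieldType) (n : nat).
Local Notation R := {mpoly K[n]}.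
Context (I : R -> Prop) (F : free_complex K n).
Context (hF : graded_free_resolution I F).

Local Notation V i := 'rV[R]_(gfr_rank F i).
Local Notation D i := (gfr_diff F i).
Local Notation deg i := (@gfr_deg K n F i).
Local Notation const := (map_mx (mcoeff (0%MM : 'X_{1..n}))).
Local Notation td i := (tensor_diff F i).
Local Notation tg i d := (tensor_deg F i d).

Lemma tensor_degE i d m (u : 'M[K]_(m, gfr_rank F i)) a b :
  (u *m tg i d) a b = if deg i b == d then u a b else 0.
Proof.
by rewrite mul_mx_diag !mxE; case: eqP; rewrite ?mulr1 ?mulr0.
Qed.

Lemma tensor_deg_sub i d (u : 'rV[K]_(gfr_rank F i)) :
  (u <= tg i d)%MS -> u *m tg i d = u.
Proof.
case/submxP=> x ->; apply/rowP => b; rewrite !tensor_degE.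
by case: eqP.
Qed.

Lemma tensor_degM i d : tg i.+1 d *m td i = td i *m tg i d.
Proof.
have homD a b : td i a b != 0 -> deg i.+1 a = deg i b.
  rewrite mxE => nz; have Dnz : D i a b != 0.
    by apply: contraNneq nz => ->; rewrite mcoeff0.
  case: hF => hom _ _ _ _; have [e ae he] := hom i a b Dnz.
  suff e0 : e = 0%N by rewrite ae e0 addn0.
  apply/eqP; apply: contraNT nz => e0; apply/eqP.
  have m0 : mdeg (0%MM : 'X_{1..n}) != e by rewrite mdeg0 eq_sym.
  exact: (dhomog_nemf_coeff he m0).
apply/matrixP => a b; rewrite tensor_degE mul_diag_mx 2!mxE.
have [->|/homD ->] := eqVneq (td i a b) 0; first by rewrite mulr0 if_same.
by case: eqP; rewrite ?mul1r ?mul0r.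
Qed.

Lemma tensor_diffK i : td i.+1 *m td i = 0.
Proof.
case: hF => _ _ _ _ ex.
have DD : D i.+1 *m D i = 0.
  by apply/row_matrixP => a; rewrite row_mul row0 rowE; apply/ex; eexists.
by rewrite -map_mxM DD map_mx0.
Qed.

Lemma hproj_const i d (u : 'rV[K]_(gfr_rank F i)) :
  (u <= tg i d)%MS ->
  hproj (deg i) d (map_mx (@mpolyC n K) u) = map_mx (@mpolyC n K) u.
Proof.
move/tensor_deg_sub => uE; apply/rowP => b; rewrite !mxE.
have := congr1 (fun w : 'rV_ _ => w 0 b) uE; rewrite tensor_degE.
case: eqP => [->|_ <-]; last by rewrite mpolyC0 linear0 if_same.
rewrite leqnn subnn => _; apply: pihomog_dE; apply/dhomogP => m.
rewrite msuppC; case: ifP => // _; rewrite inE => /eqP ->; exact: mdeg0.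
Qed.

(** Constant terms carry a spanning family over R to one of the homology of F (x) K; only its
    components of degree [d] matter, because the differential preserves degree. *)
Lemma tor_dim_le i d N (Z : V i -> Prop) :
  (forall u : 'rV[K]_(gfr_rank F i), (u <= tensor_cycles F i)%MS ->
     (u <= tg i d)%MS -> Z (map_mx (@mpolyC n K) u)) ->
  spanned_mod N Z (fun v => exists y, const (v - y *m D i) = 0) ->
  (tor_dim F i d <= N)%N.
Proof.
move=> hZ [M leM [b _ hb]]; rewrite /tor_dim leq_subLR.
pose B := \matrix_a (const (b a) *m tg i d).
have sub : (tensor_cycles F i :&: tg i d <= tg i.+1 d *m td i + B)%MS.
  apply/row_subP => r; set u := row r _.
  have /andP[uZ uP] : (u <= tensor_cycles F i)%MS && (u <= tg i d)%MS.
    by rewrite -sub_capmx; apply: row_sub.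
  have [c [y hc]] := hb _ (hZ u uZ uP).
  have uE : u = \sum_a c a *: const (b a) + const y *m td i.
    have cu : const (map_mx (@mpolyC n K) u) = u.
      by rewrite -map_mx_comp map_mx_id // => x; rewrite /= mpolyCK.
    move: hc; rewrite !raddfB /= cu map_mxM raddf_sum /= => /eqP.
    rewrite subr_eq add0r subr_eq addrC => /eqP ->; congr (_ + _).
    by apply: eq_bigr => a _; apply/rowP => j; rewrite !mxE mcoeffCM.
  rewrite -(tensor_deg_sub uP) uE mulmxDl -mulmxA -tensor_degM mulmxA addrC.
  apply: addmx_sub_adds; first by rewrite -mulmxA submxMl.
  rewrite mulmx_suml summx_sub // => a _; rewrite -scalemxAl scalemx_sub //.
  by rewrite -(rowK (fun a => const (b a) *m tg i d)) row_sub.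
apply: leq_trans (mxrankS sub) _; apply: leq_trans (mxrank_adds_leqif _ _) _.
by rewrite leq_add2l (leq_trans (rank_leq_row _)).
Qed.

(** When [B] exceeds all basis degrees, the cycles are the sum of their homogeneous parts, and
    boundaries of different degrees are independent. *)
Lemma tor_dim_sum i B : (forall b, (deg i b < B)%N) ->
  (\rank (tensor_cycles F i) <=
     \sum_(d < B) tor_dim F i d + \rank (td i))%N.
Proof.
move=> hB.
have cyc_deg d (u : 'rV[K]_(gfr_rank F i)) :
    (u <= tensor_cycles F i)%MS -> (u *m tg i d <= tensor_cycles F i)%MS.
  case: i {hB} u => [|i] u /=; first by rewrite !submx1.
  move/sub_kermxP => u0; apply/sub_kermxP.
  by rewrite -mulmxA tensor_degM mulmxA u0 mul0mx.
have cyc_sum : (tensor_cycles F i <= \sum_(d < B) (tensor_cycles F i :&: tg i d))%MS.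
  apply/row_subP => r; set u := row r _.
  have uZ : (u <= tensor_cycles F i)%MS by apply: row_sub.
  have -> : u = \sum_(d < B) u *m tg i d.
    apply/rowP => b; rewrite summxE; under eq_bigr do rewrite tensor_degE.
    rewrite (bigD1 (Ordinal (hB b))) //= eqxx big1 ?addr0 // => d.
    by rewrite -val_eqE /= eq_sym => /negbTE ->.
  apply: summx_sub_sums => d _.
  by rewrite sub_capmx cyc_deg //= submxMl.
have bnd_sum : (\sum_(d < B) \rank (tg i.+1 d *m td i) <= \rank (td i))%N.
  (* Projection onto the degrees below [k]; adding the degree [k] gives a direct sum of boundary
     spaces. *)
  pose Q k := \sum_(d < k) tg i.+1 d.
  have QE k a b : Q k a b = if a == b then ((deg i.+1 a < k)%N)%:R else 0.
    rewrite summxE; under eq_bigr do rewrite !mxE.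
    have [_|_] := eqVneq a b; last by rewrite big1 // => d _; rewrite mulr0n.
    under eq_bigr do rewrite mulr1n.
    case: (ltnP (deg i.+1 a) k) => [lt|ge].
      rewrite (bigD1 (Ordinal lt)) //= eqxx big1 ?addr0 // => d.
      by rewrite -val_eqE /= eq_sym => /negbTE ->.
    rewrite big1 // => d _; rewrite gtn_eqF //.
    exact: leq_trans (ltn_ord d) ge.
  have Qdiag k : Q k = diag_mx (\row_a ((deg i.+1 a < k)%N)%:R).
    by apply/matrixP => a b; rewrite QE !mxE; case: eqP.
  suff rQ k : (\sum_(d < k) \rank (tg i.+1 d *m td i) <= \rank (Q k *m td i))%N.
    by apply: leq_trans (rQ B) _; apply: mxrankS; apply: submxMl.
  elim: k => [|k IHk]; first by rewrite big_ord0.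
  rewrite big_ord_recr /=; apply: leq_trans (leq_add IHk (leqnn _)) _.
  have QP : Q k *m tg i.+1 k = 0.
    apply/matrixP => a b; rewrite tensor_degE QE mxE.
    have [->|_] := eqVneq a b; last by rewrite if_same.
    by case: eqP => // ->; rewrite ltnn.
  have PP : tg i.+1 k *m tg i.+1 k = tg i.+1 k.
    apply/matrixP => a b; rewrite tensor_degE !mxE.
    have [->|_] := eqVneq a b; last by rewrite mulr0n if_same.
    by rewrite mulr1n; case: eqP.
  have cap0 : ((Q k *m td i) :&: (tg i.+1 k *m td i) = 0)%MS.
    apply/eqP/rowV0P => u; rewrite sub_capmx => /andP[/submxP[x ux] /submxP[y uy]].
    have u1 : u *m tg i k = u.
      by rewrite uy -mulmxA -(mulmxA _ (td i)) -tensor_degM (mulmxA (tg i.+1 k)) PP.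
    rewrite -u1 ux -mulmxA -(mulmxA _ (td i)) -tensor_degM.
    by rewrite (mulmxA (Q k)) QP mul0mx mulmx0.
  rewrite -(mxrank_disjoint_sum cap0); apply: mxrankS.
  have QQ : Q k *m Q k.+1 = Q k.
    apply/matrixP => a b; rewrite [in X in _ *m X]Qdiag mul_mx_diag !mxE QE.
    have [->|_] := eqVneq a b; last by rewrite mul0r.
    by case: ltnP => [lt|_]; rewrite ?mul0r // (ltnW lt : (_ < k.+1)%N) mulr1.
  have PQ : tg i.+1 k *m Q k.+1 = tg i.+1 k.
    apply/matrixP => a b; rewrite [in X in _ *m X]Qdiag mul_mx_diag !mxE.
    have [->|_] := eqVneq a b; last by rewrite !mulr0n mul0r.
    by rewrite !mulr1n; case: eqP => [->|_]; rewrite ?ltnSn ?mulr1 // mul0r.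
  by rewrite addsmx_sub -{1}QQ -{1}PQ -!mulmxA !submxMl.
have bnd_cyc d : (tg i.+1 d *m td i <= tensor_cycles F i :&: tg i d)%MS.
  rewrite sub_capmx {2}tensor_degM submxMl andbT -/(td i).
  apply: submx_trans (submxMl _ _) _.
  case: i {hB cyc_deg cyc_sum bnd_sum} => [|i] /=; first exact: submx1.
  by apply/sub_kermxP; apply: tensor_diffK.
apply: leq_trans (mxrankS cyc_sum) _.
apply: leq_trans (mxrank_sum_leqif _) _ => /=.
rewrite addnC -leq_subLR; apply: leq_trans (leq_sub2l _ bnd_sum) _.
rewrite leq_subLR -big_split; apply: leq_sum => d _ /=.
by rewrite /tor_dim subnKC // mxrankS.
Qed.

End TorDimensions.

(** Unrolls the recurrence with Pascal's rule. It is an inequality because the degree shift loses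
    the top term of the sum. *)
Lemma tor_bound_sum h T k i :
  (\sum_(d < T) tor_bound h k i d <=
   \sum_(r < k) 'C(k - r.+1, i) *
     \sum_(e < T) (iter r dplus h e - iter r dplus h e.+1))%N.
Proof.
elim: k i => [|k IHk] i; first by rewrite big1.
pose f d := if d is e.+1 then
    if i is j.+1 then tor_bound h k j e else (iter k dplus h e - iter k dplus h e.+1)%N
  else 0%N.
have -> : (\sum_(d < T) tor_bound h k.+1 i d =
    \sum_(d < T) tor_bound h k i d + \sum_(d < T) f d)%N.
  by rewrite -big_split.
have f_sum : (\sum_(d < T) f d <= \sum_(d < T) f d.+1)%N.
  case: T {IHk} => [|T]; first by rewrite !big_ord0.
  by rewrite big_ord_recl add0n [leqRHS]big_ord_recr /= leq_addr.
apply: leq_trans (leq_add (IHk i) f_sum) _.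
rewrite [leqRHS]big_ord_recr /= subnn.
case: i f {f_sum} => [|j] f /=.
  rewrite bin0 mul1n leq_add2r; apply: leq_sum => r _.
  by rewrite !bin0.
rewrite mul0n addn0; apply: leq_trans (leq_add (leqnn _) (IHk j)) _.
rewrite -big_split; apply: leq_sum => r _ /=.
by rewrite subSS -mulnDl -binS -subSn // subSS.
Qed.

(** * Linear forms and Hilbert functions in the Lefschetz classes *)

Section GoodForms.
Context (K : fieldType) (n : nat).
Local Notation R := {mpoly K[n]}.
Implicit Types (I : R -> Prop) (g : 'I_n -> R).

Lemma homog_const0 t (f : R) : f \is t.+1.-homog -> f@_0 = 0.
Proof.
move=> hf; have m0 : mdeg (0%MM : 'X_{1..n}) != t.+1 by rewrite mdeg0.
exact: (dhomog_nemf_coeff hf m0).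
Qed.

Lemma homog0_const (f : R) : f \is 0.-homog -> f = (f@_0)%:MP.
Proof.
move=> hf; apply/mpolyP => m; rewrite mcoeffC.
have [->|m0] := eqVneq 0%MM m; first by rewrite mulr1.
rewrite mulr0; apply: (dhomog_nemf_coeff hf).
by rewrite mdeg_eq0 eq_sym.
Qed.

Lemma ideal_const I (c : K) f : is_ideal I -> c != 0 -> I c%:MP -> I f.
Proof.
move=> [_ _ IM] c0 Ic; have := IM (f * (c^-1)%:MP) _ Ic.
by rewrite -mulrA -mpolyCM mulVf // mpolyC1 mulr1.
Qed.

Lemma WLP_ext I J f : (forall u, I u <-> J u) -> WLP I f -> WLP J f.
Proof.
move=> IJ hI i; case: (hI i) => [inj|surj]; [left|right].
  by move=> u hu /IJ Ju; apply/IJ; apply: inj.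
by move=> u hu; have [w hw /IJ Iw] := surj u hu; exists w.
Qed.

Lemma WLP_vars I f : is_ideal I -> (forall i, I 'X_i) -> WLP I f.
Proof.
move=> Iid IX i; right => u; rewrite addn1 => hu; exists 0; first exact: dhomog0.
by rewrite mulr0 subr0; apply: ideal_vars => //; apply: homog_const0 hu.
Qed.

Lemma kSLP_kWLP I k : kSLP k I -> kWLP k I.
Proof.
by move=> [g [g_hom hg]]; exists g; split=> // i t; apply: hg.
Qed.

Definition lead_forms g (k : nat) : 'M[K]_n :=
  \matrix_(i, j) (if (i < k)%N then form_mx g i j else 0).

Lemma lead_forms_rank g (k : 'I_n) :
  ~~ (row k (form_mx g) <= lead_forms g k)%MS ->
  (\rank (lead_forms g k) < \rank (lead_forms g k.+1))%N.
Proof.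
move=> gk; set U := lead_forms g k.
have sub : (row k (form_mx g) + U <= lead_forms g k.+1)%MS.
  have rowE (i : 'I_n) : (i <= k)%N -> row i (lead_forms g k.+1) = row i (form_mx g).
    by move=> le_ik; apply/rowP => j; rewrite !mxE ltnS le_ik.
  rewrite addsmx_sub -rowE ?leqnn // row_sub; apply/row_subP => i.
  have [lt_ik|le_ki] := ltnP i k.
    have -> : row i U = row i (lead_forms g k.+1).
      by rewrite rowE ?(ltnW lt_ik) //; apply/rowP => j; rewrite !mxE lt_ik.
    exact: row_sub.
  rewrite (_ : row i U = 0) ?sub0mx //.
  by apply/rowP => j; rewrite !mxE ltnNge le_ki.
apply: leq_trans (mxrankS sub); rewrite ltn_neqAle mxrankS ?addsmxSr // andbT.
apply: contra gk => /eqP rk;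
  have := (mxrank_leqif_sup (addsmxSr (row k (form_mx g)) U)).2.
by rewrite rk eqxx => /esym; rewrite addsmx_sub => /andP[].
Qed.

Lemma add_gens_eq I g g' (k : nat) u :
  (forall i : 'I_n, (i < k)%N -> g i = g' i) -> add_gens I g k u -> add_gens I g' k u.
Proof.
move=> gg'; apply: ideal_gen_min => [|f [If|[j lt_jk ->]]].
- exact: add_gens_is_ideal.
- exact: add_gens_sub.
by rewrite gg' //; apply: add_gens_form.
Qed.

(** Dependent forms can be replaced one at a time. A form in the span of its predecessors acts as
    zero on its quotient, and full rank in degree 0 then makes all variables vanish there. *)
Lemma kWLP_unit I : kWLP n I -> exists g,
  [/\ forall i, g i \is 1.-homog, form_mx g \in unitmx
    & forall i : 'I_n, WLP (add_gens I g i) (g i)].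
Proof.
case=> g0 [g0_hom g0_W].
have main k : (k <= n)%N -> exists g, [/\ forall i, g i \is 1.-homog,
    forall i : 'I_n, WLP (add_gens I g i) (g i) & (k <= \rank (lead_forms g k))%N].
  elim: k => [|k IHk] lt_kn; first by exists g0.
  have [g [g_hom g_W rk]] := IHk (ltnW lt_kn); pose ok := Ordinal lt_kn.
  have [gk|gk] := boolP (row ok (form_mx g) <= lead_forms g k)%MS; last first.
    exists g; split=> //.
    by apply: leq_ltn_trans rk _; apply: (@lead_forms_rank g ok).
  have Jid := add_gens_is_ideal g I k; have [_ JD JM] := Jid.
  have Jgk : add_gens I g k (g ok).
    have /submxP[c cE] := gk.
    have -> : g ok = \sum_(i < n | (i < k)%N) c 0 i *: g i.
      rewrite {1}(form_mxE g_hom).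
      under [RHS]eq_bigr do rewrite (form_mxE g_hom) scaler_sumr.
      rewrite exchange_big; apply: eq_bigr => j _ /=.
      have := congr1 (fun w : 'rV_n => w 0 j) cE; rewrite !mxE => ->.
      rewrite scaler_suml [RHS]big_mkcond; apply: eq_bigr => i _.
      rewrite !mxE; case: ifP => _; first by rewrite scalerA.
      by rewrite mulr0 scale0r.
    by apply: ideal_sum => // i _ lt_ik; apply: (idealZ _ Jid); apply: add_gens_form.
  (* Multiplication by zero from degree 0 to degree 1 is injective or surjective, which puts 1 or
     every variable in the ideal. *)
  have JX i : add_gens I g k 'X_i.
    have [inj|surj] := g_W ok 0%N.
      have J1 : add_gens I g k 1.
        by apply: inj; rewrite ?expr1 ?mulr1 //; apply: dhomog1.
      by rewrite -['X_i]mulr1; apply: JM.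
    have [f _ Jf] : exists2 f, f \is 0.-homog & add_gens I g k ('X_i - g ok ^+ 1 * f).
      by apply: surj; rewrite add0n dhomogX; apply/eqP; apply: mdeg1.
    by rewrite -['X_i](subrK (g ok ^+ 1 * f)); apply: JD => //;
      rewrite mulrC; apply: JM.
  have [j jU] : exists j, ~~ ((delta_mx 0 j : 'rV_n) <= lead_forms g k)%MS.
    apply/existsP; rewrite -negb_forall; apply/negP => /forallP allU.
    have full : (1%:M <= lead_forms g k)%MS.
      by apply/row_subP => j; rewrite rowE mulmx1; apply: allU.
    have := mxrankS full; rewrite mxrank1 leqNgt => /negP; apply.
    apply: (leq_ltn_trans _ lt_kn).
    pose A := \matrix_(i < k) row (widen_ord (ltnW lt_kn) i) (form_mx g).
    have sub : (lead_forms g k <= A)%MS.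
      apply/row_subP => i; have [lt_ik|le_ki] := ltnP i k.
        have -> : row i (lead_forms g k) = row (Ordinal lt_ik) A.
          rewrite rowK; apply/rowP => l; rewrite !mxE lt_ik.
          by congr (mcoeff _ (g _)); apply: val_inj.
        exact: row_sub.
      rewrite (_ : row i _ = 0) ?sub0mx //.
      by apply/rowP => l; rewrite !mxE ltnNge le_ki.
    by apply: leq_trans (mxrankS sub) _; apply: rank_leq_row.
  (* A variable outside the span replaces the dependent form; from index [k] on, every quotient
     vanishes in positive degree and all multiplications are surjective. *)
  pose g' i := if i == ok then 'X_j else g i.
  have gg' (i : 'I_n) : (i < k)%N -> g i = g' i.
    by rewrite /g'; case: eqP => // ->; rewrite /= ltnn.
  exists g'; split.
  - by move=> i; rewrite /g'; case: eqP => _ //;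
      rewrite dhomogX; apply/eqP; apply: mdeg1.
  - move=> i; have [lt_ik|le_ki] := ltnP i k.
      rewrite -gg' //; apply: WLP_ext (g_W i) => u.
      by split; apply: add_gens_eq => l lt_li; rewrite gg' //; apply: ltn_trans lt_ik.
    apply: WLP_vars => [|l]; first exact: add_gens_is_ideal.
    by apply: (add_gens_leq le_ki); apply: (add_gens_eq gg').
  have UE : lead_forms g' k = lead_forms g k.
    by apply/matrixP => i l; rewrite !mxE; case: ifP => // /gg' ->.
  apply: leq_ltn_trans rk _; rewrite -UE; apply: (@lead_forms_rank g' ok).
  rewrite UE; apply: contra jU; congr (_ <= _)%MS.
  by apply/rowP => l; rewrite !mxE /g' eqxx mcoeffXU /= eq_sym.
have [g [g_hom g_W rk]] := main n (leqnn n); exists g; split=> //.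
rewrite -row_full_unit /row_full eqn_leq rank_leq_col /=.
suff -> : form_mx g = lead_forms g n by [].
by apply/matrixP => i j; rewrite !mxE ltn_ord.
Qed.

End GoodForms.

Section HilbertFacts.
Context (K : fieldType) (n : nat) (I : {mpoly K[n]} -> Prop) (h : nat -> nat).
Context (Igr : graded_ideal I).
Context (hI : is_hilbert_function I h).

Lemma hilbert_eq0 t : (forall f, f \is t.-homog -> I f) -> h t = 0%N.
Proof.
move=> If; have [b [b_hom _ b_free]] := hI t.
case: (posnP (h t)) => // ht.
have I1 : I (\sum_a 1 *: b a).
  by apply: ideal_sum => [|a _ _]; [case: Igr | rewrite scale1r; apply/If/b_hom].
by have /eqP := b_free (fun=> 1) I1 (Ordinal ht); rewrite oner_eq0.
Qed.

Lemma hilbert_gt0 t : (0 < h t)%N -> exists2 f, f \is t.-homog & ~ I f.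
Proof.
move=> ht; apply: NNPP => no; suff h0 : h t = 0%N by rewrite h0 in ht.
apply: hilbert_eq0 => f hf; apply: NNPP => nf; apply: no; by exists f.
Qed.

Lemma hilbert_le1 : (h 0 <= 1)%N.
Proof.
rewrite leqNgt; apply/negP => h2; have [b [b_hom _ b_free]] := hI 0.
have [I0 _ _] : is_ideal I by case: Igr.
pose a0 := Ordinal (ltnW h2); pose a1 := Ordinal h2.
have sumE (c : 'I_(h 0) -> K) : (forall a, a != a0 -> a != a1 -> c a = 0) ->
    \sum_a c a *: b a = c a0 *: b a0 + c a1 *: b a1.
  move=> c0; rewrite (bigD1 a0) //= (bigD1 a1) //= big1 ?addr0 // => a /andP[n0 n1].
  by rewrite c0 // scale0r.
pose c a := if a == a0 then (b a1)@_0 else if a == a1 then - (b a0)@_0 else 0.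
have b0 a : (b a)@_0 = 0 -> False.
  move=> ba; have Ia : I (\sum_x (x == a)%:R *: b x).
    rewrite (bigD1 a) //= big1 => [|x /negbTE ->]; last by rewrite scale0r.
    by rewrite (homog0_const (b_hom a)) ba mpolyC0 scaler0 addr0.
  by have /eqP := b_free _ Ia a; rewrite eqxx oner_eq0.
apply: (b0 a1); suff Ic : I (\sum_a c a *: b a).
  by have := b_free c Ic a0; rewrite /c eqxx.
rewrite /c sumE => [|a /negbTE -> /negbTE -> //]; rewrite !eqxx.
rewrite (homog0_const (b_hom a0)) (homog0_const (b_hom a1)) !mcoeffC !eqxx !mulr1.
by rewrite /= -!mul_mpolyC -!mpolyCM mulrC mulNr mpolyCN subrr.
Qed.

(** Otherwise m + 1 forms of distinct degrees, nonzero modulo I, would satisfy a linear relation,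
    whose homogeneous components contradict the choice of the forms. *)
Lemma artinian_eventually0 : artinian I -> exists t, h t = 0%N.
Proof.
case=> m [b hb]; apply: NNPP => no.
have pos t : (0 < h t)%N by rewrite lt0n; apply/eqP => h0; apply: no; exists t.
have pick t : {u : {mpoly K[n]} | u \is t.-homog /\ ~ I u}.
  apply: constructive_indefinite_description.
  by have [u] := hilbert_gt0 (pos t); exists u.
pose u t := sval (pick t).
have u_hom t : u t \is t.-homog by rewrite /u; case: (pick t) => ? [].
have u_nI t : ~ I (u t) by rewrite /u; case: (pick t) => ? [].
have pickc t : {c | I (u t - \sum_a c a *: b a)}.
  exact: constructive_indefinite_description.
pose A := \matrix_(t < m.+1, a < m) sval (pickc t) a.
have [Iid Ihom] := Igr; have [I0 ID _] := Iid.
have [c cA c0] : exists2 c : 'rV_m.+1, c *m A = 0 & c != 0.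
  have : kermx A != 0.
    rewrite -mxrank_eq0 mxrank_ker -lt0n subn_gt0 ltnS.
    exact: rank_leq_col.
  by case/rowV0Pn => c /sub_kermxP cA c0; exists c.
have Ic : I (\sum_t c 0 t *: u t).
  have -> : \sum_t c 0 t *: u t =
      \sum_t c 0 t *: (u t - \sum_a sval (pickc t) a *: b a).
    under [RHS]eq_bigr do rewrite scalerBr; rewrite sumrB.
    suff -> : \sum_(t < m.+1) c 0 t *: (\sum_a sval (pickc t) a *: b a) = 0.
      by rewrite subr0.
    under eq_bigr do rewrite scaler_sumr; rewrite exchange_big big1 // => a _ /=.
    have := congr1 (fun w : 'rV_m => w 0 a) cA; rewrite !mxE => cAa.
    under eq_bigr do rewrite scalerA; rewrite -scaler_suml.
    have -> : \sum_(t < m.+1) c 0 t * sval (pickc t) a = 0; last by rewrite scale0r.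
    by rewrite -[RHS]cAa; apply: eq_bigr => t _; rewrite mxE.
  apply: ideal_sum => // t _ _; apply: (idealZ _ Iid); by case: (pickc t).
case/rV0Pn: c0 => t ct; apply: (u_nI t).
have := Ihom _ t Ic; rewrite linear_sum (bigD1 t) //= big1 => [|s st].
  rewrite addr0 linearZ /= pihomog_dE // => Ict.
  rewrite -[u t]scale1r -(mulVf ct) -scalerA; exact: (idealZ _ Iid).
by rewrite linearZ /= (pihomog_ne0 _ (u_hom s)) ?scaler0.
Qed.

End HilbertFacts.

(** * Extremality *)

Section TorBounds.
Context (K : fieldType) (n : nat) (I : {mpoly K[n]} -> Prop) (F : free_complex K n).
Context (h : nat -> nat) (g : 'I_n -> {mpoly K[n]}).
Context (Igr : graded_ideal I).
Context (hF : graded_free_resolution I F).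
Context (hI : is_hilbert_function I h).
Context (g_hom : forall i, g i \is 1.-homog).
Context (g_unit : form_mx g \in unitmx).
Context (hW : forall k : 'I_n, WLP (add_gens I g k) (g k)).

(** For k = n the forms generate the ideal of the variables, so the reduction of [F] is F (x) K. *)
Lemma tor_dimS_le i d : (tor_dim F i.+1 d <= tor_bound h n i d)%N.
Proof.
apply: (tor_dim_le hF (Z := @cyc K n F g n i d)) => [u /sub_kermxP uZ uP|].
  split=> [|b]; first exact: hproj_const.
  apply/(lin_ideal_full g_hom g_unit).
  have := congr1 (fun w : 'rV_ _ => w 0 b) uZ; rewrite !mxE => ub0; rewrite -[RHS]ub0.
  rewrite raddf_sum; apply: eq_bigr => a _ /=.
  by rewrite mxE mcoeffCM [in RHS]mxE.
have [M leM [b Zb hb]] := cyc_bound Igr hF hI g_hom g_unit hW i d (leqnn n).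
exists M => //; exists b => // z Zz; have [c [y hc]] := hb z Zz.
exists c; exists y; apply/rowP => a; rewrite [RHS]mxE mxE.
exact/(lin_ideal_full g_hom g_unit).
Qed.

(** The augmentation identifies position 0 with the quotient of R by I and all the forms, whose
    Hilbert function is the [n]-fold [dplus] of [h]. *)
Lemma tor_dim0_le d : (tor_dim F 0 d <= iter n dplus h d)%N.
Proof.
have [Iid _] := Igr; case: (hF) => _ haug hsurj hker _.
pose J := add_gens I g n; have [J0 JD JM] : is_ideal J := add_gens_is_ideal _ _ _.
have homaug : homogmx (@gfr_deg _ _ F 0) (fun _ : 'I_1 => 0%N) (gfr_aug F).
  by move=> a b _; exists (gfr_deg a) => //; rewrite [b]ord1; apply: haug.
pose Z (v : 'rV[{mpoly K[n]}]_(gfr_rank F 0)) := hproj (@gfr_deg _ _ F 0) d v = v.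
apply: (@tor_dim_le _ _ _ _ hF 0 d _ Z) => [u _ uP|];
  first exact: (hproj_const (i := 0) uP).
pose T (v : 'rV[{mpoly K[n]}]_(gfr_rank F 0)) (u : 'rV[{mpoly K[n]}]_1) :=
  J ((u - v *m gfr_aug F) 0 0).
rewrite -[iter _ _ _ _]addn0.
apply: (spanned_mod_ext (T := T) (Z0 := fun v => v = 0)
  (Z' := fun u : 'rV_1 => u 0 0 \is d.-homog) (B' := fun u => J (u 0 0))).
- split; first exact: hproj0.
  by move=> a u v hu hv; rewrite /Z hproj_is_additive hprojZ hu hv.
- split; first by exists 0; rewrite mul0mx subr0 map_mx0.
  move=> a u v [y hy] [y' hy']; exists (a%:MP *: y + y').
  rewrite mulmxDl -scalemxAl opprD addrACA -scalerBr raddfD /= hy' addr0.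
  apply/rowP => b; have := congr1 (fun w : 'rV_ _ => w 0 b) hy; rewrite !mxE => hyb.
  by rewrite mcoeffCM hyb mulr0.
- split; first by rewrite mxE.
  by move=> a u v Bu Bv; rewrite !mxE; apply: JD => //; apply: JM.
- by rewrite /T mul0mx subr0 mxE.
- move=> a z1 u1 z2 u2 h1 h2; rewrite /T.
  have := JD _ _ (JM a%:MP _ h1) h2; congr J.
  rewrite mulmxDl -scalemxAl; move: (z1 *m _) (z2 *m _) => x1 x2.
  by rewrite !mxE; ring.
- move=> z hz; exists (z *m gfr_aug F); last by rewrite /T subrr mxE.
  have := hproj_mulmx d z homaug; rewrite hz => /rowP/(_ 0).
  rewrite mxE /= subn0 => <-; exact: pihomogP.
- move=> z u _ Tz Bu; exists 0 => //; rewrite subr0.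
  have Jz : J ((z *m gfr_aug F) 0 0).
    have := ideal_sub (add_gens_is_ideal _ _ _) Bu Tz.
    by congr J; move: (z *m _) => x; rewrite !mxE; ring.
  have [l Ll Izl] := add_gens_split Iid Jz; have [v1 hv1] := hsurj 1.
  have /hker[y yE] : I (((z - l *: v1) *m gfr_aug F) 0 0).
    have [_ ID IM] := Iid; have := ID _ _ Izl (IM l _ hv1); congr I.
    rewrite mulmxBl -scalemxAl; move: (z *m _) (v1 *m _) => x1 x2.
    by rewrite !mxE; ring.
  exists y; rewrite -yE opprB addrCA subrr addr0.
  have l0 := (lin_ideal_full g_hom g_unit l).1 Ll.
  by apply/rowP => b; rewrite !mxE rmorphM /= l0 mul0r.
- by move=> z ->; apply: hproj0.
- have [b [b_hom hb _]] := section_hilbert Igr hI g_hom hW (leqnn n) d.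
  exists (iter n dplus h d) => //; exists (fun a => const_mx (b a)) => [a|u hu].
    by rewrite mxE.
  have [c hc] := hb _ hu; exists c; move: hc; congr J.
  rewrite !mxE summxE; congr (_ - _); apply: eq_bigr => a _.
  by rewrite !mxE mul_mpolyC.
apply: spanned_mod0 => z ->; exists 0.
by rewrite mul0mx subr0 map_mx0.
Qed.

Lemma section_full0 t : iter n dplus h t.+1 = 0%N.
Proof.
apply: (hilbert_eq0 (add_gens_graded g_hom n Igr)).
  exact: (section_hilbert Igr hI g_hom hW (leqnn n)).
move=> f hf; apply: lin_ideal_sub; first by case: Igr.
by apply/(lin_ideal_full g_hom g_unit); apply: homog_const0 hf.
Qed.

End TorBounds.

Lemma class_hilb (K : fieldType) n h (J : {mpoly K[n]} -> Prop) :
  lefschetz_class (kWLP n) h J ->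
  [/\ forall t, hilb n h 0 t.+1 = 0%N, (h 0 <= 1)%N
    & exists T, forall t, (T <= t)%N -> h t = 0%N].
Proof.
case=> Jgr Jart hJ /kWLP_unit[g [g_hom g_unit g_W]].
have hilb0 t : hilb n h 0 t.+1 = 0%N.
  by rewrite /hilb subn0; apply: (section_full0 Jgr hJ g_hom g_unit g_W).
split=> //; first exact: (hilbert_le1 Jgr hJ).
have [T hT] := artinian_eventually0 Jgr hJ Jart; exists T.
elim=> [|t IHt]; first by rewrite leqn0 => /eqP T0; rewrite T0 in hT.
rewrite leq_eqVlt => /orP[/eqP <- //|le_Tt].
have := hilb_persist hilb0 (leqnn n); rewrite hilb_full; apply.
exact: IHt.
Qed.

(** * Equality for the almost revlex ideal *)

Section StairBetti.
Context (K : fieldType) (n : nat) (h : nat -> nat) (F : free_complex K n).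
Context (hilb0 : forall t, hilb n h 0 t.+1 = 0%N).
Context (h0 : (h 0 <= 1)%N).
Local Notation I := (@stairI K n h n).
Context (hF : graded_free_resolution I F).

Let Igr : graded_ideal I. Proof. exact: stairI_graded. Qed.
Let hI : is_hilbert_function I h.
Proof. by have := stairI_hilbert K hilb0 h0 (leqnn n); rewrite hilb_full. Qed.

Lemma stair_tor_ge i T : (forall b : 'I_(gfr_rank F i.+1), (gfr_deg b < T)%N) ->
  (\sum_(d < T) tor_bound h n i d <= \sum_(d < T) tor_dim F i.+1 d)%N.
Proof.
move=> hT; apply: leq_trans (tor_bound_sum h T n i) _.
have -> : (\sum_(r < n) 'C(n - r.+1, i) *
    \sum_(e < T) (iter r dplus h e - iter r dplus h e.+1) = size (kfam K n h T n i))%N.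
  rewrite size_kfam (reindex_inj rev_ord_inj); apply: eq_bigr => r _ /=.
  rewrite subnSK // (subKn (ltnW _)) // size_corner //.
have [Iid _] := Igr; set N := size _.
pose z (a : 'I_N) := nth 0 (kfam K n h T n i) a.
rewrite -(leq_add2r (\rank (tensor_diff F i.+1))).
apply: leq_trans (tor_dim_sum hF hT); apply: (koszul_tor_lower Iid hF (z := z)).
  move=> a; rewrite /z -(lc_delta (ltn_ord a)).
  exact: (kfam_cycle hilb0 h0).
move=> c [w hw] a.
pose c' j := if insub j is Some b then c b else 0.
have cE (b : 'I_N) : c' b = c b by rewrite /c' valK.
rewrite -cE; apply: (kfam_free hilb0 h0 (leqnn n) (w := w) _ (ltn_ord a)).
move: hw; congr (kall _ (_ - _)).
by apply: eq_bigr => b _; rewrite cE.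
Qed.

(** A proper graded ideal contains no element with constant term. A differential of full rank would
    make the constant part of the augmentation vanish, and 1 could not be represented. *)
Lemma tensor_diff0_rank f : ~ I f -> (\rank (tensor_diff F 0) < gfr_rank F 0)%N.
Proof.
move=> nIf; have [Iid Ihom] := Igr; case: (hF) => _ _ hsurj hker _.
have I_const u : I u -> u@_0 = 0.
  move=> Iu; apply/eqP/negPn/negP => u0; apply: nIf.
  apply: (ideal_const f Iid u0); have := Ihom u 0%N Iu.
  rewrite [X in I X](homog0_const (pihomogP _ _ _)); congr (I _%:MP).
  elim/mpolyind: (u) => [|c m p _ _ IHp]; first by rewrite linear0.
  rewrite pihomogD !mcoeffD IHp [pihomog _ _ (c *: _)]linearZ /=.
  rewrite !mcoeffZ pihomogX /= mdeg_eq0.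
  by case: eqP => // /eqP/negbTE m0; rewrite mcoeffX m0 mcoeff0.
pose alpha := map_mx (mcoeff (0%MM : 'X_{1..n})) (gfr_aug F).
have tda : tensor_diff F 0 *m alpha = 0.
  rewrite -map_mxM; apply/matrixP => a b; rewrite [b]ord1 [LHS]mxE [RHS]mxE.
  apply: I_const.
  have -> : (gfr_diff F 0 *m gfr_aug F) a 0 = (row a (gfr_diff F 0) *m gfr_aug F) 0 0.
    by rewrite -row_mul [RHS]mxE.
  by apply/hker; exists (delta_mx 0 a); rewrite rowE.
rewrite ltn_neqAle rank_leq_col andbT; apply/negP => full.
have a0 : alpha = 0.
  have /row_fullP[B BE] : row_full (tensor_diff F 0) by [].
  by rewrite -[alpha]mul1mx -BE -mulmxA tda mulmx0.
have [v hv] := hsurj 1; have := I_const _ hv.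
have -> : (1 - (v *m gfr_aug F) 0 0)@_0 = 1.
  rewrite mcoeffB mcoeff1 eqxx mxE raddf_sum big1 ?subr0 // => b _ /=.
  have := congr1 (fun w : 'cV_ _ => w b 0) a0; rewrite !mxE rmorphM /= => ->.
  by rewrite mulr0.
by move/eqP; rewrite oner_eq0.
Qed.

(** Termwise upper bounds whose sum is attained are equalities; [T] is taken beyond [d] and all
    basis degrees. In position 0 only degree 0 contributes. *)
Lemma stair_tor i d :
  tor_dim F i d = if i is j.+1 then tor_bound h n j d else iter n dplus h d.
Proof.
have [g [g_hom g_unit g_W]] := kWLP_unit (kSLP_kWLP (stairI_kSLP K hilb0 h0)).
have [T [dT degT]] : exists T,
    (d < T)%N /\ forall b : 'I_(gfr_rank F i), (gfr_deg b < T)%N.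
  exists (d.+1 + \sum_(b < gfr_rank F i) (gfr_deg b).+1)%N.
  split; first by rewrite leq_addr.
  by move=> b; rewrite (bigD1 b) //= addnCA leq_addr.
case: i degT => [|i] degT; last first.
  have le e : (tor_dim F i.+1 e <= tor_bound h n i e)%N.
    exact: (tor_dimS_le Igr hF hI g_hom g_unit g_W).
  have := leqif_sum (fun (e : 'I_T) (_ : true) => leqif_eq (le e)).
  case=> _; rewrite eqn_leq stair_tor_ge // andbT leq_sum // => /esym/forallP.
  by move/(_ (Ordinal dT))/eqP.
have le e : (tor_dim F 0 e <= iter n dplus h e)%N.
  exact: (tor_dim0_le Igr hF hI g_hom g_unit g_W).
apply/eqP; rewrite eqn_leq le /=.
case: d dT => [|d] dT; last first.
  by rewrite (section_full0 Igr hI g_hom g_unit g_W).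
have -> : iter n dplus h 0 = h 0 by elim: (n) => //= k ->.
case: (posnP (h 0)) => [-> //|h_pos]; apply: leq_trans h0 _.
have [f _ nIf] := hilbert_gt0 Igr hI h_pos.
have := tor_dim_sum hF degT; rewrite mxrank1.
case: T dT degT => // T _ _; rewrite big_ord_recl big1 => [|e _].
  by move/(leq_trans (tensor_diff0_rank nIf));
    rewrite addn0 -[X in (X < _)%N]add0n ltn_add2r.
by apply/eqP; rewrite -leqn0; apply: leq_trans (le _) _;
  rewrite (section_full0 Igr hI g_hom g_unit g_W).
Qed.

End StairBetti.

(** The resolution behind [epsilon] is unspecified, so the estimates of [tor_dim] are proved for
    arbitrary resolutions. *)
Lemma graded_bettiP (K : fieldType) n (I : {mpoly K[n]} -> Prop) i d : graded_ideal I ->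
  exists2 F, graded_free_resolution I F & graded_betti I i d = tor_dim F i d.
Proof.
move=> /graded_free_resolution_exists[F hF].
have ex : exists b, exists2 F, graded_free_resolution I F & b = tor_dim F i d.
  by exists (tor_dim F i d), F.
exact: (epsilon_spec (inhabits 0%N) _ ex).
Qed.

(** Stated for any property between the n-SLP and the n-WLP: members of the class satisfy the upper
    bounds by the weaker property, and [stairI] belongs to it by the stronger one. *)
Lemma stair_max_betti (K : fieldType) n h (C : ({mpoly K[n]} -> Prop) -> Prop) :
  (forall J, C J -> kWLP n J) -> (forall J, kSLP n J -> C J) ->
  (exists J : {mpoly K[n]} -> Prop, lefschetz_class C h J) ->
  the_almost_revlex_ideal h (fun I => max_betti_in (lefschetz_class C h) I).
Proof.
move=> CW SC [J [Jgr Jart hJ CJ]].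
have [hilb0 h0 [T hT]] : [/\ forall t, hilb n h 0 t.+1 = 0%N, (h 0 <= 1)%N
    & exists T, forall t, (T <= t)%N -> h t = 0%N].
  by apply: (@class_hilb K n h J); split=> //; apply: CW.
pose I := @stairI K n h n.
have Igr : graded_ideal I by apply: stairI_graded.
have hI : is_hilbert_function I h.
  by have := stairI_hilbert K hilb0 h0 (leqnn n); rewrite hilb_full.
exists I; split=> //; first exact: stairI_almost_revlex.
  move=> I' I'rev hI' f; apply: (almost_revlex_unique I'rev) hI' hI f.
  exact: stairI_almost_revlex.
split; first by split=> //; [apply: stairI_artinian hT | apply: SC; apply: stairI_kSLP].
move=> I' [I'gr _ hI' /CW/kWLP_unit[g [g_hom g_unit g_W]]] i j.
have [F hF ->] := graded_bettiP i (i + j) Igr.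
have [F' hF' ->] := graded_bettiP i (i + j) I'gr.
rewrite (stair_tor hilb0 h0 hF); case: i => [|i].
  exact: (tor_dim0_le I'gr hF' hI' g_hom g_unit g_W).
exact: (tor_dimS_le I'gr hF' hI' g_hom g_unit g_W).
Qed.

Theorem corollary55 (K : fieldType) (char0 : [pchar K] =i pred0)
    (n : nat) (h : nat -> nat) :
  ((exists J : {mpoly K[n]} -> Prop, lefschetz_class (kWLP n) h J) ->
   the_almost_revlex_ideal h
     (fun I : {mpoly K[n]} -> Prop =>
        max_betti_in (lefschetz_class (kWLP n) h) I)) /\
  ((exists J : {mpoly K[n]} -> Prop, lefschetz_class (kSLP n) h J) ->
   the_almost_revlex_ideal h
     (fun I : {mpoly K[n]} -> Prop =>
        max_betti_in (lefschetz_class (kSLP n) h) I)).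
Proof.
by split; apply: stair_max_betti => // J; apply: kSLP_kWLP.
Qed.
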